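(* Assume condition (C3) holds (with constants $T_3,c_3,\alpha_3$) and $A=0$. Let $\nu_s$ be a symmetric Lévy measure on $\mathbb{R}^d$ and suppose there is $a_1\in(0,1]$ with $a_1\nu_s(B)\le N(B)$ for all Borel $B$, and $a_2\in[1,\infty)$ such that $\mathrm{Re}[\Psi(x)]\le a_2\,\mathrm{Re}[\Psi_s(x)]$ for all $|x|>1/T_3$. Then for all $T,\theta>0$ there is a constant $\tilde c>0$ depending only on $d,\alpha_3,c_3,T_3,a_1,a_2,\nu_s,T,\theta$ such that for all $0<t<T$ and $|x|\le\theta h_s^{-1}(1/t)$, $$p(t,x+t b_{h_s^{-1}(1/t)})\ge\tilde c\,[h_s^{-1}(1/t)]^{-d}.$$ If $T_3=\infty$, then this holds with $T=\infty$ and some $\tilde c>0$.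
   Context: $Y$ is a Lévy process in $\mathbb{R}^d$ with generating triplet $(A,N,b)$ ($A$ symmetric non-negative definite, $b\in\mathbb{R}^d$, $N$ Lévy measure), characteristic exponent $\Psi$ ($\mathbb{E}e^{i\langle x,Y_t\rangle}=e^{-t\Psi(x)}$), $\Psi^*(r)=\sup_{|z|\le r}\mathrm{Re}\,\Psi(z)$, $b_r=b+\int z(\mathbf{1}_{|z|<r}-\mathbf{1}_{|z|<1})N(dz)$, $p(t,x)$ the density of $Y_t$. Condition (C3): there are $T_3\in(0,\infty]$, $c_3\in(0,1]$, $\alpha_3\in(0,2]$ with $c_3\Psi^*(|x|)\le\mathrm{Re}\Psi(x)$ for all $|x|>1/T_3$ and $\Psi^*(\lambda r)\ge c_3\lambda^{\alpha_3}\Psi^*(r)$ for all $\lambda\ge1$, $r>1/T_3$ ($1/\infty=0$). $\Psi_s$ and $h_s$ are the characteristic exponent and $h$-function of the triplet $(0,\nu_s,0)$: $\Psi_s(x)=\int(1-\cos\langle x,z\rangle)\nu_s(dz)$, $h_s(r)=\int(1\wedge|z|^2/r^2)\nu_s(dz)$; $h_s^{-1}$ is the inverse of the (continuous, strictly decreasing, unbounded under the hypotheses) function $h_s$. *)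

(* Defs.v *)
(* mathcomp-analysis, points of R^d are d.-tuple R
   (carrying the product = Borel sigma-algebra from measurable_structure). *)
From mathcomp Require Import all_boot all_order all_algebra.
From mathcomp Require Import all_classical all_reals all_analysis.
Import Order.TTheory GRing.Theory Num.Theory.
Set Implicit Arguments. Unset Strict Implicit. Unset Printing Implicit Defensive.
Local Open Scope ring_scope.
Local Open Scope classical_set_scope.

Section Defs.
Variable R : realType.
Variable d : nat.
Notation vec := (d.-tuple R).

Definition dotv (x y : vec) : R := \sum_(i < d) tnth x i * tnth y i.
Definition enorm (x : vec) : R := Num.sqrt (\sum_(i < d) tnth x i ^+ 2).
Definition vzero : vec := [tuple (0 : R) | i < d].
Definition vadd (x y : vec) : vec := [tuple tnth x i + tnth y i | i < d].
Definition vscale (a : R) (x : vec) : vec := [tuple a * tnth x i | i < d].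
Definition vopp (x : vec) : vec := [tuple - tnth x i | i < d].

Definition levy_measure (N : {measure set vec -> \bar R}) : Prop :=
  N [set vzero] = 0%E /\
  (\int[N]_z (Num.min 1 (enorm z ^+ 2))%:E < +oo)%E.

Definition symmetric_measure (N : {measure set vec -> \bar R}) : Prop :=
  forall B : set vec, measurable B -> N (vopp @^-1` B) = N B.

(* Characteristic exponent of the triplet (0, N, b):
   Psi(x) = - i<b,x> + \int (1 - e^{i<x,z>} + i<x,z> 1_{|z|<1}) N(dz). *)
Definition RePsi (N : {measure set vec -> \bar R}) (x : vec) : R :=
  fine (\int[N]_z (1 - cos (dotv x z))%:E).
Definition ImPsi (N : {measure set vec -> \bar R}) (b : vec) (x : vec) : R :=
  - dotv b x
  - fine (\int[N]_z (sin (dotv x z) - dotv x z * (if enorm z < 1 then 1 else 0))%:E).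

Definition Psistar (N : {measure set vec -> \bar R}) (r : R) : R :=
  sup [set RePsi N z | z in [set z | enorm z <= r]].

Definition bshift (N : {measure set vec -> \bar R}) (b : vec) (r : R) : vec :=
  [tuple tnth b i + fine (\int[N]_z
      (tnth z i * ((if enorm z < r then 1 else 0) - (if enorm z < 1 then 1 else 0)))%:E) | i < d].

Definition hfun (nu : {measure set vec -> \bar R}) (r : R) : R :=
  fine (\int[nu]_z (Num.min 1 (enorm z ^+ 2 / r ^+ 2))%:E).

End Defs.

Definition einv (R : realType) (T : \bar R) : R :=
  match T with EFin r => r^-1 | _ => 0 end.

(* Iterated Lebesgue integral over R^n of a function of n.-tuple R; for
   nonnegative measurable integrands this is the Lebesgue integral on R^n
   (Tonelli). *)
Fixpoint liint (R : realType) (n : nat) : (n.-tuple R -> \bar R) -> \bar R :=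
  match n return (n.-tuple R -> \bar R) -> \bar R with
  | 0 => fun f => f [tuple]
  | n'.+1 => fun f =>
      (\int[@lebesgue_measure R]_x liint (fun y => f (cons_tuple x y)))%E
  end.

Definition cond_C3 (R : realType) (d : nat)
  (N : {measure set d.-tuple R -> \bar R}) (T3 : \bar R) (c3 a3 : R) : Prop :=
  (0 < T3)%E /\ 0 < c3 <= 1 /\ 0 < a3 <= 2 /\
  (forall x : d.-tuple R, einv T3 < enorm x ->
      c3 * Psistar N (enorm x) <= RePsi N x) /\
  (forall lam r : R, 1 <= lam -> einv T3 < r ->
      c3 * lam `^ a3 * Psistar N r <= Psistar N (lam * r)).

(* p(t, .) is the (continuous version of the) density of Y_t, where Y is the
   Levy process with triplet (0, N, b): p(t,.) >= 0, continuous, and its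
   Fourier transform is \int e^{i<xi,x>} p(t,x) dx = e^{-t Psi(xi)}
   (real and imaginary parts written separately; signed integrands split
   into positive and negative parts). *)
Definition levy_density (R : realType) (d : nat)
  (N : {measure set d.-tuple R -> \bar R}) (b : d.-tuple R)
  (p : R -> d.-tuple R -> R) : Prop :=
  forall t : R, 0 < t ->
  (forall x, 0 <= p t x) /\
  (forall x (e : R), 0 < e -> exists2 del : R, 0 < del &
      forall y, enorm (vadd x (vopp y)) < del -> `|p t x - p t y| < e) /\
  (forall xi : d.-tuple R,
     (liint (fun x => (p t x * Num.max (cos (dotv xi x)) 0)%:E)
      - liint (fun x => (p t x * Num.max (- cos (dotv xi x)) 0)%:E))%E
       = (expR (- t * RePsi N xi) * cos (t * ImPsi N b xi))%:E /\
     (liint (fun x => (p t x * Num.max (sin (dotv xi x)) 0)%:E)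
      - liint (fun x => (p t x * Num.max (- sin (dotv xi x)) 0)%:E))%E
       = (- (expR (- t * RePsi N xi) * sin (t * ImPsi N b xi)))%:E).

(* Main.v *)
(** The Fourier integrand of the density at x + t b_r, stripped of the jumps of size >= r,
    is E(xi) e^(-u(xi)), where u is a1 t times the exponent of the jumps of nu_s of size < r;
    dropping the large jumps costs the factor e^(-t N(|z| >= r)). Since N - s a1 nu_s is a
    Levy measure for s in [0, 1], every E e^(-su) is positive definite. For s in [1/4, 1/2]
    the function e^(-(1-s)u) - c k, with k a Fejer kernel of width 1 / r, is positive definite
    too, hence G := \int E e^(-u) >= c \int E k e^(-su). So if G were much smaller than
    r^(-d), then t |-> \int E k e^(-tu) would be small on [1/4, 1/2]; being a Laplace
    transform, it would stay small at any fixed later time T, because v^(3m) is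
    exponentially close on [0, 1] to a polynomial of degree 2m. But for T large the integral
    concentrates near xi = 0, where E is close to 1, and it is of order r^(-d).
    Condition (C3) enters through the growth of u and the bound on t h_N(r). *)
From HB Require Import structures.
Require Import Defs.
From mathcomp Require Import all_boot all_order all_algebra.
From mathcomp Require Import all_classical all_reals all_analysis.
From mathcomp Require Import measurable_realfun complex ring lra.
Import Order.TTheory GRing.Theory Num.Theory.
Import numFieldNormedType.Exports.
Local Open Scope ring_scope.
Local Open Scope classical_set_scope.
Set Implicit Arguments.
Unset Strict Implicit.
Unset Printing Implicit Defensive.


(** * Real-valued integrals *)

(** What blocks a direct estimate is the sign of E: it is close to 1 only for small r |xi|, it
    contains the phase of x with |x| up to theta r, and the integral at time 1 does not concentrate
    near 0. Letting only the clock of u run, with E frozen, gives an integral that can be estimated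
    for large T, but positive definiteness is at hand only up to s = 1; the extrapolation bridges
    this gap. It is quantitative, so that one constant serves all N, b and p, which positivity of
    each single density would not give. The window [1/4, 1/2] leaves time 1 - s >= 1/2 from which
    the kernel is split off, while every exponential in use carries at least e^(-u/8), whose
    integrability and second moment are the decay drawn from (C3). If T3 is finite, r may exceed T3,
    and 1/r is then no admissible frequency for (C3); a reference frequency Q, comparable to 1/r,
    replaces it. The density is reached without inverting e^(-t Psi): its averages over small boxes
    are bounded from below. *)

Definition rint d (T : measurableType d) (R : realType)
  (mu : {measure set T -> \bar R}) (f : T -> R) : Prop :=
  mu.-integrable setT (EFin \o f).

Section real_integrals.
Context d (T : measurableType d) (R : realType) (mu : {measure set T -> \bar R}).
Implicit Types f g : T -> R.

Lemma rint_meas f : rint mu f -> measurable_fun setT f.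
Proof. by move=> /(measurable_int mu)/measurable_EFinP. Qed.

Lemma rint_dom f g : measurable_fun setT f -> rint mu g ->
  (forall x, `|f x| <= g x) -> rint mu f.
Proof.
move=> mf ig fg; apply: (le_integrable _ _ _ ig) => //.
- exact/measurable_EFinP.
- by move=> x _ /=; rewrite lee_fin (le_trans (fg x))// ler_norm.
Qed.

Lemma rintD f g : rint mu f -> rint mu g -> rint mu (fun x => f x + g x).
Proof.
move=> iF ig; rewrite /rint (_ : _ \o _ = (EFin \o f) \+ (EFin \o g))%E.
  exact: integrableD.
by apply/funext => x /=; rewrite EFinD.
Qed.

Lemma rintZ c f : rint mu f -> rint mu (fun x => c * f x).
Proof.
move=> iF; rewrite /rint (_ : _ \o _ = fun x => (c%:E * (EFin \o f) x)%E).
  exact: integrableZl.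
by apply/funext => x /=; rewrite EFinM.
Qed.

Lemma rintN f : rint mu f -> rint mu (fun x => - f x).
Proof.
by move=> /(rintZ (-1)); congr (rint _ _); apply/funext => x; rewrite mulN1r.
Qed.

Lemma rintB f g : rint mu f -> rint mu g -> rint mu (fun x => f x - g x).
Proof. by move=> iF ig; apply: rintD => //; exact: rintN. Qed.

Lemma rint_norm f : rint mu f -> rint mu (fun x => `|f x|).
Proof. by move=> iF; exact: integrable_norm. Qed.

Lemma rintM f g C : rint mu f -> measurable_fun setT g ->
  (forall x, `|g x| <= C) -> rint mu (fun x => f x * g x).
Proof.
move=> iF mg gC; apply: (@rint_dom _ (fun x => C * `|f x|)).
- by apply: measurable_funM => //; exact: rint_meas.
- exact/rintZ/rint_norm.
- by move=> x; rewrite normrM mulrC ler_wpM2r.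
Qed.

Lemma rint_ge0 f : measurable_fun setT f -> (forall x, 0 <= f x) ->
  (\int[mu]_x (f x)%:E < +oo)%E -> rint mu f.
Proof.
move=> mf f0 fi; apply/integrableP; split; first exact/measurable_EFinP.
by under eq_integral do rewrite /= ger0_norm//.
Qed.

Lemma rintE f : rint mu f -> (\int[mu]_x (f x)%:E = (\int[mu]_x f x)%R%:E)%E.
Proof. by move=> iF; rewrite /Rintegral fineK//; exact: integrable_fin_num. Qed.

Lemma IntD f g : rint mu f -> rint mu g ->
  \int[mu]_x (f x + g x) = \int[mu]_x f x + \int[mu]_x g x.
Proof. by move=> iF ig; rewrite RintegralD. Qed.

Lemma IntB f g : rint mu f -> rint mu g ->
  \int[mu]_x (f x - g x) = \int[mu]_x f x - \int[mu]_x g x.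
Proof. by move=> iF ig; rewrite RintegralB. Qed.

Lemma IntZ c f : rint mu f -> \int[mu]_x (c * f x) = c * \int[mu]_x f x.
Proof. by move=> iF; rewrite RintegralZl. Qed.

Lemma IntN f : rint mu f -> \int[mu]_x (- f x) = - \int[mu]_x f x.
Proof.
move=> iF; rewrite -mulN1r -IntZ//.
by apply: eq_Rintegral => x _; rewrite mulN1r.
Qed.

Lemma le_Int f g : rint mu f -> rint mu g -> (forall x, f x <= g x) ->
  \int[mu]_x f x <= \int[mu]_x g x.
Proof. by move=> iF ig fg; exact: le_Rintegral. Qed.

Lemma Int_ge0 f : (forall x, 0 <= f x) -> 0 <= \int[mu]_x f x.
Proof. by move=> f0; exact: Rintegral_ge0. Qed.

Lemma eq_Int f g : f =1 g -> \int[mu]_x f x = \int[mu]_x g x.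
Proof. by move=> fg; exact: eq_Rintegral. Qed.

Lemma norm_Int_le f g : rint mu f -> rint mu g -> (forall x, `|f x| <= g x) ->
  `|\int[mu]_x f x| <= \int[mu]_x g x.
Proof.
move=> iF ig fg; apply: (le_trans (le_normr_Rintegral measurableT iF)).
exact: (le_Int (rint_norm iF) ig fg).
Qed.

Lemma rint_sum (I : Type) (s : seq I) (F : I -> T -> R) :
  (forall i, rint mu (F i)) -> rint mu (fun x => \sum_(i <- s) F i x).
Proof.
move=> iF; elim: s => [|i s IH].
  apply: (@rint_dom _ (fun x => 0)) => //=.
  - by under eq_fun do rewrite big_nil; exact: measurable_cst.
  - exact: integrable0.
  - by move=> x; rewrite big_nil normr0.
by under eq_fun do rewrite big_cons; exact: rintD.
Qed.

Lemma Int_sum (I : Type) (s : seq I) (F : I -> T -> R) :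
  (forall i, rint mu (F i)) ->
  \int[mu]_x (\sum_(i <- s) F i x) = \sum_(i <- s) \int[mu]_x F i x.
Proof.
move=> iF; elim: s => [|i s IH].
  under eq_Int do rewrite big_nil.
  by rewrite big_nil Rintegral_cst// mul0r.
under eq_Int do rewrite big_cons.
by rewrite IntD// ?IH ?big_cons//; exact: rint_sum.
Qed.

Lemma Int_cvg (f_ : nat -> T -> R) f g :
  (forall n, measurable_fun setT (f_ n)) -> measurable_fun setT f ->
  (forall x, f_ n x @[n --> \oo] --> f x) -> rint mu g ->
  (forall n x, `|f_ n x| <= g x) ->
  rint mu f /\ \int[mu]_x f_ n x @[n --> \oo] --> \int[mu]_x f x.
Proof.
move=> mf_ mf ff ig fg.
have [|/= | | | |i1 _ i2] := @dominated_convergence _ _ _ mu setT measurableT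
    (fun n x => (f_ n x)%:E) (fun x => (f x)%:E) (fun x => (g x)%:E).
- by move=> n; exact/measurable_EFinP.
- exact/measurable_EFinP.
- by apply: aeW => x _; apply: cvg_EFin; [exact: nearW|exact: ff].
- exact: ig.
- by apply: aeW => x n _; rewrite /= lee_fin.
split => //; apply: fine_cvg.
rewrite -/(Rintegral _ _ _) -rintE//.
Qed.

End real_integrals.

(** * Fubini and Lebesgue measure on R^n *)

Section fubini_dominated.
Context d1 d2 (T1 : measurableType d1) (T2 : measurableType d2) (R : realType).
Variables (m1 : {sigma_finite_measure set T1 -> \bar R})
          (m2 : {sigma_finite_measure set T2 -> \bar R}).

(** A product majorant g(x) h(y) is the only form of domination that the proof meets, and it yields
    integrability of all sections and partial integrals at once. *)
Lemma fubini_dom (f : T1 * T2 -> R) (g : T1 -> R) (h : T2 -> R) :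
  measurable_fun setT f -> rint m1 g -> rint m2 h ->
  (forall x y, `|f (x, y)| <= g x * h y) ->
  [/\ forall x, rint m2 (fun y => f (x, y)),
      forall y, rint m1 (fun x => f (x, y)),
      rint m1 (fun x => \int[m2]_y f (x, y)),
      rint m2 (fun y => \int[m1]_x f (x, y)) &
      \int[m1]_x (\int[m2]_y f (x, y)) = \int[m2]_y (\int[m1]_x f (x, y)) ].
Proof.
move=> mf ig ih fgh.
have r2 x : rint m2 (fun y => f (x, y)).
  apply: (rint_dom _ (rintZ (g x) ih)); last exact: fgh.
  exact: measurableT_comp.
have r1 y : rint m1 (fun x => f (x, y)).
  apply: (@rint_dom _ _ _ _ _ (fun x => h y * g x)); last first.
  - by move=> x; rewrite mulrC.
  - exact: rintZ.
  - exact: measurableT_comp.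
have iF : (m1 \x m2)%E.-integrable setT (EFin \o f).
  apply/integrable12ltyP; first exact/measurable_EFinP.
  apply: (@le_lt_trans _ _ (\int[m1]_x (`|g x| * \int[m2]_y `|h y|)%:E)%E).
    apply: ge0_le_integral => //.
    - by move=> x _; exact: integral_ge0.
    - apply: (measurable_fun_fubini_tonelli_F (abse \o (EFin \o f))) => [|x] //=.
      by apply: measurableT_comp => //; exact/measurable_EFinP.
    - apply/measurable_EFinP/measurable_funM => //.
      by apply: measurableT_comp => //; exact: rint_meas ig.
    - move=> x _.
      rewrite EFinM -rintE; last exact: rint_norm.
      rewrite -ge0_integralZl//; last first.
        by apply/measurable_EFinP; apply: measurableT_comp => //; exact: rint_meas ih.
      apply: ge0_le_integral => //=.
      + by apply/measurable_EFinP; apply: measurableT_comp => //; exact: rint_meas (r2 x).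
      + apply/measurable_EFinP/measurable_funM => //.
        by apply: measurableT_comp => //; exact: rint_meas ih.
      + by move=> y _; rewrite lee_fin (le_trans (fgh x y))// -normrM ler_norm.
  have : rint m1 (fun x => `|g x| * \int[m2]_y `|h y|).
    under eq_fun do rewrite mulrC.
    by apply: rintZ; exact: rint_norm.
  by move=> i1; rewrite (rintE i1) ltry.
have eF x : (\int[m2]_y (f (x, y))%:E = (\int[m2]_y f (x, y))%R%:E)%E.
  exact: rintE (r2 x).
have eG y : (\int[m1]_x (f (x, y))%:E = (\int[m1]_x f (x, y))%R%:E)%E.
  exact: rintE (r1 y).
have i1 : rint m1 (fun x => \int[m2]_y f (x, y)).
  have := integrable_fubini_F iF; congr (_.-integrable _ _).
  by apply/funext => x; rewrite /fubini_F /= eF.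
have i2 : rint m2 (fun y => \int[m1]_x f (x, y)).
  apply: (rint_dom _ (rintZ (\int[m1]_x g x) ih)).
    apply/measurable_EFinP; have := measurable_fubini_G iF.
    by congr measurable_fun; apply/funext => y; rewrite /fubini_G /= eG.
  move=> y; rewrite -[leRHS]mulrC -IntZ//.
  apply: norm_Int_le => //; first exact: rintZ.
  by move=> x; rewrite mulrC.
split => //.
rewrite {1 3}/Rintegral; congr fine.
under eq_integral do rewrite -eF.
under [RHS]eq_integral do rewrite -eG.
exact: Fubini iF.
Qed.

End fubini_dominated.

Section sigma_finite_pack.
Context d (T : measurableType d) (R : realType) (mu : {measure set T -> \bar R}).

(** The proof argument is kept in the term so that the structure instance below can read
    sigma-finiteness off it; the set function stays convertible to [mu]. *)
Definition sigma_finite_pack of sigma_finite setT mu : set T -> \bar R := mu.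

Hypothesis sf : sigma_finite setT mu.

HB.instance Definition _ := Measure.copy (sigma_finite_pack sf) mu.
HB.instance Definition _ :=
  Measure_isSigmaFinite.Build _ _ _ (sigma_finite_pack sf) sf.

End sigma_finite_pack.

Section product_lebesgue.
Context {R : realType}.

Definition mcons n (q : measurableTypeR R * n.-tuple R) : n.+1.-tuple R := cons_tuple q.1 q.2.

Lemma measurable_mcons n : measurable_fun setT (@mcons n).
Proof.
exact: (@measurable_cons _ _ (measurableTypeR R * n.-tuple R)%type R fst n snd).
Qed.

Lemma sigma_finite_pushforward_mcons n
  (m : {sigma_finite_measure set n.-tuple R -> \bar R}) :
  sigma_finite setT (pushforward (@lebesgue_measure R \x m)%E (@mcons n)).
Proof.
have [F FT Ffin] := sigma_finiteT (@lebesgue_measure R).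
have [G GT Gfin] := sigma_finiteT m.
pose un (q : n.+1.-tuple R) : measurableTypeR R * n.-tuple R := (thead q, [tuple of behead q]).
have unK (q : measurableTypeR R * n.-tuple R) : un (mcons q) = q.
  case: q => x y; rewrite /un /mcons /= theadE; congr pair.
  by apply/val_inj.
have mun : measurable_fun setT un.
  apply: measurable_fun_pair; last exact: measurable_behead.
  exact: measurable_tnth.
(* A countable cover by product sets, listed through codes of index pairs; a number that codes no
   pair gets the empty set. *)
pose H k := match unpickle k with Some ij => F ij.1 `*` G ij.2 | None => set0 end.
have mH k : measurable (H k).
  rewrite /H; case: unpickle => [[i j]|] //=.
  by apply: measurableX; [have [] := Ffin i|have [] := Gfin j].
exists (fun k => un @^-1` H k).
  rewrite -preimage_bigcup; apply/esym/seteqP; split => // q _ /=.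
  have [i _ Fi] : (\bigcup_i F i) (un q).1 by rewrite -FT.
  have [j _ Gj] : (\bigcup_i G i) (un q).2 by rewrite -GT.
  by exists (pickle (i, j)) => //; rewrite /H pickleK.
move=> k; split; first by have := mun measurableT _ (mH k); rewrite setTI.
rewrite /pushforward -comp_preimage.
rewrite (_ : _ \o _ = id); last exact/funext.
rewrite /= /H; case: unpickle => [[i j]|] /=; last by rewrite measure0.
have [mF Fi] := Ffin i; have [mG Gj] := Gfin j.
rewrite product_measure1E//.
by apply: lte_mul_pinfty => //; rewrite ge0_fin_numE.
Qed.

(** Turns the iterated integral [liint] into an integral against one measure, built by pushing
    Lebesgue measure times the previous one along [mcons], with a Dirac mass as the base case. A
    sigma type, since the measure itself is extracted as [leb]. *)
Lemma product_lebesgue_sig n :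
  {m : {sigma_finite_measure set n.-tuple R -> \bar R} |
    forall f : n.-tuple R -> \bar R, measurable_fun setT f ->
      (forall x, 0 <= f x)%E -> (\int[m]_x f x = liint f)%E}.
Proof.
elim: n => [|n [m IH]].
  exists (dirac ([tuple] : 0.-tuple R)) => f mf f0.
  by rewrite integral_dirac// diracT mul1e.
pose M := measure_function_pushforward__canonical__measure_function_Measure
  (@lebesgue_measure R \x m)%E (@measurable_mcons n).
have sM : sigma_finite setT M by exact: sigma_finite_pushforward_mcons.
exists (sigma_finite_pack sM) => f mf f0.
transitivity (\int[M]_x f x)%E; first exact: eq_measure_integral.
have mfc : measurable_fun setT (f \o @mcons n).
  by apply: measurableT_comp => //; exact: measurable_mcons.
transitivity (\int[(@lebesgue_measure R \x m)%E]_q (f (mcons q)))%E.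
  have := @ge0_integral_pushforward _ _ _ _ _ _ (@measurable_mcons n)
    (@lebesgue_measure R \x m)%E setT f measurableT mf (fun x _ => f0 x).
  by rewrite preimage_setT; apply.
rewrite (fubini_tonelli1 (f \o @mcons n))//=.
apply: eq_integral => x _; rewrite /fubini_F -IH//.
exact: (measurable_fun_pair2 x mfc).
Qed.

Definition leb n : {sigma_finite_measure set n.-tuple R -> \bar R} :=
  sval (product_lebesgue_sig n).

Lemma leb_liint n (f : n.-tuple R -> \bar R) : measurable_fun setT f ->
  (forall x, 0 <= f x)%E -> (\int[leb n]_x f x = liint f)%E.
Proof. exact: (svalP (product_lebesgue_sig n)). Qed.

End product_lebesgue.
Arguments leb {R} n.

Section lebesgue_line.
Context {R : realType}.
Notation mu := (@lebesgue_measure R).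
Implicit Types f : R -> R.

Lemma continuous_rmeas (f : R -> R) : continuous f ->
  measurable_fun setT (f : measurableTypeR R -> R).
Proof. by move=> cf; exact: continuous_measurable_fun. Qed.

Lemma integral_pushforward_line (g : measurableTypeR R -> measurableTypeR R) f :
  measurable_fun setT g -> measurable_fun setT f -> (forall x, 0 <= f x) ->
  (\int[pushforward mu g]_x (f x)%:E = \int[mu]_x (f (g x))%:E)%E.
Proof.
move=> mg mf f0.
have mf' : measurable_fun setT (EFin \o (f : measurableTypeR R -> R)).
  exact/measurable_EFinP.
have := ge0_integral_pushforward mg mu measurableT mf'.
by rewrite preimage_setT; apply => x _; rewrite /= lee_fin.
Qed.

(** By uniqueness of Lebesgue measure: the right-hand side is a measure with the correct values on
    half-open intervals. *)
Lemma lebesgue_scale (a : R) (A : set R) : 0 < a -> measurable A ->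
  (mu A = a%:E * pushforward mu (fun x => a * x : measurableTypeR R)%R A)%E.
Proof.
move=> a0 mA.
have ma : measurable_fun setT (fun x : measurableTypeR R => a * x : measurableTypeR R)%R.
  by apply: continuous_rmeas => x; exact: mulrl_continuous.
pose P := measure_function_pushforward__canonical__measure_function_Measure mu ma.
pose M := mscale (NngNum (ltW a0)) P.
have := @lebesgue_measure_unique R M; rewrite /M /mscale /=; apply => //.
move=> _ [[p q]] _ <-.
have E : (fun x => a * x) @^-1` `]p, q] = `](p / a), (q / a)].
  apply/seteqP; split => x /=; rewrite !in_itv /= => /andP[h1 h2]; apply/andP.
    by rewrite ltr_pdivrMr// ler_pdivlMr// mulrC.
  by move: h1 h2; rewrite ltr_pdivrMr// ler_pdivlMr// mulrC.
rewrite /mscale /P /= /pushforward E.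
rewrite !lebesgue_measure_itv /= !lte_fin ltr_pM2r ?invr_gt0//.
case: ifPn => _; last by rewrite mule0.
by rewrite -!EFinB -EFinM -mulrBl mulrC divfK ?gt_eqF.
Qed.

Lemma integral_scale (a : R) f : 0 < a -> measurable_fun setT f ->
  (forall x, 0 <= f x) ->
  (\int[mu]_x (f x)%:E = a%:E * \int[mu]_x (f (a * x))%:E)%E.
Proof.
move=> a0 mf f0.
have ma : measurable_fun setT (fun x : measurableTypeR R => a * x : measurableTypeR R)%R.
  by apply: continuous_rmeas => x; exact: mulrl_continuous.
pose P := measure_function_pushforward__canonical__measure_function_Measure mu ma.
transitivity (\int[mscale (NngNum (ltW a0)) P]_x (f x)%:E)%E.
  by apply: eq_measure_integral => //= A mA _; rewrite (lebesgue_scale a0).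
rewrite ge0_integral_mscale//=; last 2 first.
- exact/measurable_EFinP.
- by move=> x _; rewrite lee_fin.
congr (_ * _)%E; exact: integral_pushforward_line.
Qed.

Lemma integral_opp f : measurable_fun setT f -> (forall x, 0 <= f x) ->
  (\int[mu]_x (f (- x))%:E = \int[mu]_x (f x)%:E)%E.
Proof.
move=> mf f0.
have ma : measurable_fun setT (-%R : measurableTypeR R -> measurableTypeR R).
  by apply: continuous_rmeas => x; exact: opp_continuous.
pose P := measure_function_pushforward__canonical__measure_function_Measure mu ma.
transitivity (\int[P]_x (f x)%:E)%E.
  by apply/esym; exact: integral_pushforward_line.
by apply: eq_measure_integral => //= A mA _; rewrite lebesgue_measureN.
Qed.

Lemma rint_oneDsqrV : rint mu (fun x => (1 + x ^+ 2)^-1).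
Proof.
apply: rint_ge0 => //.
- by apply: continuous_rmeas; exact: continuous_oneDsqrV.
- by move=> x; rewrite invr_ge0 addr_ge0// sqr_ge0.
rewrite (@ge0_symfun_integralT _ (fun x => (1 + x ^+ 2)^-1)).
- have := @integral0y_oneDsqr R; rewrite -set_itvcy /oneDsqr => ->.
  by rewrite -EFinM ltry.
- by move=> x; rewrite invr_ge0 addr_ge0// sqr_ge0.
- exact: continuous_oneDsqrV.
- by move=> x /=; rewrite sqrrN.
Qed.

End lebesgue_line.

(** * Taylor bounds for sine, cosine and the exponential *)

Section elementary_bounds.
Context {R : realType}.
Implicit Types (x c s : R) (f df : R -> R).

Lemma eq_ler x c : x = c -> x <= c.
Proof. by move->. Qed.

(** Mean value theorem. Used as a ladder: each Taylor bound for sine or cosine below states that the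
    derivative in the next one is nonnegative. *)
Lemma ge0_of_is_derive f df : (forall x, is_derive x 1 f (df x)) -> f 0 = 0 ->
  (forall x, 0 <= x -> 0 <= df x) -> forall x, 0 <= x -> 0 <= f x.
Proof.
move=> hf f0 df0 x x0.
have cf : {within `[0, x], continuous f}.
  apply: continuous_subspaceT => y.
  by apply/differentiable_continuous/derivable1_diffP; have [] := hf y.
have [c + E] := MVT_segment x0 (fun y _ => hf y) cf.
rewrite in_itv/= => /andP[c0 _].
by move: E; rewrite f0 !subr0 => ->; rewrite mulr_ge0// df0.
Qed.

Lemma even_ge0 f : (forall x, f (- x) = f x) ->
  (forall x, 0 <= x -> 0 <= f x) -> forall x, 0 <= f x.
Proof.
move=> fN f0 x; have [/f0//|x0] := leP 0 x.
by rewrite -fN f0// oppr_ge0 ltW.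
Qed.

Ltac deriv := apply: is_derive_eq; rewrite /GRing.scale /=; by field.

Lemma sin_le x : 0 <= x -> sin x <= x.
Proof.
move=> x0; rewrite -subr_ge0; move: x x0.
apply: (@ge0_of_is_derive (fun x => x - sin x) (fun x => 1 - cos x)) => /=.
- by rewrite sin0 subr0.
- by move=> y _; rewrite subr_ge0 cos_le1.
Qed.

Lemma one_sub_cos_ge0 x : 0 <= 1 - cos x.
Proof. by rewrite subr_ge0 cos_le1. Qed.

Lemma one_sub_cos_le2 x : 1 - cos x <= 2.
Proof. by have := cos_geN1 x; lra. Qed.

Lemma one_sub_cos_le x : 1 - cos x <= x ^+ 2 / 2.
Proof.
rewrite -subr_ge0; move: x.
apply: (@even_ge0 (fun x => x ^+ 2 / 2 - (1 - cos x))) => [x|].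
  by rewrite sqrrN cosN.
apply: (@ge0_of_is_derive _ (fun x => x - sin x)) => /=.
- by move=> y; deriv.
- by rewrite expr0n /= mul0r cos0 !subrr.
- by move=> y y0; rewrite subr_ge0 sin_le.
Qed.

Lemma sin_ge x : 0 <= x -> x - x ^+ 3 / 6 <= sin x.
Proof.
move=> x0; rewrite -subr_ge0; move: x x0.
apply: (@ge0_of_is_derive (fun x => sin x - (x - x ^+ 3 / 6))
  (fun x => x ^+ 2 / 2 - (1 - cos x))) => /=.
- by move=> y; deriv.
- by rewrite sin0 expr0n /= mul0r !subrr.
- by move=> y _; rewrite subr_ge0 one_sub_cos_le.
Qed.

Lemma one_sub_cos_ge x : x ^+ 2 / 2 - x ^+ 4 / 24 <= 1 - cos x.
Proof.
rewrite -subr_ge0; move: x.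
apply: (@even_ge0 (fun x => 1 - cos x - (x ^+ 2 / 2 - x ^+ 4 / 24))) => [x|].
  by rewrite cosN; ring.
apply: (@ge0_of_is_derive _ (fun x => sin x - (x - x ^+ 3 / 6))) => /=.
- by move=> y; deriv.
- by rewrite !expr0n /= cos0 !mul0r !subrr.
- by move=> y y0; rewrite subr_ge0 sin_ge.
Qed.

(** The quadratic form of the bound fits a Levy measure, which integrates |z|^2 near 0; past 1 it
    follows from boundedness of the sine. *)
Lemma norm_sin_subl_le x : `|sin x - x| <= x ^+ 2.
Proof.
wlog x0 : x / 0 <= x => [h|].
  have [/h//|x0] := leP 0 x.
  rewrite -normrN (_ : - (sin x - x) = sin (- x) - (- x)); last first.
    by rewrite sinN; ring.
  by rewrite -sqrrN h// oppr_ge0 ltW.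
rewrite ler0_norm ?subr_le0 ?sin_le//.
have [x1|x1] := leP 1 x.
  have := sin_geN1 x; have := sin_ge x0; have : x <= x ^+ 2.
    by rewrite expr2 ler_peMl.
  have [x2|x2] := leP 2 x; last by nra.
  by have : 2 * x <= x ^+ 2; [rewrite expr2 ler_wpM2r|lra].
have := sin_ge x0.
have : x ^+ 3 <= x ^+ 2 by rewrite ler_wiXn2l//; lra.
by have := sqr_ge0 x; lra.
Qed.

Lemma norm_expR_sub_le c : `|c| <= 1 / 2 -> `|expR c - 1 - c| <= 2 * c ^+ 2.
Proof.
rewrite ler_norml => /andP[c1 c2].
have h1 := expR_ge1Dx c; rewrite ger0_norm; last by lra.
have h2 : expR c <= (1 - c)^-1.
  rewrite -[expR c]invrK -expRN lef_pV2 ?posrE ?expR_gt0//; last by lra.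
  by have := expR_ge1Dx (- c); lra.
have h3 : (1 - c)^-1 - 1 - c = c ^+ 2 * (1 - c)^-1 by field; lra.
have h4 : (1 - c)^-1 <= 2.
  by rewrite -[leRHS]invrK lef_pV2 ?posrE ?invr_gt0//; lra.
have : c ^+ 2 * (1 - c)^-1 <= c ^+ 2 * 2 by rewrite ler_wpM2l// sqr_ge0.
by lra.
Qed.

End elementary_bounds.

(** * The Fejer kernel *)

Section fejer_kernel.
Context {R : realType}.
Notation mu := (@lebesgue_measure R).
Implicit Types a s u : R.

Lemma measurable_ge0V d (T : measurableType d) (f : T -> R) :
  measurable_fun setT f -> (forall x, 0 <= f x) ->
  measurable_fun setT (fun x => (f x)^-1).
Proof.
move=> mf f0; rewrite (_ : (fun _ => _) = (fun y => y `^ (-1)) \o f).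
  by apply: measurableT_comp => //; exact: measurable_powR.
by apply/funext => x /=; rewrite powR_inv1.
Qed.

Lemma measurable_cosT d (T : measurableType d) (f : T -> R) :
  measurable_fun setT f -> measurable_fun setT (fun x => cos (f x)).
Proof.
move=> mf; apply: (@measurableT_comp _ _ _ _ _ _ cos) => //.
apply: continuous_measurable_fun => x; exact: continuous_cos.
Qed.

Lemma measurable_sinT d (T : measurableType d) (f : T -> R) :
  measurable_fun setT f -> measurable_fun setT (fun x => sin (f x)).
Proof.
move=> mf; apply: (@measurableT_comp _ _ _ _ _ _ sin) => //.
apply: continuous_measurable_fun => x; exact: continuous_sin.
Qed.

Lemma measurable_expRT d (T : measurableType d) (f : T -> R) :
  measurable_fun setT f -> measurable_fun setT (fun x => expR (f x)).
Proof. by move=> mf; exact: (@measurableT_comp _ _ _ _ _ _ expR). Qed.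

Lemma cos_bound1 a : `|cos a| <= 1.
Proof. by rewrite ler_norml cos_geN1 cos_le1. Qed.

Lemma sin_bound1 a : `|sin a| <= 1.
Proof. by rewrite ler_norml sin_geN1 sin_le1. Qed.

Lemma rint_cos d (T : measurableType d) (m : {measure set T -> \bar R})
    (f g : T -> R) : rint m f -> measurable_fun setT g ->
  rint m (fun x => f x * cos (g x)).
Proof.
by move=> rf mg; apply: (rintM rf (measurable_cosT mg)) => x; exact: cos_bound1.
Qed.

Lemma rint_sin d (T : measurableType d) (m : {measure set T -> \bar R})
    (f g : T -> R) : rint m f -> measurable_fun setT g ->
  rint m (fun x => f x * sin (g x)).
Proof.
by move=> rf mg; apply: (rintM rf (measurable_sinT mg)) => x; exact: sin_bound1.
Qed.

Lemma integral_indic_itv (a b : R) : a <= b ->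
  (\int[mu]_s (\1_`[a, b]%classic s)%:E = (b - a)%:E)%E.
Proof.
move=> ab; rewrite integral_indic// setIT.
have := @lebesgue_measure_itv R (Interval (BLeft a) (BRight b)); rewrite /= lte_fin.
case: ltgtP ab => [_ _ ->//|//|-> _ E]; rewrite [LHS]E; congr EFin; ring.
Qed.

(** The value at s = 0 is the limit, so that the bounds [fejer_le] and [fejer_ge] hold at every
    s. *)
Definition fejer a s : R :=
  if s == 0 then a ^+ 2 / 2 else (1 - cos (a * s)) / s ^+ 2.

Lemma measurable_fejer a : measurable_fun setT (fejer a).
Proof.
apply: measurable_fun_ifT => //.
  exact: measurable_fun_eqr.
apply: measurable_funM.
  apply: measurable_funB => //; apply: measurable_cosT.
  exact: measurable_funM.
apply: measurable_ge0V => [|x]; last exact: sqr_ge0.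
exact: measurable_funX.
Qed.

Lemma fejer_ge0 a s : 0 <= fejer a s.
Proof.
rewrite /fejer; case: ifPn => _; first by rewrite divr_ge0// sqr_ge0.
by rewrite divr_ge0 ?sqr_ge0 ?one_sub_cos_ge0.
Qed.

Lemma fejer_le a s : fejer a s <= a ^+ 2 / 2.
Proof.
rewrite /fejer; case: ifPn => // s0.
have s2 : 0 < s ^+ 2 by rewrite exprn_even_gt0.
rewrite ler_pdivrMr// (le_trans (one_sub_cos_le _))// exprMn.
by rewrite mulrAC.
Qed.

Lemma fejer_ge a s : a ^+ 2 / 2 - a ^+ 4 * s ^+ 2 / 24 <= fejer a s.
Proof.
rewrite /fejer; case: ifPn => [/eqP ->|s0].
  by rewrite expr0n /= mulr0 mul0r subr0.
have s2 : 0 < s ^+ 2 by rewrite exprn_even_gt0.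
rewrite ler_pdivlMr// (le_trans _ (one_sub_cos_ge _))//.
by apply: eq_ler; ring.
Qed.

Lemma fejer_le_oneDsqrV a s : fejer a s <= (a ^+ 2 / 2 + 2) * (1 + s ^+ 2)^-1.
Proof.
have s2 := sqr_ge0 s; rewrite ler_pdivlMr; last by lra.
rewrite mulrDr mulr1 lerD ?fejer_le// /fejer; case: ifPn => [/eqP ->|s0].
  by rewrite expr0n /= mulr0.
rewrite divfK ?one_sub_cos_le2//.
by rewrite expf_eq0.
Qed.

Lemma norm_fejer a s : `|fejer a s| = fejer a s.
Proof. by rewrite ger0_norm// fejer_ge0. Qed.

Lemma rint_fejer a : rint mu (fejer a).
Proof.
apply: (rint_dom _ (rintZ (a ^+ 2 / 2 + 2) rint_oneDsqrV)).
  exact: measurable_fejer.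
by move=> s; rewrite norm_fejer fejer_le_oneDsqrV.
Qed.

(** The number pi, kept as an unevaluated integral. *)
Definition fejerC : R := \int[mu]_s fejer 1 s.

Lemma fejerN a s : fejer (- a) s = fejer a s.
Proof. by rewrite /fejer sqrrN mulNr cosN. Qed.

Lemma fejer_opp a s : fejer a (- s) = fejer a s.
Proof. by rewrite /fejer sqrrN oppr_eq0 mulrN cosN. Qed.

Lemma Int_fejer a : \int[mu]_s fejer a s = `|a| * fejerC.
Proof.
wlog a0 : a / 0 <= a => [h|].
  have [/h//|/ltW a0] := leP 0 a.
  rewrite -normrN -h ?oppr_ge0//.
  by apply: eq_Int => s; rewrite fejerN.
rewrite ger0_norm//; have [->|an0] := eqVneq a 0.
  rewrite mul0r (@eq_Int _ _ _ _ _ (fun=> 0)); first by rewrite Rintegral_cst// mul0r.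
  by move=> s; rewrite /fejer expr0n /= !mul0r cos0 subrr mul0r if_same.
have {}a0 : 0 < a by rewrite lt_neqAle eq_sym an0.
apply: EFin_inj; rewrite EFinM -!rintE; [|exact: rint_fejer..].
rewrite (@integral_scale _ a (fejer 1))//; last 2 first.
- exact: measurable_fejer.
- exact: fejer_ge0.
have mfa : measurable_fun setT (fun s => fejer 1 (a * s)).
  apply: (measurableT_comp (measurable_fejer 1)).
  exact: measurable_funM.
rewrite muleA -EFinM -expr2 -ge0_integralZl//; last 3 first.
- exact/measurable_EFinP.
- by move=> s _; rewrite lee_fin fejer_ge0.
- by rewrite lee_fin sqr_ge0.
apply: eq_integral => s _; rewrite -EFinM; congr EFin.
rewrite /fejer mulf_eq0 (negbTE an0) /= expr1n !mul1r exprMn.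
case: ifPn => s0; first by [].
by field; rewrite an0 s0.
Qed.

Lemma fejerC_gt0 : 0 < fejerC.
Proof.
have ind x : \1_`[1%R, 2%R]%classic x / 24 <= fejer 1 x.
  rewrite indicE; case: (boolP (x \in _)) => [|_]; last by rewrite mul0r fejer_ge0.
  rewrite inE /= in_itv /= => /andP[x1 x2].
  apply: le_trans (fejer_ge 1 x); rewrite !expr1n !mul1r.
  suff : x ^+ 2 <= 4 by lra.
  by nra.
have ri : rint mu (fun x => 24^-1 * \1_`[1%R, 2%R]%classic x).
  by apply: rintZ; exact: integrable_indic_itv.
apply: lt_le_trans (le_Int ri (rint_fejer 1) _); last first.
  by move=> x; rewrite mulrC.
rewrite IntZ; last exact: integrable_indic_itv.
rewrite /Rintegral integral_indic_itv ?ler1n//=; lra.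
Qed.

Lemma rint_fejer_cos a b u : rint mu (fun s => fejer a s * cos (b + u * s)).
Proof.
apply: rint_cos (rint_fejer a) _.
by apply: measurable_funD => //; exact: measurable_funM.
Qed.

(* Reduces to the scaling law [Int_fejer]: cos (u s) times 1 - cos (a s) is a
   combination of three functions 1 - cos (c s). *)
Lemma Int_fejer_cos0 a u : 0 <= a ->
  \int[mu]_s (fejer a s * cos (u * s)) = fejerC * Num.max 0 (a - `|u|).
Proof.
move=> a0.
transitivity (\int[mu]_s (2^-1 * (fejer (u + a) s + fejer (u - a) s) - fejer u s)).
  apply: eq_Int => s; rewrite /fejer; case: ifPn => s0.
    by rewrite (eqP s0) mulr0 cos0 mulr1; field.
  by rewrite (mulrDl u) (mulrBl s) cosD cosB; field.
have r c := rint_fejer c.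
rewrite IntB//; last by apply: rintZ; exact: rintD.
rewrite IntZ; last exact: rintD.
rewrite IntD// !Int_fejer -!mulrDl mulrA -mulrBl mulrC; congr (_ * _).
rewrite /Num.max; case: ifPn; rewrite -?leNgt => h.
- have [u0|u0] := leP 0 u; move: h;
    rewrite ?(ger0_norm u0) ?(ltr0_norm u0) => h.
  + by rewrite ger0_norm ?ler0_norm; lra.
  + by rewrite ger0_norm ?ler0_norm; lra.
- have [u0|u0] := leP 0 u; move: h;
    rewrite ?(ger0_norm u0) ?(ltr0_norm u0) => h.
  + by rewrite !ger0_norm; lra.
  + by rewrite !ler0_norm; lra.
Qed.

Lemma Int_fejer_cos a b u : 0 <= a ->
  \int[mu]_s (fejer a s * cos (b + u * s)) =
  cos b * (fejerC * Num.max 0 (a - `|u|)).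
Proof.
move=> a0; have rf := rint_fejer a; have rc := rint_fejer_cos a b.
have sym : \int[mu]_s (fejer a s * cos (b + u * s)) =
    \int[mu]_s (fejer a s * cos (b + - u * s)).
  (* Adding [fejer a s] makes the integrand nonnegative, as the reflection rule [integral_opp]
     requires. *)
  apply/(addrI (\int[mu]_s fejer a s)); rewrite -!IntD//.
  apply: EFin_inj; rewrite -!rintE; [|exact: rintD..].
  rewrite -integral_opp; last 2 first.
  - by apply: measurable_funD; [exact: rint_meas rf|exact: rint_meas (rc u)].
  - by move=> s; have := fejer_ge0 a s; have := cos_geN1 (b + u * s); nra.
  by apply: eq_integral => s _; rewrite fejer_opp mulrN mulNr.
have r0 : rint mu (fun s => fejer a s * cos (u * s)).
  by apply: rint_cos rf _; exact: measurable_funM.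
rewrite -Int_fejer_cos0//; apply: (@mulfI _ 2) => //.
rewrite mulr_natl mulr2n {2}sym -IntD// mulrA -IntZ//.
by apply: eq_Int => s; rewrite mulNr cosB cosD; ring.
Qed.

End fejer_kernel.

(** * Tensor products of one-variable kernels *)

Section product_functions.
Context {R : realType}.
Notation mu := (@lebesgue_measure R).

Definition prodf n (F : R -> R) (xi : n.-tuple R) : R :=
  \prod_(i < n) F (tnth xi i).

Lemma measurable_tnthR n (i : 'I_n) :
  measurable_fun setT (fun x : n.-tuple R => tnth x i).
Proof. exact: measurable_tnth. Qed.

Lemma measurable_dotv d (T : measurableType d) n (f g : T -> n.-tuple R) :
  (forall i, measurable_fun setT (fun x => tnth (f x) i)) ->
  (forall i, measurable_fun setT (fun x => tnth (g x) i)) ->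
  measurable_fun setT (fun x => dotv (f x) (g x)).
Proof.
by move=> mf mg; apply: measurable_sum => i; exact: measurable_funM.
Qed.

Lemma measurable_dotvl n (x : n.-tuple R) : measurable_fun setT (dotv x).
Proof.
by apply: measurable_dotv => i; [exact: measurable_cst|exact: measurable_tnthR].
Qed.

Lemma measurable_dotvr n (x : n.-tuple R) :
  measurable_fun setT (fun y => dotv y x).
Proof.
by apply: measurable_dotv => i; [exact: measurable_tnthR|exact: measurable_cst].
Qed.

Lemma measurable_prodf n (F : R -> R) : measurable_fun setT F ->
  measurable_fun setT (@prodf n F).
Proof.
move=> mF; apply: measurable_prod => i _.
by apply: measurableT_comp => //; exact: measurable_tnthR.
Qed.

Lemma prodf_ge0 n (F : R -> R) (xi : n.-tuple R) : (forall s, 0 <= F s) ->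
  0 <= prodf F xi.
Proof. by move=> F0; apply: prodr_ge0 => i _. Qed.

Lemma prodf_cons n (F : R -> R) s (y : n.-tuple R) :
  prodf F (cons_tuple s y) = F s * prodf F y.
Proof.
rewrite /prodf big_ord_recl; congr (_ * _); apply: eq_bigr => i _.
by rewrite tnthS.
Qed.

Lemma dotv_cons n s (y : n.-tuple R) a (x : n.-tuple R) :
  dotv (cons_tuple s y) (cons_tuple a x) = s * a + dotv y x.
Proof.
rewrite /dotv big_ord_recl; congr (_ + _); apply: eq_bigr => i _.
by rewrite !tnthS.
Qed.

(** With |q| <= p the integrand is nonnegative, so the iterated integral may be used without
    splitting signs. The phase b makes the induction go through, since peeling off a coordinate
    shifts it. The one-variable hypothesis carries the factor q so that q = 0, with an arbitrary K,
    gives the plain integral of the product. *)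
Lemma integral_prodf_cos (F K : R -> R) (p q : R) :
  measurable_fun setT F -> (forall s, 0 <= F s) -> rint mu F -> `|q| <= p ->
  (forall b u, q * \int[mu]_s (F s * cos (b + u * s)) = q * (cos b * K u)) ->
  forall n (x : n.-tuple R) b,
  (\int[leb n]_xi (prodf F xi * (p + q * cos (b + dotv x xi)))%:E =
   (p * (\int[mu]_s F s) ^+ n + q * (cos b * \prod_(i < n) K (tnth x i)))%:E)%E.
Proof.
move=> mF F0 rF qp HK.
have w0 c : 0 <= p + q * cos c.
  have : `|q * cos c| <= p.
    by rewrite normrM (le_trans _ qp)// ler_piMr// cos_bound1.
  by rewrite ler_norml => /andP[+ _]; lra.
have mw n (x : n.-tuple R) b : measurable_fun setT
    (fun xi => (prodf F xi * (p + q * cos (b + dotv x xi)))%:E).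
  apply/measurable_EFinP/measurable_funM; first exact: measurable_prodf.
  apply: measurable_funD => //; apply: measurable_funM => //.
  by apply: measurable_cosT; apply: measurable_funD => //; exact: measurable_dotvl.
have pos n (x : n.-tuple R) b xi :
    (0 <= (prodf F xi * (p + q * cos (b + dotv x xi)))%:E)%E.
  by rewrite lee_fin mulr_ge0// prodf_ge0.
elim=> [|n IH] x b.
  by rewrite leb_liint// /prodf /dotv /= !big_ord0 addr0 expr0 !mulr1 mul1r.
case/tupleP: x => a x; rewrite leb_liint//=.
have split s y : (prodf F (cons_tuple s y) *
      (p + q * cos (b + dotv (cons_tuple a x) (cons_tuple s y))))%:E =
    ((F s)%:E * (prodf F y * (p + q * cos (b + a * s + dotv x y)))%:E)%E.
  by rewrite prodf_cons dotv_cons addrA -mulrA EFinM.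
have msplit (s : R) : measurable_fun setT (fun y =>
    ((F s)%:E * (prodf F y * (p + q * cos (b + a * s + dotv x y)))%:E)%E).
  by apply: emeasurable_funM; [exact: measurable_cst|exact: mw].
transitivity (\int[mu]_s (F s * (p * (\int[mu]_s F s) ^+ n +
    q * (cos (b + a * s) * \prod_(i < n) K (tnth x i))))%:E)%E.
  apply: eq_integral => s _; rewrite EFinM -IH.
  rewrite -ge0_integralZl//; [|exact: mw|by rewrite lee_fin].
  rewrite -leb_liint; last 2 first.
  - by under eq_fun do rewrite split; exact: msplit.
  - by move=> y; exact: pos.
  by apply: eq_integral => y _; exact: split.
have rc : rint mu (fun s => F s * cos (b + a * s)).
  by apply: rint_cos => //; apply: measurable_funD => //; exact: measurable_funM.
set I := \int[mu]_s F s; set P := \prod_(i < n) K _.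
transitivity (\int[mu]_s (p * I ^+ n * F s + q * P * (F s * cos (b + a * s)))%:E)%E.
  by apply: eq_integral => s _; congr EFin; ring.
rewrite rintE; last by apply: rintD; exact: rintZ.
rewrite IntD; [|exact: rintZ..]; rewrite !IntZ// -/I.
congr EFin; rewrite big_ord_recl /= exprS.
under eq_bigr do rewrite tnthS.
rewrite -/P [q * P]mulrC -[P * q * _]mulrA HK tnth0.
by ring.
Qed.

Section integrable_factor.
Variable F : R -> R.
Hypotheses (mF : measurable_fun setT F) (F0 : forall s, 0 <= F s)
  (rF : rint mu F).

Lemma integral_prodf n :
  (\int[leb n]_xi (prodf F xi)%:E = ((\int[mu]_s F s) ^+ n)%:E)%E.
Proof.
have := @integral_prodf_cos F (fun=> 0) 1 0 mF F0 rF _ _ n [tuple 0 | i < n] 0.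
rewrite normr0 mul1r !mul0r addr0 => <-//.
- by apply: eq_integral => xi _; rewrite mul0r addr0 mulr1.
- by move=> b u; rewrite !mul0r.
Qed.

Lemma rint_prodf n : rint (leb n) (prodf F).
Proof.
apply: rint_ge0; first exact: measurable_prodf.
- by move=> xi; exact: prodf_ge0.
- by rewrite integral_prodf ltry.
Qed.

Lemma Int_prodf n : \int[leb n]_xi prodf F xi = (\int[mu]_s F s) ^+ n.
Proof. by rewrite /Rintegral integral_prodf. Qed.

Lemma Int_prodf_cos (K : R -> R) n (x : n.-tuple R) :
  (forall b u, \int[mu]_s (F s * cos (b + u * s)) = cos b * K u) ->
  \int[leb n]_xi (prodf F xi * cos (dotv x xi)) = \prod_(i < n) K (tnth x i).
Proof.
move=> HK.
have rc : rint (leb n) (fun xi => prodf F xi * cos (dotv x xi)).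
  by apply: rint_cos (rint_prodf n) _; exact: measurable_dotvl.
have := @integral_prodf_cos F K 1 1 mF F0 rF _ _ n x 0.
under eq_integral do rewrite mul1r add0r mulrDr mulr1.
rewrite rintE; last by apply: rintD => //; exact: rint_prodf.
rewrite IntD//; last exact: rint_prodf.
rewrite Int_prodf normr1 lexx cos0 !mul1r => /(_ isT) h.
apply: (addrI ((\int[mu]_s F s) ^+ n)); apply: EFin_inj; apply: h.
by move=> b u; rewrite HK !mul1r.
Qed.

End integrable_factor.

End product_functions.

(** * Euclidean vectors and measurability of continuous functions *)

Section euclidean.
Context {R : realType} {d : nat}.
Notation vec := (d.-tuple R).
Implicit Types x y z : vec.

Lemma tnth_vadd x y i : tnth (vadd x y) i = tnth x i + tnth y i.
Proof. by rewrite tnth_mktuple. Qed.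

Lemma tnth_vscale a x i : tnth (vscale a x) i = a * tnth x i.
Proof. by rewrite tnth_mktuple. Qed.

Lemma tnth_vopp x i : tnth (vopp x) i = - tnth x i.
Proof. by rewrite tnth_mktuple. Qed.

Lemma tnth_vzero i : tnth (vzero R d) i = 0.
Proof. by rewrite tnth_mktuple. Qed.

Lemma dotvC x y : dotv x y = dotv y x.
Proof. by apply: eq_bigr => i _; rewrite mulrC. Qed.

Lemma dotvDl x y z : dotv (vadd x y) z = dotv x z + dotv y z.
Proof.
by rewrite -big_split; apply: eq_bigr => i _; rewrite tnth_vadd mulrDl.
Qed.

Lemma dotvZl a x z : dotv (vscale a x) z = a * dotv x z.
Proof.
by rewrite mulr_sumr; apply: eq_bigr => i _; rewrite tnth_vscale mulrA.
Qed.

Lemma dotvNl x z : dotv (vopp x) z = - dotv x z.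
Proof.
by rewrite -sumrN; apply: eq_bigr => i _; rewrite tnth_vopp mulNr.
Qed.

Lemma dotvDr x y z : dotv z (vadd x y) = dotv z x + dotv z y.
Proof. by rewrite dotvC dotvDl !(dotvC z). Qed.

Lemma dotvZr a x z : dotv z (vscale a x) = a * dotv z x.
Proof. by rewrite dotvC dotvZl (dotvC z). Qed.

Lemma dotvNr x z : dotv z (vopp x) = - dotv z x.
Proof. by rewrite dotvC dotvNl (dotvC z). Qed.

Lemma dotv0l x : dotv (vzero R d) x = 0.
Proof. by apply: big1 => i _; rewrite tnth_vzero mul0r. Qed.

Lemma enorm_ge0 x : 0 <= enorm x.
Proof. exact: sqrtr_ge0. Qed.

Lemma enorm_sqr x : enorm x ^+ 2 = \sum_(i < d) tnth x i ^+ 2.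
Proof. by rewrite sqr_sqrtr// sumr_ge0// => i _; exact: sqr_ge0. Qed.

Lemma enormZ a x : enorm (vscale a x) = `|a| * enorm x.
Proof.
apply/eqP; rewrite -(@eqrXn2 _ 2)// ?mulr_ge0 ?enorm_ge0//.
rewrite exprMn !enorm_sqr real_normK ?num_real// mulr_sumr; apply/eqP.
by apply: eq_bigr => i _; rewrite tnth_vscale exprMn.
Qed.

Lemma enormN x : enorm (vopp x) = enorm x.
Proof.
by congr Num.sqrt; apply: eq_bigr => i _; rewrite tnth_vopp sqrrN.
Qed.

Lemma enorm0 : enorm (vzero R d) = 0.
Proof.
apply/eqP; rewrite -sqrf_eq0 enorm_sqr big1// => i _.
by rewrite tnth_vzero expr0n.
Qed.

Lemma enorm_eq0 x : enorm x = 0 -> x = vzero R d.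
Proof.
move/eqP; rewrite -sqrf_eq0 enorm_sqr psumr_eq0; last by move=> i _; exact: sqr_ge0.
move/allP => h; apply: eq_from_tnth => i.
by rewrite tnth_vzero; apply/eqP; rewrite -sqrf_eq0; apply: h; rewrite mem_index_enum.
Qed.

Lemma norm_tnth_le_enorm x i : `|tnth x i| <= enorm x.
Proof.
rewrite -(@ler_pXn2r _ 2) ?nnegrE ?enorm_ge0//.
rewrite enorm_sqr real_normK ?num_real// (bigD1 i)//= lerDl.
by apply: sumr_ge0 => j _; exact: sqr_ge0.
Qed.

Lemma enorm_sqr_le_max x (rho : R) : (forall i, `|tnth x i| <= rho) ->
  enorm x ^+ 2 <= d%:R * rho ^+ 2.
Proof.
move=> h; rewrite enorm_sqr.
have -> : d%:R * rho ^+ 2 = \sum_(i < d) rho ^+ 2.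
  by rewrite sumr_const card_ord mulr_natl.
apply: ler_sum => i _; rewrite -real_normK ?num_real//.
by rewrite lerXn2r ?nnegrE// (le_trans _ (h i)).
Qed.

Lemma dotv_le x y : `|dotv x y| <= enorm x * enorm y.
Proof.
rewrite -(@ler_pXn2r _ 2) ?nnegrE ?mulr_ge0 ?enorm_ge0//.
rewrite real_normK ?num_real// exprMn.
have [y0|y0] := eqVneq (enorm y) 0.
  by rewrite (enorm_eq0 y0) dotvC dotv0l enorm0 expr0n mulr0.
set b := dotv x y; set Y := enorm y ^+ 2; set X := enorm x ^+ 2.
have Y0 : 0 < Y by rewrite /Y exprn_even_gt0.
have : 0 <= \sum_(i < d) (Y * tnth x i - b * tnth y i) ^+ 2.
  by apply: sumr_ge0 => i _; exact: sqr_ge0.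
have -> : \sum_(i < d) (Y * tnth x i - b * tnth y i) ^+ 2 = Y * (X * Y - b ^+ 2).
  transitivity (\sum_(i < d) (Y ^+ 2 * tnth x i ^+ 2 -
      2 * Y * b * (tnth x i * tnth y i) + b ^+ 2 * tnth y i ^+ 2)).
    by apply: eq_bigr => i _; ring.
  rewrite big_split sumrB /= -!mulr_sumr -!enorm_sqr -/X -/Y -/(dotv x y) -/b.
  by ring.
by rewrite pmulr_rge0// subr_ge0.
Qed.

Lemma dotv_self x : dotv x x = enorm x ^+ 2.
Proof. by rewrite enorm_sqr. Qed.

Lemma measurable_enorm : measurable_fun setT (@enorm R d).
Proof.
apply: (@measurableT_comp _ _ _ _ _ _ (@Num.sqrt R)).
  by apply: continuous_measurable_fun; exact: sqrt_continuous.
by apply: measurable_sum => i; apply: measurable_funX; exact: measurable_tnthR.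
Qed.

Definition econtinuous (P : vec -> R) := forall x (e : R), 0 < e ->
  exists2 del : R, 0 < del &
  forall y, enorm (vadd x (vopp y)) < del -> `|P x - P y| < e.

Let rbox (q : d.-tuple rat * nat) : set vec :=
  [set x | forall i, `|tnth x i - ratr (tnth q.1 i)| < q.2.+1%:R^-1].

Let measurable_rbox q : measurable (rbox q).
Proof.
rewrite (_ : rbox q = \bigcap_(i in [set: 'I_d])
  [set x | `|tnth x i - ratr (tnth q.1 i)| < q.2.+1%:R^-1]); last first.
  by apply/seteqP; split => x h i; [move=> _; exact: h|exact: (h i I)].
apply: fin_bigcap_measurable => // i _.
have mf : measurable_fun setT (fun x : vec => `|tnth x i - ratr (tnth q.1 i)|).
  apply: measurableT_comp => //; apply: measurable_funB => //.
  exact: measurable_tnthR.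
have := mf measurableT `]-oo, q.2.+1%:R^-1[%classic (measurable_itv _).
by rewrite setTI; congr measurable; apply/seteqP; split => x /=; rewrite in_itv.
Qed.

(** Continuity is given through [enorm], measurability through the product sigma-algebra. They meet
    in the rational boxes: a superlevel set of P is the union of the countably many boxes that it
    contains. *)
Lemma econtinuous_measurable (P : vec -> R) : econtinuous P ->
  measurable_fun setT P.
Proof.
move=> cP; apply: (measurability _ (RGenOInfty.measurableE R)) => _ [_ [a ->] <-].
rewrite setTI.
set O := _ @^-1` _.
have -> : O = \bigcup_(q in [set q | rbox q `<=` O]) rbox q.
  apply/seteqP; split; last by move=> x [q qO] /qO.
  move=> x; rewrite {1}/O /= in_itv /= andbT => ax.
  have [del del0 hdel] := cP x (P x - a) (ltac:(by rewrite subr_gt0)).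
  (* Two points of a box of radius 1/(m+1) differ by at most 2/(m+1) in each coordinate, hence by at
     most 2d/(m+1) in norm. *)
  pose m := Num.trunc (2 * d%:R / del).
  have hm : 2 * d%:R / m.+1%:R < del.
    have := truncnS_gt (2 * d%:R / del); rewrite -/m.
    by rewrite !ltr_pdivrMr// (mulrC del).
  have hq i : {q : rat | `|tnth x i - ratr q| < m.+1%:R^-1}.
    apply: cid; have : tnth x i - m.+1%:R^-1 < tnth x i + m.+1%:R^-1.
      by rewrite ltrBlDr -addrA ltrDl addr_gt0// invr_gt0.
    move=> /rat_in_itvoo[q]; rewrite in_itv /= => /andP[q1 q2].
    exists q; move: q1 q2; move: (ratr q) (_^-1) => z e q1 q2.
    by rewrite ltr_norml; apply/andP; split; lra.
  exists ([tuple sval (hq i) | i < d], m).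
    move=> y /= hy; rewrite /O /= in_itv /= andbT.
    have : `|P x - P y| < P x - a.
      apply: hdel; apply: le_lt_trans hm.
      rewrite -(@ler_pXn2r _ 2) ?nnegrE ?enorm_ge0 ?divr_ge0//.
      apply: (@le_trans _ _ (d%:R * (2 / m.+1%:R) ^+ 2)).
        apply: enorm_sqr_le_max => i; rewrite tnth_vadd tnth_vopp.
        have := hy i; rewrite /= tnth_mktuple => h1.
        have h2 := svalP (hq i).
        rewrite (_ : _ + _ = (tnth x i - ratr (sval (hq i))) -
          (tnth y i - ratr (sval (hq i)))); last by ring.
        rewrite (le_trans (ler_normB _ _))// mulr_natl mulr2n lerD//; exact: ltW.
      rewrite [2 * _ / _]mulrAC [leRHS]exprMn [leLHS]mulrC ler_wpM2l ?sqr_ge0//.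
      by rewrite -natrX ler_nat; case: (d) => // k; rewrite leq_pmulr.
    by rewrite ltr_norml => /andP[_]; lra.
  by move=> i /=; rewrite tnth_mktuple; exact: (svalP (hq i)).
rewrite bigcup_mkcond; apply: countable_bigcupT_measurable.
  exact: countableP.
by move=> q; case: ifP.
Qed.

End euclidean.

(** * Kernels with a nonnegative Fourier transform *)

Section complex_exponential.
Context {R : realType}.
Implicit Types (p q t : R) (z w : R[i]).

(** The complex exponential of p + iq. *)
Definition cexp p q : R[i] := Complex (expR p * cos q) (expR p * sin q).

(** The norm of [R[i]] takes its values in [R[i]]; this is the modulus as an element of R. *)
Definition cmod z : R := Normc.normc z.

Lemma cmodE a b : cmod (Complex a b) = Num.sqrt (a ^+ 2 + b ^+ 2).
Proof. by []. Qed.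

Lemma cmodM z w : cmod (z * w) = cmod z * cmod w.
Proof. exact: Normc.normcM. Qed.

Lemma cmod_ge0 z : 0 <= cmod z.
Proof. by case: z => a b; rewrite cmodE sqrtr_ge0. Qed.

Lemma cmodD z w : cmod (z + w) <= cmod z + cmod w.
Proof. by have := ler_normD z w; rewrite -rmorphD /= lecR. Qed.

Lemma cmodX z n : cmod (z ^+ n) = cmod z ^+ n.
Proof.
elim: n => [|n IH]; first by rewrite !expr0 cmodE expr1n expr0n addr0 sqrtr1.
by rewrite !exprS cmodM IH.
Qed.

Lemma cmod_sum n (F : 'I_n -> R[i]) : cmod (\sum_(i < n) F i) <= \sum_(i < n) cmod (F i).
Proof.
elim/big_ind2 : _ => //.
  by rewrite cmodE expr0n addr0 sqrtr0.
by move=> z a w b za wb; rewrite (le_trans (cmodD _ _))// lerD.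
Qed.

Lemma cmod_cexp p q : cmod (cexp p q) = expR p.
Proof.
rewrite cmodE !exprMn -mulrDr cos2Dsin2 mulr1 sqrtr_sqr.
by rewrite ger0_norm// expR_ge0.
Qed.

Lemma norm_Re_le z : `|complex.Re z| <= cmod z.
Proof.
case: z => a b; rewrite cmodE /= -sqrtr_sqr ler_wsqrtr// lerDl sqr_ge0//.
Qed.

Lemma norm_Im_le z : `|complex.Im z| <= cmod z.
Proof.
case: z => a b; rewrite cmodE /= -sqrtr_sqr ler_wsqrtr// lerDr sqr_ge0//.
Qed.

Lemma cmod_le a b : cmod (Complex a b) <= `|a| + `|b|.
Proof.
rewrite cmodE -(@ler_pXn2r _ 2) ?nnegrE ?sqrtr_ge0 ?addr_ge0//.
rewrite sqr_sqrtr ?addr_ge0 ?sqr_ge0// sqrrD -!normrX.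
by rewrite (ger0_norm (sqr_ge0 a)) (ger0_norm (sqr_ge0 b)) lerD2r lerDl mulrn_wge0// mulr_ge0.
Qed.

Lemma cexp_expn p q n : cexp p q ^+ n = cexp (n%:R * p) (n%:R * q).
Proof.
elim: n => [|n IH].
  by rewrite expr0 !mul0r /cexp expR0 cos0 sin0 mulr1 mulr0.
rewrite exprS IH -natr1 !mulrDl !mul1r /cexp expRD cosD sinD.
by congr Complex; ring.
Qed.

Lemma cmod_cexp_sub p q : `|p| <= 1 / 2 -> `|q| <= 1 / 2 ->
  cmod (cexp p q - (1 + Complex p q)) <= 8 * (p ^+ 2 + q ^+ 2).
Proof.
move=> p2 q2.
rewrite (_ : cexp p q - _ = Complex (expR p * cos q - 1 - p) (expR p * sin q - q));
  last first.
  by apply/eqP; rewrite eq_complex /=; apply/andP; split; apply/eqP; ring.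
apply: le_trans (cmod_le _ _) _.
have h1 := norm_expR_sub_le p2.
have ep : expR p <= 2.
  move: h1; rewrite ler_norml => /andP[_ h].
  have : p ^+ 2 <= 4^-1.
    rewrite -real_normK ?num_real// (_ : 4^-1 = (1 / 2) ^+ 2); last by field.
    by rewrite lerXn2r ?nnegrE.
  by move: p2; rewrite ler_norml => /andP[_]; lra.
have e0 := expR_ge0 p.
have hc0 := one_sub_cos_ge0 q; have hc := one_sub_cos_le q.
have hs := norm_sin_subl_le q.
have q0 := sqr_ge0 q; have p0 := sqr_ge0 p.
have A : `|expR p * cos q - 1 - p| <= 2 * p ^+ 2 + q ^+ 2.
  rewrite (_ : _ - p = (expR p - 1 - p) - expR p * (1 - cos q)); last by ring.
  rewrite (le_trans (ler_normB _ _))// lerD// normrM !ger0_norm//.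
  by apply: (@le_trans _ _ (2 * (q ^+ 2 / 2))); [exact: ler_pM|lra].
have B : `|expR p * sin q - q| <= 2 * q ^+ 2 + (3 * p ^+ 2 + q ^+ 2).
  rewrite (_ : _ - q = expR p * (sin q - q) + (expR p - 1) * q); last by ring.
  rewrite (le_trans (ler_normD _ _))// lerD//.
    by rewrite normrM ger0_norm// ler_pM.
  have h2 : `|expR p - 1| <= 2 * `|p|.
    rewrite (_ : _ - 1 = (expR p - 1 - p) + p); last by ring.
    rewrite (le_trans (ler_normD _ _))//.
    have : 2 * p ^+ 2 <= `|p|.
      by rewrite -real_normK ?num_real// expr2 mulrA ler_piMl//; lra.
    by lra.
  rewrite normrM; apply: (@le_trans _ _ (2 * `|p| * `|q|)); first by rewrite ler_wpM2r.
  rewrite -(real_normK (num_real p)) -(real_normK (num_real q)).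
  move: `|p| `|q| => a b; have := sqr_ge0 (a - b); have := sqr_ge0 a.
  by rewrite sqrrB; lra.
lra.
Qed.

Lemma cmod_expn_sub z w B n : cmod z <= B -> cmod w <= B -> 0 <= B ->
  cmod (z ^+ n.+1 - w ^+ n.+1) <= n.+1%:R * cmod (z - w) * B ^+ n.
Proof.
move=> zB wB B0; rewrite subrXX cmodM -mulrA [n.+1%:R * _]mulrC -[leRHS]mulrA.
rewrite ler_wpM2l ?cmod_ge0// (le_trans (cmod_sum _))//.
apply: (@le_trans _ _ (\sum_(i < n.+1) B ^+ n)); last first.
  by rewrite sumr_const card_ord -[leLHS]mulr_natr.
apply: ler_sum => i _; rewrite cmodM !cmodX.
have ni : (i <= n)%N by rewrite -ltnS ltn_ord.
rewrite -[in leRHS](subnK ni) exprD ler_pM ?exprn_ge0 ?cmod_ge0//.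
  by rewrite /= lerXn2r ?nnegrE ?cmod_ge0.
by rewrite lerXn2r ?nnegrE ?cmod_ge0.
Qed.

Lemma cmod_1D_le p q : cmod (1 + Complex p q) <= expR (`|p| + `|q|).
Proof.
rewrite (le_trans (cmodD _ _))// (le_trans _ (expR_ge1Dx _))//.
by rewrite lerD ?cmod_le// cmodE expr1n expr0n addr0 sqrtr1.
Qed.

(** Euler's product for e^(p+iq). Products suit positivity: multiplying a kernel by one factor adds
    to it a multiple of a convolution, so positivity of the transform survives each factor and
    passes to the limit. *)
Definition cexp_approx n p q : R[i] :=
  (1 + Complex (p / n.+1%:R) (q / n.+1%:R)) ^+ n.+1.

Lemma cmod_cexp_approx n p q : cmod (cexp_approx n p q) <= expR (`|p| + `|q|).
Proof.
rewrite /cexp_approx cmodX.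
have -> : expR (`|p| + `|q|) = expR (`|p / n.+1%:R| + `|q / n.+1%:R|) ^+ n.+1.
  rewrite -expRM_natl !normrM normfV (ger0_norm (ler0n _ n.+1)) -mulrDl.
  by rewrite -mulr_natl mulrC divfK// pnatr_eq0.
by rewrite lerXn2r ?nnegrE ?cmod_ge0 ?expR_ge0// cmod_1D_le.
Qed.

(** Telescoping the difference of the (n+1)-st powers of 1 + w/(n+1) and e^(w/(n+1)) leaves an error
    of order 1/(n+1). *)
Lemma cexp_approx_cvg p q :
  cmod (cexp_approx n p q - cexp p q) @[n --> \oo] --> (0 : R).
Proof.
pose C := 8 * (p ^+ 2 + q ^+ 2) * expR (`|p| + `|q|).
have bound : \forall n \near \oo, cmod (cexp_approx n p q - cexp p q) <= C * n.+1%:R^-1.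
  near=> n.
  have n0 : (0 : R) < n.+1%:R by rewrite ltr0n.
  have nn0 : (n.+1%:R : R) != 0 by rewrite pnatr_eq0.
  have hn : 2 * (`|p| + `|q|) <= n.+1%:R.
    near: n; exists (Num.truncn (2 * (`|p| + `|q|))).+1 => // m /= hm.
    rewrite ltW// (lt_le_trans (truncnS_gt _))// ler_nat.
    by rewrite (leq_trans hm).
  have np : `|p / n.+1%:R| <= 1 / 2.
    rewrite normrM normfV (ger0_norm (ltW n0)) ler_pdivrMr//.
    by have := normr_ge0 q; lra.
  have nq : `|q / n.+1%:R| <= 1 / 2.
    rewrite normrM normfV (ger0_norm (ltW n0)) ler_pdivrMr//.
    by have := normr_ge0 p; lra.
  have -> : cexp p q = cexp (p / n.+1%:R) (q / n.+1%:R) ^+ n.+1.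
    by rewrite cexp_expn ![_ * (_ / _)]mulrC !divfK.
  pose B := expR (`|p / n.+1%:R| + `|q / n.+1%:R|).
  have B1 : 1 <= B by rewrite -expR0 ler_expR addr_ge0.
  apply: (@le_trans _ _ (n.+1%:R * (8 * ((p / n.+1%:R) ^+ 2 + (q / n.+1%:R) ^+ 2)) * B ^+ n.+1)).
    apply: (@le_trans _ _ (n.+1%:R * (8 * ((p / n.+1%:R) ^+ 2 + (q / n.+1%:R) ^+ 2)) * B ^+ n)).
      apply: le_trans (@cmod_expn_sub _ _ B n _ _ _) _.
      - exact: cmod_1D_le.
      - rewrite cmod_cexp ler_expR (le_trans (ler_norm _))//.
        by rewrite lerDl.
      - exact: expR_ge0.
      rewrite ler_wpM2r ?exprn_ge0 ?expR_ge0// ler_wpM2l//.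
      have -> : forall z w, cmod (z - w) = cmod (w - z).
        move=> z w; rewrite -[z - w]opprB.
        by case: (w - z) => a b; rewrite !cmodE !sqrrN.
      exact: cmod_cexp_sub.
    rewrite ler_wpM2l//; last by rewrite exprSr ler_peMr// exprn_ge0// expR_ge0.
    by rewrite !mulr_ge0// addr_ge0// sqr_ge0.
  rewrite /B -expRM_natl !normrM normfV (ger0_norm (ltW n0)) -mulrDl.
  rewrite [_%:R * ((_ + _) / _)]mulrC divfK//.
  apply: eq_ler; rewrite /C.
  by field; rewrite -natr1 in nn0.
apply: (@squeeze_cvgr _ _ _ _ (fun=> 0) (fun n => C * n.+1%:R^-1)).
- near=> n; rewrite cmod_ge0 /=; near: n; exact: bound.
- exact: cvg_cst.
- rewrite -[X in _ --> X](mulr0 C); apply: cvgMr.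
  exact: cvg_harmonic.
Unshelve. all: by end_near.
Qed.

End complex_exponential.

Section measurable_parameter_integral.
Context d1 d2 (T1 : measurableType d1) (T2 : measurableType d2) (R : realType).
Variable m2 : {sigma_finite_measure set T2 -> \bar R}.

(** Adding the majorant h makes f nonnegative, which brings the Tonelli measurability result into
    reach; the integral of h is subtracted again. *)
Lemma measurable_Int_param (f : T1 * T2 -> R) (h : T2 -> R) :
  measurable_fun setT f -> rint m2 h -> (forall x y, `|f (x, y)| <= h y) ->
  measurable_fun setT (fun x => \int[m2]_y f (x, y)).
Proof.
move=> mf ih fh.
have ifx x : rint m2 (fun y => f (x, y)).
  by apply: rint_dom ih _; [exact: measurableT_comp|exact: fh].
rewrite (_ : (fun _ => _) =
    (fun x => \int[m2]_y (f (x, y) + h y) - \int[m2]_y h y)); last first.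
  by apply/funext => x; rewrite IntD// addrK.
apply: measurable_funB => //; apply/measurable_EFinP.
rewrite (_ : _ \o _ = fun x => \int[m2]_y (f (x, y) + h y)%:E)%E; last first.
  by apply/funext => x /=; rewrite rintE//; exact: rintD.
have := @measurable_fun_fubini_tonelli_F _ _ T1 T2 R m2
  (fun xy => (f xy + h xy.2)%:E); apply => [|[x y]] /=.
- apply/measurable_EFinP; apply: measurable_funD => //.
  by apply: measurableT_comp => //; exact: rint_meas ih.
- by have := fh x y; rewrite lee_fin ler_norml => /andP[]; lra.
Qed.

End measurable_parameter_integral.

Lemma cvg_dist_le (R : realType) (u v : nat -> R) (l : R) :
  (forall n, `|u n - l| <= v n) -> v n @[n --> \oo] --> 0 ->
  u n @[n --> \oo] --> l.
Proof.
move=> uv v0; apply/cvgrPdistC_lt => e e0; near=> n.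
apply: (le_lt_trans (uv n)); apply: (le_lt_trans (ler_norm _)).
by rewrite -[v n]subr0; near: n; move/cvgrPdistC_lt : v0; exact.
Unshelve. all: by end_near. Qed.
Arguments cvg_dist_le {R} u v l.

Section positive_transform.
Context {R : realType} {d : nat}.
Notation vec := (d.-tuple R).
Notation Re := (@complex.Re R).
Notation Im := (@complex.Im R).
Implicit Types (k X Y : vec -> R[i]) (x z xi : vec).

Definition cmeas X := measurable_fun setT (Re \o X) /\ measurable_fun setT (Im \o X).

Definition cint k := rint (leb d) (Re \o k) /\ rint (leb d) (Im \o k).

(* Re \int k(xi) e^(-i<xi,x>) dxi *)
Definition ft k x : R :=
  \int[leb d]_xi (Re (k xi) * cos (dotv xi x) + Im (k xi) * sin (dotv xi x)).

(** The working form of positive definiteness. The class is closed under sums, nonnegative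
    multiples, phases (which translate the transform) and dominated limits; these operations suffice
    to build characteristic functions of Levy type on top of an integrable kernel. *)
Definition posft k := cint k /\ forall x, 0 <= ft k x.

Definition cphase z xi : R[i] := Complex (cos (dotv xi z)) (sin (dotv xi z)).

Lemma ReM (a b : R[i]) : Re (a * b) = Re a * Re b - Im a * Im b.
Proof. by case: a b => [a1 a2] [b1 b2]. Qed.

Lemma ImM (a b : R[i]) : Im (a * b) = Re a * Im b + Im a * Re b.
Proof. by case: a b => [a1 a2] [b1 b2]. Qed.

Lemma ReD (a b : R[i]) : Re (a + b) = Re a + Re b.
Proof. by case: a b => [a1 a2] [b1 b2]. Qed.

Lemma ImD (a b : R[i]) : Im (a + b) = Im a + Im b.
Proof. by case: a b => [a1 a2] [b1 b2]. Qed.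

Lemma cmeasM X Y : cmeas X -> cmeas Y -> cmeas (fun xi => X xi * Y xi).
Proof.
move=> [mX1 mX2] [mY1 mY2]; split.
  rewrite (_ : _ \o _ = fun xi => Re (X xi) * Re (Y xi) - Im (X xi) * Im (Y xi)).
    by apply: measurable_funB; exact: measurable_funM.
  by apply/funext => xi; exact: ReM.
rewrite (_ : _ \o _ = fun xi => Re (X xi) * Im (Y xi) + Im (X xi) * Re (Y xi)).
  by apply: measurable_funD; exact: measurable_funM.
by apply/funext => xi; exact: ImM.
Qed.

Lemma cmeasD X Y : cmeas X -> cmeas Y -> cmeas (fun xi => X xi + Y xi).
Proof.
move=> [mX1 mX2] [mY1 mY2]; split.
  rewrite (_ : _ \o _ = fun xi => Re (X xi) + Re (Y xi)).
    exact: measurable_funD.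
  by apply/funext => xi; exact: ReD.
rewrite (_ : _ \o _ = fun xi => Im (X xi) + Im (Y xi)).
  exact: measurable_funD.
by apply/funext => xi; exact: ImD.
Qed.

Lemma cmeas_cst (c : R[i]) : cmeas (fun=> c).
Proof. by split; exact: measurable_cst. Qed.

Lemma cmeasX X n : cmeas X -> cmeas (fun xi => X xi ^+ n).
Proof.
move=> mX; elim: n => [|n IH].
  by under eq_fun do rewrite expr0; exact: cmeas_cst.
by under eq_fun do rewrite exprS; exact: cmeasM.
Qed.

Lemma cmeas_Complex (f g : vec -> R) : measurable_fun setT f ->
  measurable_fun setT g -> cmeas (fun xi => Complex (f xi) (g xi)).
Proof. by []. Qed.

Lemma cmeas_cexp (f g : vec -> R) : measurable_fun setT f ->
  measurable_fun setT g -> cmeas (fun xi => cexp (f xi) (g xi)).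
Proof.
move=> mf mg; apply: cmeas_Complex; apply: measurable_funM.
- exact: measurable_expRT.
- exact: measurable_cosT.
- exact: measurable_expRT.
- exact: measurable_sinT.
Qed.

Lemma cmeas_cphase z : cmeas (cphase z).
Proof.
apply: cmeas_Complex.
  by apply: measurable_cosT; exact: measurable_dotvr.
by apply: measurable_sinT; exact: measurable_dotvr.
Qed.

Lemma cint_meas k : cint k -> cmeas k.
Proof. by move=> [i1 i2]; split; [exact: rint_meas i1|exact: rint_meas i2]. Qed.

Lemma cintM k X C : cint k -> cmeas X -> (forall xi, cmod (X xi) <= C) ->
  cint (fun xi => k xi * X xi).
Proof.
move=> [i1 i2] [mX1 mX2] XC.
have C1 xi : `|Re (X xi)| <= C by rewrite (le_trans (norm_Re_le _)).
have C2 xi : `|Im (X xi)| <= C by rewrite (le_trans (norm_Im_le _)).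
split.
  rewrite (_ : _ \o _ = fun xi => Re (k xi) * Re (X xi) - Im (k xi) * Im (X xi)).
    by apply: rintB; [exact: rintM i1 mX1 C1|exact: rintM i2 mX2 C2].
  by apply/funext => xi; exact: ReM.
rewrite (_ : _ \o _ = fun xi => Re (k xi) * Im (X xi) + Im (k xi) * Re (X xi)).
  by apply: rintD; [exact: rintM i1 mX2 C2|exact: rintM i2 mX1 C1].
by apply/funext => xi; exact: ImM.
Qed.

Lemma cintD k1 k2 : cint k1 -> cint k2 -> cint (fun xi => k1 xi + k2 xi).
Proof.
move=> [i1 i2] [j1 j2]; split.
  rewrite (_ : _ \o _ = fun xi => Re (k1 xi) + Re (k2 xi)); first exact: rintD.
  by apply/funext => xi; exact: ReD.
rewrite (_ : _ \o _ = fun xi => Im (k1 xi) + Im (k2 xi)); first exact: rintD.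
by apply/funext => xi; exact: ImD.
Qed.

Lemma rint_ft k x : cint k -> rint (leb d)
  (fun xi => Re (k xi) * cos (dotv xi x) + Im (k xi) * sin (dotv xi x)).
Proof.
have mx := measurable_dotvr x.
by move=> [i1 i2]; apply: rintD; [exact: rint_cos|exact: rint_sin].
Qed.

Lemma ftD k1 k2 x : cint k1 -> cint k2 ->
  ft (fun xi => k1 xi + k2 xi) x = ft k1 x + ft k2 x.
Proof.
move=> c1 c2; rewrite /ft -IntD; [|exact: rint_ft..].
by apply: eq_Int => xi; rewrite ReD ImD; ring.
Qed.

Lemma cintZ (c : R) k : cint k -> cint (fun xi => Complex c 0 * k xi).
Proof.
move=> [i1 i2]; split.
  rewrite (_ : _ \o _ = fun xi => c * Re (k xi)); first exact: rintZ.
  by apply/funext => xi; rewrite /comp ReM /= mul0r subr0.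
rewrite (_ : _ \o _ = fun xi => c * Im (k xi)); first exact: rintZ.
by apply/funext => xi; rewrite /comp ImM /= mul0r addr0.
Qed.

Lemma ftZ (c : R) k x : cint k ->
  ft (fun xi => Complex c 0 * k xi) x = c * ft k x.
Proof.
move=> ck; rewrite /ft -IntZ; last exact: rint_ft.
by apply: eq_Int => xi; rewrite ReM ImM /=; ring.
Qed.

Lemma eq_posft k1 k2 : k1 =1 k2 -> posft k1 -> posft k2.
Proof. by move=> /funext ->. Qed.

Lemma posftD k1 k2 : posft k1 -> posft k2 -> posft (fun xi => k1 xi + k2 xi).
Proof.
move=> [c1 p1] [c2 p2]; split; first exact: cintD.
by move=> x; rewrite ftD// addr_ge0.
Qed.

Lemma posftZ (c : R) k : 0 <= c -> posft k -> posft (fun xi => Complex c 0 * k xi).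
Proof.
move=> c0 [ck pk]; split; first exact: cintZ.
by move=> x; rewrite ftZ// mulr_ge0.
Qed.

Lemma ft_cvg k (X_ : nat -> vec -> R[i]) X C x : cint k ->
  (forall n, cmeas (X_ n)) -> cmeas X -> (forall n xi, cmod (X_ n xi) <= C) ->
  (forall xi, cmod (X xi) <= C) ->
  (forall xi, cmod (X_ n xi - X xi) @[n --> \oo] --> (0 : R)) ->
  ft (fun xi => k xi * X_ n xi) x @[n --> \oo] --> ft (fun xi => k xi * X xi) x.
Proof.
move=> ck mX_ mX XnC XC XX.
have mk := cint_meas ck.
have [ck1 ck2] := ck.
have mterm Y : cmeas Y -> measurable_fun setT
    (fun xi => Re (Y xi) * cos (dotv xi x) + Im (Y xi) * sin (dotv xi x)).
  move=> [mY1 mY2]; apply: measurable_funD; apply: measurable_funM => //.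
    by apply: measurable_cosT; exact: measurable_dotvr.
  by apply: measurable_sinT; exact: measurable_dotvr.
have term_le Y xi : `|Re (Y xi) * cos (dotv xi x) + Im (Y xi) * sin (dotv xi x)|
    <= 2 * cmod (Y xi).
  rewrite (le_trans (ler_normD _ _))// mulr_natl mulr2n lerD// normrM.
    by rewrite -[leRHS]mulr1 ler_pM// ?norm_Re_le// cos_bound1.
  by rewrite -[leRHS]mulr1 ler_pM// ?norm_Im_le// sin_bound1.
have C0 : 0 <= C by rewrite (le_trans _ (XC [tuple 0 | i < d])) ?cmod_ge0.
apply: (@Int_cvg _ _ _ _ _ _
  (fun xi => 2 * C * (`|Re (k xi)| + `|Im (k xi)|)) _ _ _ _ _).2.
- by move=> n; apply: (mterm (fun xi => k xi * X_ n xi)); exact: cmeasM.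
- by apply: (mterm (fun xi => k xi * X xi)); exact: cmeasM.
- move=> xi.
  apply: (@cvg_dist_le _ _ (fun n => 2 * (cmod (k xi) * cmod (X_ n xi - X xi)))).
    move=> n.
    have := term_le (fun=> k xi * (X_ n xi - X xi)) xi; rewrite cmodM.
    apply: le_trans; rewrite mulrBr; case: (k xi * X_ n xi) => a b.
    case: (k xi * X xi) => a' b' /=.
    by apply: eq_ler; congr `|_|; ring.
  rewrite -[X in _ --> X](mulr0 (2 * cmod (k xi))).
  under eq_fun do rewrite mulrA.
  by apply: cvgMr; exact: XX.
- by apply: rintZ; apply: rintD; exact: rint_norm.
- move=> n xi; rewrite (le_trans (term_le (fun xi => k xi * X_ n xi) xi))//.
  rewrite cmodM -mulrA ler_wpM2l// mulrC ler_pM ?cmod_ge0//.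
  by case: (k xi) => a b; exact: cmod_le.
Qed.

Lemma posft_cvg k (X_ : nat -> vec -> R[i]) X C : cint k ->
  (forall n, cmeas (X_ n)) -> cmeas X -> (forall n xi, cmod (X_ n xi) <= C) ->
  (forall xi, cmod (X xi) <= C) ->
  (forall xi, cmod (X_ n xi - X xi) @[n --> \oo] --> (0 : R)) ->
  (forall n, posft (fun xi => k xi * X_ n xi)) -> posft (fun xi => k xi * X xi).
Proof.
move=> ck mX_ mX XnC XC XX pn; split; first exact: cintM ck mX XC.
move=> x; have cv := @ft_cvg k X_ X C x ck mX_ mX XnC XC XX.
rewrite -(cvg_lim _ cv)//; apply: limr_ge; first by apply/cvg_ex; eexists; exact: cv.
by apply: nearW => n; exact: (pn n).2.
Qed.

Lemma cmod_cphase z xi : cmod (cphase z xi) = 1.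
Proof. by rewrite cmodE cos2Dsin2 sqrtr1. Qed.

Lemma ft_cphase k z x :
  ft (fun xi => k xi * cphase z xi) x = ft k (vadd x (vopp z)).
Proof.
apply: eq_Int => xi; rewrite ReM ImM /= dotvDr dotvNr cosD sinD cosN sinN.
by ring.
Qed.

Lemma posft_cphase k z : posft k -> posft (fun xi => k xi * cphase z xi).
Proof.
move=> [ck pk]; split.
  by apply: (cintM ck (cmeas_cphase z)) => xi; rewrite cmod_cphase.
by move=> x; rewrite ft_cphase.
Qed.

End positive_transform.

(** * Multiplication by transforms of measures *)

Section measure_transform.
Context {R : realType} {d : nat}.
Notation vec := (d.-tuple R).
Notation Re := (@complex.Re R).
Notation Im := (@complex.Im R).
Notation smeasure := {sigma_finite_measure set vec -> \bar R}.
Implicit Types (m : smeasure) (w : vec -> R) (k : vec -> R[i]).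

Definition hatc m w (xi : vec) : R := \int[m]_z (w z * cos (dotv xi z)).
Definition hats m w (xi : vec) : R := \int[m]_z (w z * sin (dotv xi z)).

Lemma measurable_dotv2 :
  measurable_fun setT (fun p : vec * vec => dotv p.1 p.2).
Proof.
apply: measurable_dotv => i.
  exact: (measurableT_comp (measurable_tnthR i)).
exact: (measurableT_comp (measurable_tnthR i)).
Qed.

Lemma measurable_hatc m w : rint m w -> measurable_fun setT (hatc m w).
Proof.
move=> iw; apply: (@measurable_Int_param _ _ _ _ _ m
  (fun p : vec * vec => w p.2 * cos (dotv p.1 p.2)) (fun z => `|w z|)).
- apply: measurable_funM; last by apply: measurable_cosT; exact: measurable_dotv2.
  exact: (measurableT_comp (rint_meas iw)).
- exact: rint_norm.
- by move=> x y /=; rewrite normrM ler_piMr// cos_bound1.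
Qed.

Lemma measurable_hats m w : rint m w -> measurable_fun setT (hats m w).
Proof.
move=> iw; apply: (@measurable_Int_param _ _ _ _ _ m
  (fun p : vec * vec => w p.2 * sin (dotv p.1 p.2)) (fun z => `|w z|)).
- apply: measurable_funM; last by apply: measurable_sinT; exact: measurable_dotv2.
  exact: (measurableT_comp (rint_meas iw)).
- exact: rint_norm.
- by move=> x y /=; rewrite normrM ler_piMr// sin_bound1.
Qed.

Lemma rint_wcos m w xi : rint m w -> rint m (fun z => w z * cos (dotv xi z)).
Proof. by move=> iw; apply: rint_cos iw _; exact: measurable_dotvl. Qed.

Lemma rint_wsin m w xi : rint m w -> rint m (fun z => w z * sin (dotv xi z)).
Proof. by move=> iw; apply: rint_sin iw _; exact: measurable_dotvl. Qed.

Lemma norm_hatc_le m w xi : rint m w -> `|hatc m w xi| <= \int[m]_z `|w z|.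
Proof.
move=> iw; apply: norm_Int_le; [exact: rint_wcos|exact: rint_norm|].
by move=> z; rewrite normrM ler_piMr// cos_bound1.
Qed.

Lemma norm_hats_le m w xi : rint m w -> `|hats m w xi| <= \int[m]_z `|w z|.
Proof.
move=> iw; apply: norm_Int_le; [exact: rint_wsin|exact: rint_norm|].
by move=> z; rewrite normrM ler_piMr// sin_bound1.
Qed.

Definition hat m w (xi : vec) : R[i] := Complex (hatc m w xi) (hats m w xi).

Lemma cmeas_hat m w : rint m w -> cmeas (hat m w).
Proof.
by move=> iw; apply: cmeas_Complex; [exact: measurable_hatc|exact: measurable_hats].
Qed.

(** Multiplication by the transform of the measure w dm convolves [ft k] with that measure, by
    Fubini. *)
Lemma ft_hat m w k x : rint m w -> cint k ->
  rint m (fun z => w z * ft k (vadd x (vopp z))) /\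
  ft (fun xi => k xi * hat m w xi) x = \int[m]_z (w z * ft k (vadd x (vopp z))).
Proof.
move=> iw ck; have [ck1 ck2] := ck.
pose e (p : vec * vec) : R := dotv p.1 (vadd x (vopp p.2)).
have me : measurable_fun setT e.
  apply: measurable_dotv => i.
    exact: (measurableT_comp (measurable_tnthR i)).
  under eq_fun do rewrite tnth_vadd tnth_vopp.
  apply: measurable_funB; first exact: measurable_cst.
  exact: (measurableT_comp (measurable_tnthR i)).
pose f (p : vec * vec) := w p.2 * (Re (k p.1) * cos (e p) + Im (k p.1) * sin (e p)).
have mf : measurable_fun setT f.
  apply: measurable_funM.
    exact: (measurableT_comp (rint_meas iw)).
  apply: measurable_funD; apply: measurable_funM.
  - exact: (measurableT_comp (rint_meas ck1)).
  - exact: measurable_cosT.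
  - exact: (measurableT_comp (rint_meas ck2)).
  - exact: measurable_sinT.
have fgh xi z : `|f (xi, z)| <= (`|Re (k xi)| + `|Im (k xi)|) * `|w z|.
  rewrite normrM mulrC ler_wpM2r// (le_trans (ler_normD _ _))// !normrM.
  by rewrite lerD// ler_piMr// ?cos_bound1// sin_bound1.
have ig : rint (leb d) (fun xi => `|Re (k xi)| + `|Im (k xi)|).
  by apply: rintD; exact: rint_norm.
have [_ _ _ r2 E] := fubini_dom mf ig (rint_norm iw) fgh.
have inner z : \int[leb d]_xi f (xi, z) = w z * ft k (vadd x (vopp z)).
  by rewrite /ft -IntZ//; exact: rint_ft.
have innerE : (fun z => \int[leb d]_xi f (xi, z)) =
    (fun z => w z * ft k (vadd x (vopp z))) by apply/funext.
split; first by rewrite -innerE.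
rewrite -(eq_Int _ inner) -E; apply: eq_Int => xi.
rewrite ReM ImM /= {mf fgh r2 E inner innerE}.
transitivity (\int[m]_z
  ((Re (k xi) * cos (dotv xi x) + Im (k xi) * sin (dotv xi x)) * (w z * cos (dotv xi z))
  + (Re (k xi) * sin (dotv xi x) - Im (k xi) * cos (dotv xi x)) * (w z * sin (dotv xi z)))).
  rewrite IntD; [|by apply: rintZ; exact: rint_wcos|by apply: rintZ; exact: rint_wsin].
  rewrite !IntZ; [|exact: rint_wsin|exact: rint_wcos].
  by rewrite -/(hatc m w xi) -/(hats m w xi); ring.
apply: eq_Int => z; rewrite /f /e /= dotvDr dotvNr cosD sinD cosN sinN.
by ring.
Qed.

Variables (N nu : smeasure) (al : R).
Hypothesis al0 : 0 <= al.
Hypothesis nuN : forall g : vec -> R, measurable_fun setT g -> (forall z, 0 <= g z) ->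
  (al%:E * \int[nu]_z (g z)%:E <= \int[N]_z (g z)%:E)%E.

Lemma Int_diff_ge0 g : rint N g -> rint nu g -> (forall z, 0 <= g z) ->
  0 <= \int[N]_z g z - al * \int[nu]_z g z.
Proof.
move=> iN inu g0; rewrite subr_ge0 -lee_fin EFinM -!rintE//.
by apply: nuN => //; exact: rint_meas iN.
Qed.

(** The transform of w (N - al nu), a nonnegative measure by [nuN] when w >= 0, written as a
    difference of integrals. *)
Definition hatd w (xi : vec) : R[i] :=
  Complex (hatc N w xi - al * hatc nu w xi) (hats N w xi - al * hats nu w xi).

Lemma cmeas_hatd w : rint N w -> rint nu w -> cmeas (hatd w).
Proof.
move=> iN inu; apply: cmeas_Complex.
  apply: measurable_funB; [exact: measurable_hatc|apply: measurable_funM => //].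
  exact: measurable_hatc.
apply: measurable_funB; [exact: measurable_hats|apply: measurable_funM => //].
exact: measurable_hats.
Qed.

Definition hatd_bound w : R := 2 * (\int[N]_z `|w z| + al * \int[nu]_z `|w z|).

Lemma hatd_bound_le w xi : rint N w -> rint nu w ->
  `|Re (hatd w xi)| + `|Im (hatd w xi)| <= hatd_bound w.
Proof.
move=> iN inu; rewrite /hatd_bound mulr_natl mulr2n lerD//=.
  rewrite (le_trans (ler_normB _ _))// lerD ?norm_hatc_le//.
  by rewrite normrM ger0_norm// ler_wpM2l ?norm_hatc_le.
rewrite (le_trans (ler_normB _ _))// lerD ?norm_hats_le//.
by rewrite normrM ger0_norm// ler_wpM2l ?norm_hats_le.
Qed.

Lemma cmod_hatd_le w xi : rint N w -> rint nu w -> cmod (hatd w xi) <= hatd_bound w.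
Proof.
by move=> iN inu; rewrite (le_trans _ (hatd_bound_le xi iN inu))// cmod_le.
Qed.

Lemma posft_hatd w k : rint N w -> rint nu w -> (forall z, 0 <= w z) ->
  posft k -> posft (fun xi => k xi * hatd w xi).
Proof.
move=> iN inu w0 [ck pk]; split.
  by apply: (cintM ck (cmeas_hatd iN inu)) => xi; exact: cmod_hatd_le.
move=> x; have [rN EN] := ft_hat x iN ck; have [rnu Enu] := ft_hat x inu ck.
have hb m : rint m w -> cint (fun xi => k xi * hat m w xi).
  move=> im; apply: (@cintM _ _ _ _ (\int[m]_z `|w z| + \int[m]_z `|w z|)) => //.
    exact: cmeas_hat.
  move=> xi; rewrite (le_trans (cmod_le _ _))// lerD//.
    exact: norm_hatc_le.
  exact: norm_hats_le.
have -> : ft (fun xi => k xi * hatd w xi) x =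
    ft (fun xi => k xi * hat N w xi) x - al * ft (fun xi => k xi * hat nu w xi) x.
  rewrite -mulNr -ftZ; last exact: hb.
  rewrite -ftD; [|exact: hb|by apply: cintZ; exact: hb].
  congr ft; apply/funext => xi; case: (k xi) => a b.
  by rewrite /hatd /hat; apply/eqP; rewrite eq_complex /=;
    apply/andP; split; apply/eqP; ring.
rewrite EN Enu; apply: Int_diff_ge0 => // z.
by rewrite mulr_ge0.
Qed.

Section compound_poisson.
Variables (w : vec -> R) (tau : R).
Hypotheses (iN : rint N w) (inu : rint nu w) (w0 : forall z, 0 <= w z)
  (tau0 : 0 <= tau).

Let X n xi := cexp_approx n (tau * Re (hatd w xi)) (tau * Im (hatd w xi)).

Let step n xi : R[i] :=
  1 + Complex (tau * Re (hatd w xi) / n.+1%:R) (tau * Im (hatd w xi) / n.+1%:R).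

Let cmeas_step n : cmeas (step n).
Proof.
have [m1 m2] := cmeas_hatd iN inu.
apply: cmeasD; first exact: cmeas_cst.
by apply: cmeas_Complex; apply: measurable_funM => //; exact: measurable_funM.
Qed.

Let cmeas_X n : cmeas (X n).
Proof. exact/cmeasX/cmeas_step. Qed.

Let cstep (Z : R[i]) (n p q : R) : Z + Complex (tau / n) 0 * (Z * Complex p q) =
  Z * (1 + Complex (tau * p / n) (tau * q / n)).
Proof.
case: Z => a b; rewrite mulrDr mulr1; congr (_ + _).
by apply/eqP; rewrite eq_complex /=; apply/andP; split; apply/eqP; ring.
Qed.

Let XE k n j : posft k -> posft (fun xi => k xi *
  step n xi ^+ j).
Proof.
move=> pk; elim: j => [|j IH].
  by apply: eq_posft pk => xi; rewrite expr0 mulr1.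
have P := posftD IH (posftZ (divr_ge0 tau0 (ler0n _ n.+1)) (posft_hatd iN inu w0 IH)).
apply: eq_posft P => xi; rewrite exprSr [RHS]mulrA; exact: cstep.
Qed.

Let C := expR (tau * hatd_bound w).

Let tau_bound xi :
  `|tau * Re (hatd w xi)| + `|tau * Im (hatd w xi)| <= tau * hatd_bound w.
Proof.
by rewrite !normrM (ger0_norm tau0) -mulrDr ler_wpM2l// hatd_bound_le.
Qed.

(** The multiplier is, up to a positive constant, the characteristic function of a compound Poisson
    law with intensity tau w (N - al nu); it is the limit of Euler products, each factor of which
    preserves [posft]. *)
Lemma posft_cexp_hatd k : posft k ->
  posft (fun xi => k xi * cexp (tau * Re (hatd w xi)) (tau * Im (hatd w xi))).
Proof.
move=> pk; have [m1 m2] := cmeas_hatd iN inu.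
apply: (@posft_cvg _ _ k X _ C) => //; first exact: pk.1.
- by apply: cmeas_cexp; exact: measurable_funM.
- move=> n xi; rewrite (le_trans (cmod_cexp_approx _ _ _))// ler_expR.
  exact: tau_bound.
- move=> xi; rewrite cmod_cexp ler_expR (le_trans (ler_norm _))//.
  by rewrite (le_trans _ (tau_bound xi))// lerDl.
- by move=> xi; exact: cexp_approx_cvg.
- by move=> n; exact: XE.
Qed.

(* Dropping the jumps described by [w] costs at most the probability that none occurs. *)
Lemma ft_le_cexp_hatd k x : posft k ->
  ft k x <= ft (fun xi => k xi * cexp (tau * Re (hatd w xi)) (tau * Im (hatd w xi))) x.
Proof.
move=> pk; have [m1 m2] := cmeas_hatd iN inu.
have ck := pk.1.
have C0 : forall n xi, cmod (X n xi) <= C.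
  move=> n xi; rewrite (le_trans (cmod_cexp_approx _ _ _))// ler_expR.
  exact: tau_bound.
have C1 xi : cmod (cexp (tau * Re (hatd w xi)) (tau * Im (hatd w xi))) <= C.
  rewrite cmod_cexp ler_expR (le_trans (ler_norm _))//.
  by rewrite (le_trans _ (tau_bound xi))// lerDl.
have cv := @ft_cvg _ _ k X _ C x ck cmeas_X
  (cmeas_cexp (measurable_funM (measurable_cst tau) m1)
     (measurable_funM (measurable_cst tau) m2)) C0 C1
  (fun xi => cexp_approx_cvg _ _).
rewrite -(cvg_lim _ cv)//; apply: limr_ge; first by apply/cvg_ex; eexists; exact: cv.
apply: nearW => n; rewrite /X /cexp_approx.
(* Every Euler factor adds a kernel with nonnegative transform, so the transform increases with the
   number j of factors. *)
suff grow i j : ft k x <= ft (fun xi => k xi *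
    step i xi ^+ j) x.
  exact: grow.
elim: j => [|j IH].
  by apply: eq_ler; congr ft; apply/funext => xi;
    rewrite expr0 mulr1.
apply: (le_trans IH).
have P := posftZ (divr_ge0 tau0 (ler0n _ i.+1)) (posft_hatd iN inu w0 (XE i j pk)).
rewrite [leRHS](_ : _ = ft (fun xi => k xi *
  step i xi ^+ j) x
  + ft (fun xi => Complex (tau / i.+1%:R) 0 * (k xi *
  step i xi ^+ j
   * hatd w xi)) x); first by rewrite lerDl; exact: P.2.
rewrite -ftD; [|exact: (XE i j pk).1|exact: P.1].
congr ft; apply/funext => xi; rewrite exprSr mulrA; apply/esym; exact: cstep.
Qed.

End compound_poisson.

End measure_transform.

(** * Truncated Levy exponents *)

Section truncated_levy.
Context {R : realType} {d : nat}.
Notation vec := (d.-tuple R).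
Notation Re := (@complex.Re R).
Notation Im := (@complex.Im R).
Notation smeasure := {sigma_finite_measure set vec -> \bar R}.
Implicit Types (m : smeasure) (w : vec -> R) (k : vec -> R[i]) (xi z : vec).

Definition ball1 (r : R) z : R := if enorm z < r then 1 else 0.

Lemma ball1_ge0 r z : 0 <= ball1 r z.
Proof. by rewrite /ball1; case: ifP. Qed.

Lemma ball1_le1 r z : ball1 r z <= 1.
Proof. by rewrite /ball1; case: ifP. Qed.

Lemma measurable_ball1 r : measurable_fun setT (ball1 r).
Proof.
apply: measurable_fun_ifT => //; apply: measurable_fun_ltr => //.
exact: measurable_enorm.
Qed.

(** Cutting out the jumps smaller than 1/(n+1) makes a Levy measure finite, so that the compound
    Poisson results apply before n tends to infinity. *)
Definition annulus1 r n z : R := ball1 r z * (1 - ball1 n.+1%:R^-1 z).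

Lemma annulus1_ge0 r n z : 0 <= annulus1 r n z.
Proof. by rewrite mulr_ge0 ?ball1_ge0// subr_ge0 ball1_le1. Qed.

Lemma annulus1_le r n z : annulus1 r n z <= ball1 r z.
Proof. by rewrite ler_piMr ?ball1_ge0// gerBl ball1_ge0. Qed.

Lemma measurable_annulus1 r n : measurable_fun setT (annulus1 r n).
Proof.
apply: measurable_funM; first exact: measurable_ball1.
by apply: measurable_funB => //; exact: measurable_ball1.
Qed.

Definition levy1 z : R := Num.min 1 (enorm z ^+ 2).

Lemma levy1_ge0 z : 0 <= levy1 z.
Proof. by rewrite le_min ler01 sqr_ge0. Qed.

Lemma measurable_levy1 : measurable_fun setT levy1.
Proof.
apply: measurable_minr => //; apply: measurable_funX; exact: measurable_enorm.
Qed.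

Lemma rint_ball1_sqr (m : {measure set vec -> \bar R}) r :
  rint m levy1 -> rint m (fun z => ball1 r z * enorm z ^+ 2).
Proof.
move=> im; apply: (rint_dom _ (rintZ (1 + r ^+ 2) im)).
  apply: measurable_funM; first exact: measurable_ball1.
  by apply: measurable_funX; exact: measurable_enorm.
move=> z; rewrite ger0_norm; last exact: mulr_ge0 (ball1_ge0 _ _) (sqr_ge0 _).
rewrite /ball1 /levy1; case: ifPn => zr; last first.
  by rewrite mul0r; apply: mulr_ge0 (levy1_ge0 _); rewrite addr_ge0// sqr_ge0.
rewrite mul1r minEle; have e0 := enorm_ge0 z; have e2 := sqr_ge0 (enorm z).
have r2 := sqr_ge0 r; case: ifP => _; last by nra.
have : enorm z ^+ 2 <= r ^+ 2.
  by apply: lerXn2r; rewrite ?nnegrE ?(le_trans e0 (ltW zr))// ltW.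
by lra.
Qed.

Definition conc1 r z : R := Num.min 1 (enorm z ^+ 2 / r ^+ 2).

Lemma conc1_ge0 r z : 0 <= conc1 r z.
Proof. by rewrite le_min ler01 divr_ge0 ?sqr_ge0. Qed.

Lemma conc1_le1 r z : conc1 r z <= 1.
Proof. by rewrite ge_min lexx. Qed.

Lemma measurable_conc1 r : measurable_fun setT (conc1 r).
Proof.
apply: measurable_minr => //; apply: measurable_funM => //.
by apply: measurable_funX; exact: measurable_enorm.
Qed.

Lemma conc1_anti (r s : R) z : 0 < r -> r <= s -> conc1 s z <= conc1 r z.
Proof.
move=> r0 rs; rewrite le_min ge_min lexx /= ge_min; apply/orP; right.
rewrite ler_wpM2l ?sqr_ge0// lef_pV2 ?posrE ?exprn_gt0//; last exact: lt_le_trans rs.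
by rewrite lerXn2r ?nnegrE// ?(ltW r0)// (le_trans (ltW r0)).
Qed.

Lemma conc1_scale (r s : R) z : 0 < r -> r <= s -> conc1 r z <= (s / r) ^+ 2 * conc1 s z.
Proof.
move=> r0 rs; have s0 : 0 < s by exact: lt_le_trans rs.
have sr : 1 <= (s / r) ^+ 2 by rewrite exprn_ege1// ler_pdivlMr// mul1r.
rewrite {2}/conc1 minEle; case: ifP => _.
  by rewrite mulr1 (le_trans (conc1_le1 _ _)).
rewrite ge_min; apply/orP; right.
by apply: eq_ler; field; rewrite !gt_eqF.
Qed.

Lemma rint_conc1 (m : {measure set vec -> \bar R}) r : 0 < r ->
  rint m levy1 -> rint m (conc1 r).
Proof.
move=> r0 im; apply: (rint_dom _ (rintZ (1 + r^-1 ^+ 2) im)); first exact: measurable_conc1.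
move=> z; rewrite ger0_norm ?conc1_ge0// /conc1 /levy1.
have [r1|r1] := leP 1 r.
  apply: (@le_trans _ _ (1 * conc1 1 z)).
    by rewrite mul1r; exact: conc1_anti.
  rewrite /conc1 expr1n divr1 ler_wpM2r ?le_min ?ler01 ?sqr_ge0//.
  by rewrite lerDl sqr_ge0.
have := @conc1_scale r 1 z r0 (ltW r1).
rewrite /conc1 expr1n divr1 mul1r => h; apply: (le_trans h).
rewrite ler_wpM2r ?le_min ?ler01 ?sqr_ge0//.
by rewrite lerDr.
Qed.

Lemma compl_ball1_le r z : 0 < r -> 1 - ball1 r z <= conc1 r z.
Proof.
move=> r0; rewrite /ball1; case: ifPn => [_|]; first by rewrite subrr conc1_ge0.
rewrite -leNgt => rz; rewrite subr0 le_min lexx /= ler_pdivlMr ?exprn_gt0// mul1r.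
by rewrite lerXn2r ?nnegrE ?enorm_ge0// ltW.
Qed.

Lemma rint_compl_ball1 (m : {measure set vec -> \bar R}) r :
  0 < r -> rint m levy1 -> rint m (fun z => 1 - ball1 r z).
Proof.
move=> r0 im; apply: (rint_dom _ (rint_conc1 r0 im)) => [|z].
  by apply: measurable_funB => //; exact: measurable_ball1.
by rewrite ger0_norm ?compl_ball1_le// subr_ge0 ball1_le1.
Qed.

Lemma rint_annulus1 m r n : rint m levy1 -> rint m (annulus1 r n).
Proof.
move=> im.
have n0 : 0 < n.+1%:R^-1 :> R by rewrite invr_gt0.
apply: rint_dom (rint_compl_ball1 n0 im) _; first exact: measurable_annulus1.
move=> z; rewrite ger0_norm ?annulus1_ge0// ler_piMl ?ball1_le1//.
by rewrite subr_ge0 ball1_le1.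
Qed.

Lemma cvg_annulus1 r (f : vec -> R) z : f (vzero R d) = 0 ->
  annulus1 r n z * f z @[n --> \oo] --> ball1 r z * f z.
Proof.
move=> f0; have [->|z0] := eqVneq z (vzero R d).
  by rewrite f0 mulr0; under eq_fun do rewrite mulr0; exact: cvg_cst.
have ez : 0 < enorm z.
  rewrite lt_neqAle enorm_ge0 andbT eq_sym.
  by apply: contra z0 => /eqP /enorm_eq0 ->.
apply: cvg_near_cst; near=> n.
rewrite /annulus1 /(ball1 n.+1%:R^-1) ifF ?subr0 ?mulr1//.
apply/negbTE; rewrite -leNgt -[leRHS]invrK lef_pV2 ?posrE ?invr_gt0//.
near: n; exists (Num.trunc (enorm z)^-1) => // n /= hn.
rewrite ltW// (lt_le_trans (truncnS_gt _))// ler_nat.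
by rewrite ltnS.
Unshelve. all: by end_near. Qed.

(** [levyc] and [levys] are the two parts of the exponent of the jumps kept by w. All of these jumps
    are compensated, not only those below 1; for w the indicator of |z| < r this is what turns the
    drift b into b_r. *)
Definition levyc m w xi : R := \int[m]_z (w z * (1 - cos (dotv xi z))).
Definition levys m w xi : R := \int[m]_z (w z * (sin (dotv xi z) - dotv xi z)).

Lemma dotv_sqr_le xi z : dotv xi z ^+ 2 <= enorm xi ^+ 2 * enorm z ^+ 2.
Proof.
rewrite -exprMn -real_normK ?num_real//.
by rewrite lerXn2r ?nnegrE ?mulr_ge0 ?enorm_ge0// dotv_le.
Qed.

Lemma norm_one_sub_cos_dotv_le xi z :
  `|1 - cos (dotv xi z)| <= enorm xi ^+ 2 * enorm z ^+ 2.
Proof.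
rewrite ger0_norm ?one_sub_cos_ge0// (le_trans (one_sub_cos_le _))//.
have := dotv_sqr_le xi z; have := sqr_ge0 (dotv xi z); lra.
Qed.

Lemma norm_sin_sub_dotv_le xi z :
  `|sin (dotv xi z) - dotv xi z| <= enorm xi ^+ 2 * enorm z ^+ 2.
Proof. exact: le_trans (norm_sin_subl_le _) (dotv_sqr_le xi z). Qed.

Lemma measurable_sub_sin_dotv xi :
  measurable_fun setT (fun z => sin (dotv xi z) - dotv xi z).
Proof.
apply: measurable_funB; last exact: measurable_dotvl.
by apply: measurable_sinT; exact: measurable_dotvl.
Qed.

Lemma measurable_one_sub_cos_dotv xi :
  measurable_fun setT (fun z => 1 - cos (dotv xi z)).
Proof.
apply: measurable_funB => //.
by apply: measurable_cosT; exact: measurable_dotvl.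
Qed.

(** Dominated convergence with |z|^2 on the ball as majorant. The bound on f forces f to vanish at
    the origin, the one point that no annulus reaches. *)
Lemma Int_annulus1_cvg (m : {measure set vec -> \bar R}) r (f : vec -> R) C :
  rint m levy1 -> measurable_fun setT f -> (forall z, `|f z| <= C * enorm z ^+ 2) ->
  rint m (fun z => ball1 r z * f z) /\
  \int[m]_z (annulus1 r n z * f z) @[n --> \oo] --> \int[m]_z (ball1 r z * f z).
Proof.
move=> im mf fC.
apply: (@Int_cvg _ _ _ _ _ _ (fun z => C * (ball1 r z * enorm z ^+ 2))).
- by move=> n; apply: measurable_funM => //; exact: measurable_annulus1.
- by apply: measurable_funM => //; exact: measurable_ball1.
- move=> z; apply: cvg_annulus1; apply/eqP; rewrite -normr_le0.
  by rewrite (le_trans (fC _))// enorm0 expr0n mulr0.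
- by apply: rintZ; exact: rint_ball1_sqr.
- move=> n z; rewrite normrM (ger0_norm (annulus1_ge0 _ _ _)) mulrCA.
  by rewrite ler_pM ?annulus1_ge0// annulus1_le.
Qed.

Lemma levyc_cvg (m : {measure set vec -> \bar R}) r xi : rint m levy1 ->
  rint m (fun z => ball1 r z * (1 - cos (dotv xi z))) /\
  \int[m]_z (annulus1 r n z * (1 - cos (dotv xi z))) @[n --> \oo] -->
  \int[m]_z (ball1 r z * (1 - cos (dotv xi z))).
Proof.
move=> im; apply: Int_annulus1_cvg im (measurable_one_sub_cos_dotv xi) _.
exact: norm_one_sub_cos_dotv_le.
Qed.

Lemma levys_cvg (m : {measure set vec -> \bar R}) r xi : rint m levy1 ->
  rint m (fun z => ball1 r z * (sin (dotv xi z) - dotv xi z)) /\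
  \int[m]_z (annulus1 r n z * (sin (dotv xi z) - dotv xi z)) @[n --> \oo] -->
  \int[m]_z (ball1 r z * (sin (dotv xi z) - dotv xi z)).
Proof.
move=> im; apply: Int_annulus1_cvg im (measurable_sub_sin_dotv xi) _.
exact: norm_sin_sub_dotv_le.
Qed.

Definition mean1 m w : vec := [tuple \int[m]_z (w z * tnth z i) | i < d].

Lemma Int_wdotv m w xi : (forall i, rint m (fun z => w z * tnth z i)) ->
  rint m (fun z => w z * dotv xi z) /\
  \int[m]_z (w z * dotv xi z) = dotv xi (mean1 m w).
Proof.
move=> iw.
have E : (fun z => w z * dotv xi z) =
    (fun z => \sum_(i < d) (tnth xi i * (w z * tnth z i))).
  by apply/funext => z; rewrite mulr_sumr; apply: eq_bigr => i _; rewrite mulrCA.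
split; first by rewrite E; apply: rint_sum => i; exact: rintZ.
rewrite (eq_Int _ (fun z => congr1 (@^~ z) E)) Int_sum; last by move=> i; exact: rintZ.
by apply: eq_bigr => i _; rewrite IntZ// tnth_mktuple.
Qed.

Lemma rint_annulus1_tnth m r n i : rint m levy1 ->
  rint m (fun z => annulus1 r n z * tnth z i).
Proof.
move=> im; apply: (rint_dom _ (rintZ `|r| (rint_annulus1 r n im))).
  by apply: measurable_funM; [exact: measurable_annulus1|exact: measurable_tnthR].
move=> z; rewrite normrM (ger0_norm (annulus1_ge0 _ _ _)) mulrC.
rewrite /annulus1 /(ball1 r); case: ifPn => zr; last by rewrite !mul0r !mulr0.
rewrite ler_wpM2r ?mul1r ?subr_ge0 ?ball1_le1//.
by rewrite (le_trans (norm_tnth_le_enorm _ _))// (le_trans (ltW zr))// ler_norm.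
Qed.

Lemma levyc_annulus1E m r n xi : rint m levy1 ->
  levyc m (annulus1 r n) xi = \int[m]_z annulus1 r n z - hatc m (annulus1 r n) xi.
Proof.
move=> im; have iw := rint_annulus1 r n im.
rewrite /hatc -IntB//; last exact: rint_wcos.
by apply: eq_Int => z; rewrite mulrBr mulr1.
Qed.

Lemma levys_annulus1E m r n xi : rint m levy1 ->
  levys m (annulus1 r n) xi =
  hats m (annulus1 r n) xi - dotv xi (mean1 m (annulus1 r n)).
Proof.
move=> im; have iw := rint_annulus1 r n im.
have [i1 <-] := Int_wdotv xi (fun i => rint_annulus1_tnth r n i im).
rewrite /hats -IntB//; last exact: rint_wsin.
by apply: eq_Int => z; rewrite mulrBr.
Qed.

Lemma measurable_levyc m r : rint m levy1 -> measurable_fun setT (levyc m (ball1 r)).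
Proof.
move=> im; apply: (@measurable_fun_cvg _ _ _ setT
    (fun n => levyc m (annulus1 r n))).
  move=> n; rewrite (funext (fun xi => levyc_annulus1E r n xi im)).
  apply: measurable_funB => //; apply: measurable_hatc.
  exact: rint_annulus1.
by move=> xi _; exact: (levyc_cvg r xi im).2.
Qed.

Lemma measurable_levys m r : rint m levy1 -> measurable_fun setT (levys m (ball1 r)).
Proof.
move=> im; apply: (@measurable_fun_cvg _ _ _ setT
    (fun n => levys m (annulus1 r n))).
  move=> n; rewrite (funext (fun xi => levys_annulus1E r n xi im)).
  apply: measurable_funB; last exact: measurable_dotvr.
  by apply: measurable_hats; exact: rint_annulus1.
by move=> xi _; exact: (levys_cvg r xi im).2.
Qed.

Lemma measurable_vopp : measurable_fun setT (@vopp R d).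
Proof.
apply/measurable_fun_tnthP => i.
rewrite (_ : _ \o _ = fun x => - tnth x i); last first.
  by apply/funext => x /=; rewrite tnth_vopp.
by apply: measurableT_comp => //; exact: measurable_tnthR.
Qed.

(** Reflecting z turns the integral into its own negative. *)
Lemma Int_odd m (f : vec -> R) : symmetric_measure m -> rint m f ->
  (forall z, f (vopp z) = - f z) -> \int[m]_z f z = 0.
Proof.
move=> sm iF fodd.
pose P := measure_function_pushforward__canonical__measure_function_Measure m measurable_vopp.
have E : (\int[P]_z (f z)%:E = \int[m]_z (f z)%:E)%E.
  by apply: eq_measure_integral => A mA _; exact: sm.
have iNf : rint m (f \o @vopp R d).
  by rewrite (_ : f \o _ = fun z => - f z); [exact: rintN|exact/funext].
have : (\int[P]_z (f z)%:E = \int[m]_z (f (vopp z))%:E)%E.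
  have := @integral_pushforward _ _ _ _ _ _ measurable_vopp m setT (EFin \o f).
  rewrite preimage_setT; apply => //.
  - by apply/measurable_EFinP; exact: rint_meas iF.
rewrite E; under [X in _ = X -> _]eq_integral do rewrite fodd.
rewrite !rintE//; last exact: rintN.
by rewrite IntN// => -[] /eqP; rewrite -addr_eq0 -mulr2n mulrn_eq0 => /eqP.
Qed.

End truncated_levy.

(** * Truncated characteristic functions as multipliers *)

Section levy_multiplier.
Context {R : realType} {d : nat}.
Notation vec := (d.-tuple R).
Notation Re := (@complex.Re R).
Notation Im := (@complex.Im R).
Notation smeasure := {sigma_finite_measure set vec -> \bar R}.
Implicit Types (k : vec -> R[i]) (xi z : vec).

Lemma cexp_cvg (p q : nat -> R) (p0 q0 : R) : p n @[n --> \oo] --> p0 ->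
  q n @[n --> \oo] --> q0 ->
  cmod (cexp (p n) (q n) - cexp p0 q0) @[n --> \oo] --> (0 : R).
Proof.
move=> pp qq.
have ep : expR (p n) @[n --> \oo] --> expR p0.
  by apply: continuous_cvg => //; exact: continuous_expR.
have cq : cos (q n) @[n --> \oo] --> cos q0.
  by apply: continuous_cvg => //; exact: continuous_cos.
have sq : sin (q n) @[n --> \oo] --> sin q0.
  by apply: continuous_cvg => //; exact: continuous_sin.
apply: (cvg_dist_le _ (fun n => `|expR (p n) * cos (q n) - expR p0 * cos q0| +
   `|expR (p n) * sin (q n) - expR p0 * sin q0|)).
  by move=> n; rewrite subr0 ger0_norm ?cmod_ge0//; exact: cmod_le.
rewrite -[X in _ --> X](addr0 0); apply: cvgD.
  rewrite -[X in _ --> X](normr0 R) -(subrr (expR p0 * cos q0)).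
  by apply: cvg_norm; apply: cvgB; [exact: cvgM|exact: cvg_cst].
rewrite -[X in _ --> X](normr0 R) -(subrr (expR p0 * sin q0)).
by apply: cvg_norm; apply: cvgB; [exact: cvgM|exact: cvg_cst].
Qed.

Lemma cexpD (p q p' q' : R) : cexp p q * cexp p' q' = cexp (p + p') (q + q').
Proof.
rewrite /cexp expRD cosD sinD; apply/eqP; rewrite eq_complex /=.
by apply/andP; split; apply/eqP; ring.
Qed.

Lemma cexp_real (p : R) : Complex (expR p) 0 = cexp p 0.
Proof. by rewrite /cexp cos0 sin0 mulr1 mulr0. Qed.

Lemma cphaseE z xi : cphase z xi = cexp 0 (dotv xi z).
Proof. by rewrite /cexp expR0 !mul1r. Qed.

Variables (N nu : smeasure) (al r tau : R).
Hypotheses (al0 : 0 <= al) (tau0 : 0 <= tau).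
Hypothesis nuN : forall g : vec -> R, measurable_fun setT g -> (forall z, 0 <= g z) ->
  (al%:E * \int[nu]_z (g z)%:E <= \int[N]_z (g z)%:E)%E.
Hypotheses (iN : rint N levy1) (inu : rint nu levy1).
Hypothesis nusym : symmetric_measure nu.

(** The characteristic function at time tau of the compensated jumps described by w (N - al nu). For
    a symmetric nu and an even w the imaginary part of the exponent has no contribution from nu,
    hence [levys N] alone. *)
Definition levyexp (w : vec -> R) xi : R[i] :=
  cexp (- (tau * (levyc N w xi - al * levyc nu w xi))) (tau * levys N w xi).

Lemma levy_diff_ge0 xi : 0 <= levyc N (ball1 r) xi - al * levyc nu (ball1 r) xi.
Proof.
apply: (Int_diff_ge0 nuN); [exact: (levyc_cvg r xi iN).1|exact: (levyc_cvg r xi inu).1|].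
by move=> z; rewrite mulr_ge0 ?ball1_ge0 ?one_sub_cos_ge0.
Qed.

Lemma hats_sym n xi : hats nu (annulus1 r n) xi = 0.
Proof.
apply: Int_odd => //; first by apply: rint_wsin; exact: rint_annulus1.
move=> z; rewrite dotvNr sinN mulrN; congr (- (_ * _)).
by rewrite /annulus1 /ball1 enormN.
Qed.

(** On an annulus the measure is finite and the multiplier splits into a positive constant, a phase
    that removes the mean, and a compound Poisson factor; each preserves [posft]. The modulus is at
    most 1 throughout, so the limit over the annuli is dominated. *)
Lemma posft_levyexp k : posft k -> posft (fun xi => k xi * levyexp (ball1 r) xi).
Proof.
move=> pk.
have posn n : posft (fun xi => k xi * levyexp (annulus1 r n) xi).
  have jN := rint_annulus1 r n iN; have jnu := rint_annulus1 r n inu.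
  pose L := \int[N]_z annulus1 r n z - al * \int[nu]_z annulus1 r n z.
  pose v := vscale (- tau) (mean1 N (annulus1 r n)).
  have P0 := posft_cexp_hatd al0 nuN jN jnu (annulus1_ge0 r n) tau0 pk.
  have := posftZ (expR_ge0 (- (tau * L))) (posft_cphase v P0).
  apply: eq_posft => xi; rewrite /levyexp.
  rewrite levys_annulus1E// !levyc_annulus1E//.
  rewrite mulrCA -mulrA cexp_real cphaseE !cexpD; congr (_ * cexp _ _).
    by rewrite /L /=; ring.
  by rewrite /= hats_sym /v dotvZr; ring.
have C2 xi z : `|1 - cos (dotv xi z)| <= 2.
  by rewrite ger0_norm ?one_sub_cos_ge0 ?one_sub_cos_le2.
have bound w xi : 0 <= levyc N w xi - al * levyc nu w xi -> cmod (levyexp w xi) <= 1.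
  by move=> h; rewrite cmod_cexp -expR0 ler_expR oppr_le0 mulr_ge0.
apply: (@posft_cvg _ _ k (fun n => levyexp (annulus1 r n)) _ 1) => //.
- exact: pk.1.
- move=> n; have jN := rint_annulus1 r n iN; have jnu := rint_annulus1 r n inu.
  apply: cmeas_cexp.
    apply: measurableT_comp => //; apply: measurable_funM => //.
    rewrite (_ : (fun _ => _) = fun xi =>
      (\int[N]_z annulus1 r n z - hatc N (annulus1 r n) xi) -
      al * (\int[nu]_z annulus1 r n z - hatc nu (annulus1 r n) xi)); last first.
      by apply/funext => xi; rewrite !levyc_annulus1E.
    apply: measurable_funB.
      by apply: measurable_funB => //; exact: measurable_hatc.
    apply: measurable_funM => //.
    by apply: measurable_funB => //; exact: measurable_hatc.
  apply: measurable_funM => //; rewrite (funext (fun xi => levys_annulus1E r n xi iN)).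
  by apply: measurable_funB; [exact: measurable_hats|exact: measurable_dotvr].
- apply: cmeas_cexp.
    apply: measurableT_comp => //; apply: measurable_funM => //.
    apply: measurable_funB; first exact: measurable_levyc.
    by apply: measurable_funM => //; exact: measurable_levyc.
  by apply: measurable_funM => //; exact: measurable_levys.
- move=> n xi; apply: bound; apply: (Int_diff_ge0 nuN).
  + by apply: (rintM (rint_annulus1 r n _) (measurable_one_sub_cos_dotv xi)) => //; exact: C2.
  + by apply: (rintM (rint_annulus1 r n _) (measurable_one_sub_cos_dotv xi)) => //; exact: C2.
  + by move=> z; rewrite mulr_ge0 ?annulus1_ge0 ?one_sub_cos_ge0.
- by move=> xi; apply: bound; exact: levy_diff_ge0.
- move=> xi; apply: cexp_cvg.
    apply: cvgN; apply: cvgMr; apply: cvgB; first exact: (levyc_cvg r xi iN).2.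
    by apply: cvgMr; exact: (levyc_cvg r xi inu).2.
  by apply: cvgMr; exact: (levys_cvg r xi iN).2.
Qed.

End levy_multiplier.

(** * Fejer-smoothed Fourier inversion as an inequality *)

Section normalized_fejer.
Context {R : realType}.
Notation mu := (@lebesgue_measure R).
Implicit Types (de s u b : R).

(* fejer de 0 = de^2 / 2 *)
Definition fejn de s : R := 2 / de ^+ 2 * fejer de s.

Lemma fejn_ge0 de s : 0 <= fejn de s.
Proof. by rewrite mulr_ge0 ?fejer_ge0// divr_ge0// sqr_ge0. Qed.

Lemma fejn_le1 de s : 0 < de -> fejn de s <= 1.
Proof.
move=> de0; have d2 : 0 < de ^+ 2 by rewrite exprn_gt0.
rewrite /fejn mulrAC ler_pdivrMr// mul1r.
by have := fejer_le de s; lra.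
Qed.

Lemma fejn_ge de s : 0 < de -> 1 - (de * s) ^+ 2 / 12 <= fejn de s.
Proof.
move=> de0; have d2 : 0 < de ^+ 2 by rewrite exprn_gt0.
rewrite /fejn [leRHS]mulrAC ler_pdivlMr//.
have := fejer_ge de s; have -> : (1 - (de * s) ^+ 2 / 12) * de ^+ 2 =
  2 * (de ^+ 2 / 2 - de ^+ 4 * s ^+ 2 / 24) by field.
by rewrite ler_pM2l.
Qed.

Lemma measurable_fejn de : measurable_fun setT (fejn de).
Proof. by apply: measurable_funM => //; exact: measurable_fejer. Qed.

Lemma rint_fejn de : rint mu (fejn de).
Proof. by apply: rintZ; exact: rint_fejer. Qed.

Lemma Int_fejn_cos de b u : 0 <= de ->
  \int[mu]_s (fejn de s * cos (b + u * s)) =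
  cos b * (2 / de ^+ 2 * (fejerC * Num.max 0 (de - `|u|))).
Proof.
move=> de0; rewrite mulrCA -Int_fejer_cos// -IntZ; last exact: rint_fejer_cos.
by apply: eq_Int => s; rewrite /fejn mulrA.
Qed.

(** The triangle is replaced by the rectangle around it. The factor 2 lost here turns the inversion
    constant (2 pi)^d into [(4 * fejerC) ^+ d]. *)
Lemma integral_tent de (y : R) : 0 < de ->
  (\int[mu]_s (Num.max 0 (de - `|y - s|))%:E <= (2 * de ^+ 2)%:E)%E.
Proof.
move=> de0.
have mt : measurable_fun setT (fun s : R => Num.max 0 (de - `|y - s|)).
  apply: measurable_maxr => //; apply: measurable_funB => //.
  by apply: measurableT_comp => //; exact: measurable_funB.
apply: (@le_trans _ _ (\int[mu]_s (de%:E * (\1_`[(y - de)%R, (y + de)%R]%classic s)%:E))%E).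
  apply: ge0_le_integral => //=.
  - by move=> s _; rewrite lee_fin le_max lexx.
  - exact/measurable_EFinP.
  - by apply/measurable_EFinP; apply: measurable_funM.
  move=> s _; rewrite -EFinM lee_fin ge_max; apply/andP; split.
    by rewrite mulr_ge0// ltW.
  rewrite indicE; case: (boolP (s \in _)) => [_|].
    by rewrite mulr1 gerBl.
  rewrite notin_setE /= in_itv /= => /negP; rewrite negb_and -!ltNge mulr0 subr_le0.
  by case/orP => h; rewrite ler_normr; apply/orP; [left|right]; lra.
rewrite ge0_integralZl//; last 2 first.
- exact/measurable_EFinP.
- by rewrite lee_fin ltW.
rewrite integral_indic_itv; last by lra.
by rewrite -EFinM lee_fin; apply: eq_ler; ring.
Qed.

Lemma integral_tents (c : R) n (F : 'I_n -> R -> R) :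
  (forall i, measurable_fun setT (F i)) -> (forall i s, 0 <= F i s) -> 0 <= c ->
  (forall i, \int[mu]_s (F i s)%:E <= c%:E)%E ->
  (\int[leb n]_x (\prod_(i < n) F i (tnth x i))%:E <= (c ^+ n)%:E)%E.
Proof.
move=> mF F0 c0 Fc.
have mprod k (G : 'I_k -> R -> R) : (forall i, measurable_fun setT (G i)) ->
    measurable_fun setT (fun x : k.-tuple R => (\prod_(i < k) G i (tnth x i))%:E).
  move=> mG; apply/measurable_EFinP; apply: measurable_prod => i _.
  by apply: (measurableT_comp (mG i)); exact: measurable_tnthR.
elim: n F mF F0 Fc => [|n IH] F mF F0 Fc.
  rewrite leb_liint; first by rewrite /= big_ord0 expr0.
  - exact: mprod.
  - by move=> x; rewrite lee_fin prodr_ge0.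
rewrite leb_liint; [|exact: mprod|by move=> x; rewrite lee_fin prodr_ge0].
pose G (i : 'I_n) := F (lift ord0 i).
have mG i : measurable_fun setT (G i) by exact: mF.
have G0 i s : 0 <= G i s by exact: F0.
have p0 (x : n.-tuple R) : (0 <= (\prod_(i < n) G i (tnth x i))%:E)%E.
  by rewrite lee_fin prodr_ge0.
have IHG := IH G mG G0 (fun i => Fc _).
rewrite /=; set K := (\int[leb n]_x (\prod_(i < n) G i (tnth x i))%:E)%E in IHG.
have K0 : (0 <= K)%E by exact: integral_ge0.
have inner s : liint (fun y => (\prod_(i < n.+1) F i (tnth (cons_tuple s y) i))%:E) =
    ((F ord0 s)%:E * K)%E.
  rewrite /K -ge0_integralZl//; [|exact: (mprod n G mG)|by rewrite lee_fin].
  rewrite -leb_liint; last 2 first.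
  - under eq_fun do rewrite big_ord_recl EFinM tnth0.
    apply: emeasurable_funM; first exact: measurable_cst.
    by under eq_fun do under eq_bigr do rewrite tnthS; exact: (mprod n G mG).
  - by move=> y; rewrite lee_fin prodr_ge0.
  apply: eq_integral => y _; rewrite big_ord_recl EFinM tnth0.
  by under eq_bigr do rewrite tnthS.
under eq_integral do rewrite inner.
rewrite ge0_integralZr//; last 2 first.
- by apply/measurable_EFinP; exact: mF.
- by move=> s _; rewrite lee_fin.
by rewrite exprS EFinM lee_pmul// integral_ge0// => s _; rewrite lee_fin.
Qed.

End normalized_fejer.

Section density_lower_bound.
Context {R : realType} {d : nat}.
Notation vec := (d.-tuple R).
Notation mu := (@lebesgue_measure R).
Implicit Types (xi x y z : vec) (de : R).

Definition kfejer de xi : R[i] := Complex (prodf (fejn de) xi) 0.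

(** The transform of [fejn de]: a triangle supported on [-de, de], of mass [2 * fejerC] for de >
    0. *)
Definition tent de (u : R) : R := 2 / de ^+ 2 * (fejerC * Num.max 0 (de - `|u|)).

Lemma tent_ge0 de u : 0 <= tent de u.
Proof.
apply: mulr_ge0; first by rewrite divr_ge0// sqr_ge0.
by apply: mulr_ge0; [exact: ltW fejerC_gt0|rewrite le_max lexx].
Qed.

Lemma Int_kfejer_cos de x : 0 <= de ->
  \int[leb d]_xi (prodf (fejn de) xi * cos (dotv xi x)) =
  \prod_(i < d) tent de (tnth x i).
Proof.
move=> de0; under eq_Int do rewrite dotvC.
apply: Int_prodf_cos.
- exact: measurable_fejn.
- exact: fejn_ge0.
- exact: rint_fejn.
- by move=> b u; exact: Int_fejn_cos.
Qed.

Lemma rint_kfejer de : rint (leb d) (prodf (fejn de)).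
Proof. by apply: rint_prodf; [exact: measurable_fejn|exact: fejn_ge0|exact: rint_fejn]. Qed.

Lemma posft_kfejer de : 0 <= de -> posft (kfejer de).
Proof.
move=> de0; split; first split.
- exact: rint_kfejer.
- apply: rint_dom (rint_kfejer 0) _; first exact: measurable_cst.
  by move=> xi; rewrite /= normr0 prodf_ge0// => s; exact: fejn_ge0.
move=> x; rewrite /ft; under eq_Int do rewrite /= mul0r addr0.
by rewrite Int_kfejer_cos// prodr_ge0// => i _; exact: tent_ge0.
Qed.

Lemma prodf_fejn_ge0 de xi : 0 <= prodf (fejn de) xi.
Proof. by apply: prodf_ge0 => s; exact: fejn_ge0. Qed.

Lemma prodf_fejn_le1 de xi : 0 < de -> prodf (fejn de) xi <= 1.
Proof.
move=> de0; apply: (@le_trans _ _ (\prod_(i < d) 1)); last by rewrite big1.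
by apply: ler_prod => i _; rewrite fejn_ge0 fejn_le1.
Qed.

(** Weierstrass's product inequality. *)
Lemma prod_ge_1_sub_sum n (f : 'I_n -> R) : (forall i, 0 <= f i <= 1) ->
  1 - \sum_(i < n) (1 - f i) <= \prod_(i < n) f i.
Proof.
elim: n f => [|n IH] f f01; first by rewrite !big_ord0 subr0.
rewrite !big_ord_recl.
have := IH (fun i => f (lift ord0 i)) (fun i => f01 _).
have /andP[f0 f1] := f01 ord0.
have : 0 <= \prod_(i < n) f (lift ord0 i) <= 1.
  apply/andP; split; first by apply: prodr_ge0 => i _; have /andP[] := f01 (lift ord0 i).
  apply: (@le_trans _ _ (\prod_(i < n) 1)); last by rewrite big1.
  by apply: ler_prod => i _; exact: f01.
move: (\prod_(i < n) _) (\sum_(i < n) _) => P S /andP[P0 P1] h.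
have : P - f ord0 * P <= 1 - f ord0.
  by rewrite -{1}[P]mul1r -mulrBl ler_piMr// subr_ge0.
by lra.
Qed.

Lemma prodf_fejn_ge de xi : 0 < de ->
  1 - (de * enorm xi) ^+ 2 / 12 <= prodf (fejn de) xi.
Proof.
move=> de0; apply: le_trans (prod_ge_1_sub_sum _); last first.
  by move=> i; rewrite fejn_ge0 fejn_le1.
rewrite lerB// exprMn enorm_sqr mulr_sumr mulr_suml; apply: ler_sum => i _.
by have := fejn_ge (tnth xi i) de0; rewrite exprMn; lra.
Qed.

Section inversion.
Variables (P A B : vec -> R).
Hypotheses (P0 : forall x, 0 <= P x) (cP : econtinuous P) (iP : rint (leb d) P).
Hypotheses (PA : forall xi, \int[leb d]_x (P x * cos (dotv xi x)) = A xi)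
           (PB : forall xi, \int[leb d]_x (P x * sin (dotv xi x)) = B xi).

(** A + iB is the characteristic function of P; damping it by the Fejer kernel before inverting
    gives the convolution of P with a product of triangles. *)
Lemma ft_kfejer_density de y : 0 <= de ->
  ft (fun xi => kfejer de xi * Complex (A xi) (B xi)) y =
  \int[leb d]_z (P z * \prod_(i < d) tent de (tnth y i - tnth z i)).
Proof.
move=> de0.
pose f (p : vec * vec) := P p.1 * (prodf (fejn de) p.2 * cos (dotv p.2 (vadd y (vopp p.1)))).
have mf : measurable_fun setT f.
  apply: measurable_funM; first exact: (measurableT_comp (rint_meas iP)).
  apply: measurable_funM; first exact: (measurableT_comp (rint_meas (rint_kfejer de))).
  apply: measurable_cosT; apply: measurable_dotv => i.
    exact: (measurableT_comp (measurable_tnthR i)).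
  under eq_fun do rewrite tnth_vadd tnth_vopp.
  apply: measurable_funB; first exact: measurable_cst.
  exact: (measurableT_comp (measurable_tnthR i)).
have fgh x xi : `|f (x, xi)| <= P x * prodf (fejn de) xi.
  rewrite !normrM (ger0_norm (P0 _)) (ger0_norm (prodf_fejn_ge0 _ _)) /=.
  by rewrite ler_wpM2l// ler_piMr ?prodf_fejn_ge0// cos_bound1.
have [_ _ _ _ E] := fubini_dom mf iP (rint_kfejer de) fgh.
have cA xi : rint (leb d) (fun x => P x * cos (dotv xi x)) by exact: rint_wcos.
have cB xi : rint (leb d) (fun x => P x * sin (dotv xi x)) by exact: rint_wsin.
transitivity (\int[leb d]_xi (\int[leb d]_z f (z, xi))).
  apply: eq_Int => xi; rewrite ReM ImM /= !mul0r subr0 addr0.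
  transitivity (\int[leb d]_z
     (prodf (fejn de) xi * cos (dotv xi y) * (P z * cos (dotv xi z)) +
      prodf (fejn de) xi * sin (dotv xi y) * (P z * sin (dotv xi z)))).
    rewrite IntD; [|exact: rintZ (cA xi)|exact: rintZ (cB xi)].
    rewrite (IntZ _ (cA xi)) (IntZ _ (cB xi)) PA PB.
    by ring.
  apply: eq_Int => z; rewrite /f /= dotvDr dotvNr cosD cosN sinN.
  by ring.
rewrite -E; apply: eq_Int => z; rewrite /f /= IntZ.
  rewrite (Int_kfejer_cos _ de0); congr (_ * _); apply: eq_bigr => i _.
  by rewrite tnth_vadd tnth_vopp.
by apply: rint_cos (rint_kfejer de) _; exact: measurable_dotvr.
Qed.

Lemma measurable_tent de (u : R) : measurable_fun setT (fun s : R => tent de (u - s)).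
Proof.
do 2 apply: measurable_funM => //.
apply: measurable_maxr => //; apply: measurable_funB => //.
by apply: measurableT_comp => //; exact: measurable_funB.
Qed.

Lemma integral_tent_le de (u : R) : 0 < de ->
  (\int[mu]_s (tent de (u - s))%:E <= (4 * fejerC)%:E)%E.
Proof.
move=> de0; have C0 := @fejerC_gt0 R.
have c0 : 0 <= 2 / de ^+ 2 * fejerC :> R.
  by rewrite mulr_ge0 ?(ltW C0)// divr_ge0// sqr_ge0.
under eq_integral do rewrite /tent mulrA EFinM.
rewrite ge0_integralZl//; last 2 first.
- apply/measurable_EFinP; apply: measurable_maxr => //; apply: measurable_funB => //.
  by apply: measurableT_comp => //; exact: measurable_funB.
- by move=> s _; rewrite lee_fin le_max lexx.
apply: (@le_trans _ _ ((2 / de ^+ 2 * fejerC)%:E * (2 * de ^+ 2)%:E)%E).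
  by apply: lee_wpmul2l; rewrite ?lee_fin//; exact: integral_tent.
rewrite -EFinM lee_fin; apply: eq_ler.
by field; rewrite gt_eqF.
Qed.

(** The left-hand side weighs P over a box around y on which P stays below P y + e, with total
    weight at most [(4 * fejerC) ^+ d]. Only this direction serves a lower bound for P y. *)
Lemma ft_kfejer_le y (e : R) : 0 < e -> exists2 de0 : R, 0 < de0 &
  forall de, 0 < de -> de < de0 ->
  ft (fun xi => kfejer de xi * Complex (A xi) (B xi)) y <=
  (P y + e) * (4 * fejerC) ^+ d.
Proof.
move=> e0; have [del del0 hdel] := cP y e0.
(* Points of the box of half-side de lie within sqrt(d) de < (d+1) de <= del of y; d+1 keeps the
   quotient meaningful for d = 0 as well. *)
exists (del / d.+1%:R); first by rewrite divr_gt0.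
move=> de de0 dede0; rewrite ft_kfejer_density ?(ltW de0)//.
have mT : measurable_fun setT
    (fun z => \prod_(i < d) tent de (tnth y i - tnth z i)).
  apply: measurable_prod => i _.
  by apply: (measurableT_comp (measurable_tent de (tnth y i))); exact: measurable_tnthR.
have T0 z : 0 <= \prod_(i < d) tent de (tnth y i - tnth z i).
  by apply: prodr_ge0 => i _; exact: tent_ge0.
have Tle : (\int[leb d]_z (\prod_(i < d) tent de (tnth y i - tnth z i))%:E <=
    ((4 * fejerC) ^+ d)%:E)%E.
  apply: (@integral_tents _ _ _ (fun i s => tent de (tnth y i - s))).
  - by move=> i; exact: measurable_tent.
  - by move=> i s; exact: tent_ge0.
  - by rewrite mulr_ge0// ltW// fejerC_gt0.
  - by move=> i; exact: integral_tent_le.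
have iT : rint (leb d) (fun z => \prod_(i < d) tent de (tnth y i - tnth z i)).
  by apply: rint_ge0 => //; rewrite (le_lt_trans Tle)// ltry.
have Pe0 : 0 <= P y + e by rewrite addr_ge0// ltW.
apply: (@le_trans _ _ (\int[leb d]_z ((P y + e) *
    \prod_(i < d) tent de (tnth y i - tnth z i)))); last first.
  rewrite IntZ// ler_wpM2l//.
  by rewrite -lee_fin -rintE.
have pw z : P z * \prod_(i < d) tent de (tnth y i - tnth z i) <=
    (P y + e) * \prod_(i < d) tent de (tnth y i - tnth z i).
  have [zc|/existsNP[i hi]] := pselect (forall i, `|tnth y i - tnth z i| < de).
    rewrite ler_wpM2r//.
    have : `|P y - P z| < e.
      apply: hdel; rewrite -(@ltr_pXn2r _ 2) ?nnegrE ?enorm_ge0 ?(ltW del0)//.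
      apply: (@le_lt_trans _ _ (d%:R * de ^+ 2)).
        apply: enorm_sqr_le_max => i; rewrite tnth_vadd tnth_vopp.
        exact: ltW.
      apply: (@lt_le_trans _ _ (d.+1%:R ^+ 2 * de ^+ 2)).
        rewrite ltr_pM2r ?exprn_gt0// -natrX ltr_nat.
        by rewrite expnS expn1 mulSn addSn ltnS leq_addr.
      rewrite -exprMn lerXn2r ?nnegrE ?mulr_ge0 ?(ltW de0) ?(ltW del0)//.
      by rewrite mulrC -ler_pdivlMr// ltW.
    by rewrite ltr_norml => /andP[]; lra.
  rewrite (bigD1 i)//= (_ : tent _ _ = 0) ?mul0r ?mulr0//.
  rewrite /tent; move/negP: hi; rewrite -leNgt => hi.
  by rewrite (max_idPl _) ?mulr0// subr_le0.
apply: le_Int => //; last exact: rintZ.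
apply: (rint_dom _ (rintZ (P y + e) iT)).
  by apply: measurable_funM => //; exact: rint_meas iP.
by move=> z; rewrite ger0_norm ?mulr_ge0.
Qed.

End inversion.

End density_lower_bound.

(** * A Levy density is bounded below by its small-jump part *)

Section levy_density_lower.
Context {R : realType} {d : nat}.
Notation vec := (d.-tuple R).
Notation smeasure := {sigma_finite_measure set vec -> \bar R}.
Implicit Types (xi x y z b : vec).

(** The origin is a null set, and each set |z| >= 1/(n+1) has finite mass because [levy1] is bounded
    below on it. *)
Lemma levy_sigma_finite (N : {measure set vec -> \bar R}) :
  levy_measure N -> sigma_finite setT N.
Proof.
move=> [N0 Nfin].
have i1 : rint N levy1.
  by apply: rint_ge0 => //; [exact: measurable_levy1|exact: levy1_ge0].
pose F n : set vec := if n is m.+1 then [set z | ~~ (enorm z < m.+1%:R^-1)] else [set vzero R d].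
have F0 : measurable (F 0).
  rewrite (_ : F 0 = @enorm R d @^-1` [set 0]).
    by rewrite -[X in measurable X]setTI; apply: measurable_enorm.
  apply/seteqP; split => z /=; first by move=> ->; rewrite enorm0.
  exact: enorm_eq0.
have FS n : measurable (F n.+1).
  rewrite (_ : F n.+1 = @enorm R d @^-1` `[n.+1%:R^-1, +oo[%classic).
    by rewrite -[X in measurable X]setTI; apply: measurable_enorm.
  by apply/seteqP; split => z /=; rewrite in_itv /= andbT leNgt.
exists F.
  apply/esym/seteqP; split => // z _.
  have [->|z0] := eqVneq z (vzero R d); first by exists 0.
  have ez : 0 < enorm z.
    rewrite lt_neqAle enorm_ge0 andbT eq_sym.
    by apply: contra z0 => /eqP /enorm_eq0 ->.
  exists (Num.trunc (enorm z)^-1).+1 => //=.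
  rewrite -leNgt -[leRHS]invrK lef_pV2 ?posrE ?invr_gt0//.
  by rewrite ltW// truncnS_gt.
case=> [|n]; split => //; first by rewrite /F N0.
have n0 : 0 < n.+1%:R^-1 :> R by rewrite invr_gt0.
have := rintE (rint_compl_ball1 n0 i1).
rewrite (_ : (fun _ => _) = fun z => (\1_(F n.+1) z)%:E).
  by rewrite integral_indic// setIT => ->; rewrite ltry.
apply/funext => z; congr EFin; rewrite indicE /ball1; case: ifPn => zn.
  by rewrite subrr memNset//= zn.
by rewrite subr0 mem_set.
Qed.

Variable N : smeasure.
Hypothesis iN : rint N levy1.

Lemma rint_ball1_sub_sin r xi :
  rint N (fun z => ball1 r z * (sin (dotv xi z) - dotv xi z)).
Proof. exact: (levys_cvg r xi iN).1. Qed.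

Lemma rint_shift (r : R) i : 0 < r -> rint N (fun z => tnth z i * (ball1 r z - ball1 1 z)).
Proof.
move=> r0.
have m0 : 0 < Num.min r 1 by rewrite lt_min r0 ltr01.
apply: (rint_dom _ (rintZ (r + 1) (rint_compl_ball1 m0 iN))).
  apply: measurable_funM; first exact: measurable_tnthR.
  by apply: measurable_funB; exact: measurable_ball1.
move=> z; rewrite normrM.
have zi := norm_tnth_le_enorm z i; have i0 := normr_ge0 (tnth z i).
rewrite /ball1 lt_min; case: (ltP (enorm z) r) => zr; case: (ltP (enorm z) 1) => z1 /=.
- by rewrite !subrr normr0 !mulr0.
- by rewrite !subr0 normr1 !mulr1; lra.
- by rewrite sub0r normrN normr1 subr0 !mulr1; lra.
- by rewrite subrr normr0 mulr0 subr0 mulr1 addr_ge0 ?ltW.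
Qed.

Lemma RePsi_split (r : R) xi : 0 < r ->
  RePsi N xi = levyc N (ball1 r) xi +
    (\int[N]_z (1 - ball1 r z) - hatc N (fun z => 1 - ball1 r z) xi).
Proof.
move=> r0; have ic := rint_compl_ball1 r0 iN.
rewrite /hatc -IntB//; last exact: rint_wcos.
rewrite /levyc -IntD; last first.
- by apply: rintB => //; exact: rint_wcos.
- exact: (levyc_cvg r xi iN).1.
by apply: eq_Int => z; ring.
Qed.

(** Moving the compensation threshold from 1 to r costs exactly the drift change from b to b_r; the
    jumps of size at least r remain uncompensated. *)
Lemma ImPsi_split (r : R) b xi : 0 < r ->
  - ImPsi N b xi = levys N (ball1 r) xi + dotv xi (bshift N b r) +
    hats N (fun z => 1 - ball1 r z) xi.
Proof.
move=> r0; have ic := rint_compl_ball1 r0 iN.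
pose S := mean1 N (fun z => ball1 r z - ball1 1 z).
have iS i : rint N (fun z => (ball1 r z - ball1 1 z) * tnth z i).
  by under eq_fun do rewrite mulrC; exact: rint_shift.
have [iS1 ES] := Int_wdotv xi iS.
have bE : bshift N b r = vadd b S.
  apply: eq_from_tnth => i; rewrite /bshift tnth_mktuple tnth_vadd /S tnth_mktuple.
  by congr (_ + _); rewrite -/(Rintegral _ _ _); apply: eq_Int => z; rewrite mulrC.
rewrite bE dotvDr /ImPsi opprB opprK addrC (dotvC b) -ES /S.
rewrite addrCA -addrA; congr (_ + _).
rewrite /levys /hats -(IntD (rint_ball1_sub_sin r xi) iS1) -IntD; last first.
- exact: rint_wsin.
- by apply: rintD => //; exact: rint_ball1_sub_sin.
by rewrite -/(Rintegral _ _ _); apply: eq_Int => z; rewrite -/(ball1 1 z); ring.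
Qed.

Variables (nu : smeasure).
Hypotheses (inu : rint nu levy1) (nusym : symmetric_measure nu).

Variables (b : vec) (p : R -> vec -> R).
Hypothesis dens : levy_density N b p.

Section fixed_time.
Variable t : R.
Hypothesis t0 : 0 < t.

Lemma RePsi0 : RePsi N (vzero R d) = 0.
Proof.
rewrite /RePsi -/(Rintegral _ _ _).
rewrite (@eq_Int _ _ _ _ _ (fun=> 0)); first by rewrite Rintegral_cst// mul0r.
by move=> z; rewrite dotv0l cos0 subrr.
Qed.

Lemma ImPsi0 : ImPsi N b (vzero R d) = 0.
Proof.
rewrite /ImPsi -/(Rintegral _ _ _) dotvC dotv0l oppr0 sub0r.
rewrite (@eq_Int _ _ _ _ _ (fun=> 0)); first by rewrite Rintegral_cst// mul0r oppr0.
by move=> z; rewrite dotv0l sin0 mul0r subr0.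
Qed.

Lemma levy_density_continuous : econtinuous (p t).
Proof. exact: (dens t0).2.1. Qed.

Lemma levy_density_ge0 x : 0 <= p t x.
Proof. exact: (dens t0).1. Qed.

Let mp : measurable_fun setT (p t).
Proof. exact: econtinuous_measurable levy_density_continuous. Qed.

(** The transform condition at xi = 0 says that the density has total mass 1. *)
Lemma rint_levy_density : rint (leb d) (p t).
Proof.
apply: rint_ge0 => //; first exact: levy_density_ge0.
have [+ _] := (dens t0).2.2 (vzero R d).
rewrite RePsi0 ImPsi0 !mulr0 expR0 cos0 mulr1 -!leb_liint; last 4 first.
- apply/measurable_EFinP/measurable_funM => //; apply: measurable_maxr => //.
  by apply: measurableT_comp => //; apply: measurable_cosT; exact: measurable_dotvl.
- by move=> x; rewrite lee_fin mulr_ge0 ?levy_density_ge0// le_max lexx orbT.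
- apply/measurable_EFinP/measurable_funM => //; apply: measurable_maxr => //.
  by apply: measurable_cosT; exact: measurable_dotvl.
- by move=> x; rewrite lee_fin mulr_ge0 ?levy_density_ge0// le_max lexx orbT.
under [X in (X - _)%E]eq_integral do rewrite dotv0l cos0 (max_idPl ler01) mulr1.
under [X in (_ - X)%E]eq_integral do
  rewrite dotv0l cos0 (max_idPr _) ?oppr_le0// mulr0.
by rewrite integral0 sube0 => ->; rewrite ltry.
Qed.

Lemma Int_posneg (f : vec -> R) (c : R) : measurable_fun setT f ->
  (forall x, `|f x| <= 1) ->
  (liint (fun x => (p t x * Num.max (f x) 0)%:E)
   - liint (fun x => (p t x * Num.max (- f x) 0)%:E))%E = c%:E ->
  \int[leb d]_x (p t x * f x) = c.
Proof.
move=> mf f1.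
have mpos : measurable_fun setT (fun x => Num.max (f x) 0) by exact: measurable_maxr.
have mneg : measurable_fun setT (fun x => Num.max (- f x) 0).
  by apply: measurable_maxr => //; exact: measurableT_comp.
have bound x : `|Num.max (f x) 0| <= 1 /\ `|Num.max (- f x) 0| <= 1.
  have := f1 x; rewrite ler_norml => /andP[h1 h2].
  by split; rewrite ger0_norm ?le_max ?lexx ?orbT// ge_max ler01 andbT//; lra.
have i1 : rint (leb d) (fun x => p t x * Num.max (f x) 0).
  by apply: (rintM rint_levy_density mpos) => x; exact: (bound x).1.
have i2 : rint (leb d) (fun x => p t x * Num.max (- f x) 0).
  by apply: (rintM rint_levy_density mneg) => x; exact: (bound x).2.
rewrite -!leb_liint; last 4 first.
- exact/measurable_EFinP/measurable_funM.
- by move=> x; rewrite lee_fin mulr_ge0 ?levy_density_ge0// le_max lexx orbT.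
- exact/measurable_EFinP/measurable_funM.
- by move=> x; rewrite lee_fin mulr_ge0 ?levy_density_ge0// le_max lexx orbT.
rewrite !rintE// -EFinB => -[<-]; rewrite -IntB//.
apply: eq_Int => x; rewrite -mulrBr; congr (_ * _).
have [f0|f0] := leP 0 (f x).
  by rewrite (max_idPr _) ?subr0// oppr_le0.
by rewrite (max_idPl _) ?sub0r ?opprK// oppr_ge0 ltW.
Qed.

Lemma Int_levy_density_cos xi : \int[leb d]_x (p t x * cos (dotv xi x)) =
  expR (- t * RePsi N xi) * cos (t * ImPsi N b xi).
Proof.
apply: Int_posneg; last exact: ((dens t0).2.2 xi).1.
  by apply: measurable_cosT; exact: measurable_dotvl.
by move=> x; exact: cos_bound1.
Qed.

Lemma Int_levy_density_sin xi : \int[leb d]_x (p t x * sin (dotv xi x)) =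
  - (expR (- t * RePsi N xi) * sin (t * ImPsi N b xi)).
Proof.
apply: Int_posneg; last exact: ((dens t0).2.2 xi).2.
  by apply: measurable_sinT; exact: measurable_dotvl.
by move=> x; exact: sin_bound1.
Qed.

Let charf xi : R[i] :=
  Complex (expR (- t * RePsi N xi) * cos (t * ImPsi N b xi))
          (- (expR (- t * RePsi N xi) * sin (t * ImPsi N b xi))).

Let bigjump r xi := hatd N nu 0 (fun z => 1 - ball1 r z) xi.

(** Independence of the pieces of the process: e^(-t Psi) is the probability that no jump of size at
    least r occurs, times the compensated small jumps, times the drift t b_r, times the exponential
    of the transform of the large jumps. *)
Lemma levyexp0E (r : R) xi : 0 < r -> charf xi =
  Complex (expR (- (t * \int[N]_z (1 - ball1 r z)))) 0 *
  (levyexp N nu 0 t (ball1 r) xi * cphase (vscale t (bshift N b r)) xi *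
   cexp (t * complex.Re (bigjump r xi)) (t * complex.Im (bigjump r xi))).
Proof.
move=> r0; rewrite cexp_real cphaseE !cexpD /= !mul0r !subr0.
transitivity (cexp (- t * RePsi N xi) (t * - ImPsi N b xi)).
  by rewrite /cexp mulrN cosN sinN mulrN.
congr cexp; first by rewrite (RePsi_split xi r0); ring.
by rewrite (ImPsi_split b xi r0) dotvZr; ring.
Qed.

Lemma ft_kfejer_levy_le (r : R) y (de : R) : 0 < r -> 0 <= de ->
  expR (- (t * \int[N]_z (1 - ball1 r z))) *
  ft (fun xi => kfejer de xi * levyexp N nu 0 t (ball1 r) xi)
     (vadd y (vopp (vscale t (bshift N b r)))) <=
  ft (fun xi => kfejer de xi * charf xi) y.
Proof.
move=> r0 de0.
have nuN0 (g : vec -> R) : measurable_fun setT g -> (forall z, 0 <= g z) ->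
    (0%:E * \int[nu]_z (g z)%:E <= \int[N]_z (g z)%:E)%E.
  by move=> _ g0; rewrite mul0e; apply: integral_ge0 => z _; rewrite lee_fin.
have P1 := posft_levyexp r (lexx 0) (ltW t0) nuN0 iN inu nusym (posft_kfejer de0).
have P2 := posft_cphase (vscale t (bshift N b r)) P1.
have icN := rint_compl_ball1 r0 iN; have icnu := rint_compl_ball1 r0 inu.
have w0 z : 0 <= 1 - ball1 r z by rewrite subr_ge0 ball1_le1.
have P3 := posft_cexp_hatd (lexx 0) nuN0 icN icnu w0 (ltW t0) P2.
have := ft_le_cexp_hatd (lexx 0) nuN0 icN icnu w0 (ltW t0) y P2.
rewrite ft_cphase => h.
rewrite [leRHS](_ : _ = expR (- (t * \int[N]_z (1 - ball1 r z))) *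
  ft (fun xi => kfejer de xi * levyexp N nu 0 t (ball1 r) xi *
     cphase (vscale t (bshift N b r)) xi *
     cexp (t * complex.Re (bigjump r xi)) (t * complex.Im (bigjump r xi))) y).
  by rewrite ler_wpM2l// expR_ge0.
rewrite -ftZ; last exact: P3.1.
congr ft; apply/funext => xi; rewrite (levyexp0E xi r0).
by rewrite mulrCA !mulrA.
Qed.

Lemma ft_kfejer_cvg (L : vec -> R[i]) x : cint L ->
  ft (fun xi => kfejer n.+1%:R^-1 xi * L xi) x @[n --> \oo] --> ft L x.
Proof.
move=> cL.
have -> : L = (fun xi => L xi * 1) by apply/funext => xi; rewrite mulr1.
under eq_fun do under [X in ft X]funext do rewrite mulr1 mulrC.
apply: (@ft_cvg _ _ L (fun n => kfejer n.+1%:R^-1) (fun=> 1) 1) => //.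
- by move=> n; apply: cmeas_Complex => //; exact: rint_meas (rint_kfejer _).
- exact: cmeas_cst.
- move=> n xi; rewrite cmodE expr0n addr0 sqrtr_sqr.
  by rewrite ger0_norm ?prodf_fejn_ge0// prodf_fejn_le1// invr_gt0.
- by move=> xi; rewrite cmodE expr1n expr0n addr0 sqrtr1.
move=> xi.
apply: (cvg_dist_le _ (fun n => enorm xi ^+ 2 / 12 * n.+1%:R^-1)).
  move=> n; have n0 : 0 < n.+1%:R^-1 :> R by rewrite invr_gt0.
  have n1 : n.+1%:R^-1 <= 1 :> R by rewrite invf_le1 ?ler1n.
  rewrite subr0 ger0_norm ?cmod_ge0//.
  rewrite (_ : kfejer _ xi - 1 = Complex (prodf (fejn n.+1%:R^-1) xi - 1) 0); last first.
    by apply/eqP; rewrite eq_complex /= subr0 !eqxx.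
  rewrite (le_trans (cmod_le _ _))// normr0 addr0 distrC.
  rewrite ger0_norm ?subr_ge0 ?prodf_fejn_le1//.
  have := prodf_fejn_ge xi n0; rewrite exprMn.
  move: (enorm xi ^+ 2) (sqr_ge0 (enorm xi)) => a a0 h2.
  have : n.+1%:R^-1 ^+ 2 * a <= n.+1%:R^-1 * a.
    by rewrite ler_wpM2r// expr2 ler_piMl// ltW.
  move: h2; move: (prodf _ xi) => w; move: (n.+1%:R^-1) => m h2 h3.
  by lra.
rewrite -[X in _ --> X](mulr0 (enorm xi ^+ 2 / 12)).
by apply: cvgMr; exact: cvg_harmonic.
Qed.

(** Compare both sides through Fejer kernels of parameter 1/(n+1): the smoothed transform of the
    small jumps converges to the left-hand side, while the smoothed density is in the limit at most
    the density times [(4 * fejerC) ^+ d]. Evaluation at x + t b_r cancels the drift phase. *)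
Lemma levy_density_lower (r : R) x : 0 < r -> cint (levyexp N nu 0 t (ball1 r)) ->
  expR (- (t * \int[N]_z (1 - ball1 r z))) *
  ft (levyexp N nu 0 t (ball1 r)) x <=
  p t (vadd x (vscale t (bshift N b r))) * (4 * fejerC) ^+ d.
Proof.
move=> r0 cL; set v := vscale t _; set y := vadd x v.
have yx : vadd y (vopp v) = x.
  by apply: eq_from_tnth => i; rewrite !tnth_vadd tnth_vopp addrK.
have C0 : 0 < (4 * fejerC) ^+ d :> R by rewrite exprn_gt0// mulr_gt0// fejerC_gt0.
apply/ler_addgt0Pr => e e0.
have [de0 de00 hde] := ft_kfejer_le levy_density_ge0 levy_density_continuous
  rint_levy_density Int_levy_density_cos Int_levy_density_sin y
  (divr_gt0 e0 C0).
have cv : expR (- (t * \int[N]_z (1 - ball1 r z))) *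
    ft (fun xi => kfejer n.+1%:R^-1 xi * levyexp N nu 0 t (ball1 r) xi) x
    @[n --> \oo] -->
    expR (- (t * \int[N]_z (1 - ball1 r z))) * ft (levyexp N nu 0 t (ball1 r)) x.
  by apply: cvgMr; exact: ft_kfejer_cvg.
rewrite -(cvg_lim _ cv)//; apply: limr_le; first by apply/cvg_ex; eexists; exact: cv.
near=> n.
have n0 : 0 < n.+1%:R^-1 :> R by rewrite invr_gt0.
have := ft_kfejer_levy_le y r0 (ltW n0); rewrite -/v yx => /le_trans; apply.
rewrite (le_trans (hde _ n0 _))//.
  rewrite -[ltRHS]invrK ltf_pV2 ?posrE ?invr_gt0//.
  near: n; exists (Num.trunc de0^-1) => // n /= hn.
  by rewrite (lt_le_trans (truncnS_gt _))// ler_nat ltnS.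
by rewrite mulrDl divfK// gt_eqF.
Unshelve. all: by end_near. Qed.

End fixed_time.

End levy_density_lower.

(** * Smallness of a Laplace transform propagates to large times *)

Section laplace_propagation.
Context {R : realType}.

(* Expanding v = (1 + w) / 2 binomially in w, the terms of degree > 2m carry the mass
   that a fair binomial law on 3m trials gives to (2m, 3m]. *)
Lemma poly_approx (m : nat) : exists2 p : {poly R}, (size p <= (2 * m).+1)%N &
  forall v, 0 <= v <= 1 -> `|v ^+ (3 * m) - p.[v]| <= (27 / 32) ^+ m.
Proof.
pose n := (3 * m)%N; pose q : {poly R} := 2%:P * 'X - 1.
exists (\sum_(k < (2 * m).+1) (2 ^- n * 'C(n, k)%:R) *: q ^+ k).
  apply: (leq_trans (size_sum _ _ _)); apply/bigmax_leqP => k _.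
  apply: (leq_trans (size_scale_leq _ _)).
  apply: (leq_trans (size_poly_exp_leq _ _)).
  have qs : (size q <= 2)%N.
    apply: (leq_trans (size_polyD _ _)); rewrite geq_max size_polyN size_poly1 andbT.
    by apply: (leq_trans (size_polyMleq _ _)); rewrite size_polyX size_polyC; case: eqP.
  rewrite ltnS; apply: (@leq_trans (1 * k)); last by rewrite mul1n -ltnS.
  by rewrite leq_mul2r; case: (size q) qs => [|[|[|]]]//= _; rewrite orbT.
move=> v /andP[v0 v1]; set w := 2 * v - 1.
have w1 : `|w| <= 1 by rewrite ler_norml; apply/andP; split; rewrite /w; lra.
have qv k : (q ^+ k).[v] = w ^+ k by rewrite horner_exp /q !hornerE.
have -> : (\sum_(k < (2 * m).+1) (2 ^- n * 'C(n, k)%:R) *: q ^+ k).[v] =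
    2 ^- n * \sum_(k < (2 * m).+1) ('C(n, k)%:R * w ^+ k).
  rewrite horner_sum mulr_sumr; apply: eq_bigr => k _.
  by rewrite hornerZ qv mulrA.
have -> : v ^+ (3 * m) = 2 ^- n * \sum_(k < n.+1) ('C(n, k)%:R * w ^+ k).
  have -> : v = 2^-1 * (1 + w) by rewrite /w; field.
  rewrite exprMn -/n exprVn; congr (_ * _); rewrite exprDn; apply: eq_bigr => k _.
  by rewrite expr1n mul1r mulr_natl.
rewrite -mulrBr normrM ger0_norm ?invr_ge0 ?exprn_ge0//.
have nm : ((2 * m).+1 <= n.+1)%N by rewrite ltnS leq_mul2r orbT.
rewrite -(big_mkord xpredT (fun k => 'C(n, k)%:R * w ^+ k)).
rewrite -(big_mkord xpredT (fun k => 'C(n, k)%:R * w ^+ k)).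
rewrite (big_cat_nat _ nm)//= [X in `|X|]addrC addKr.
have bnd : `|\sum_((2 * m).+1 <= k < n.+1) ('C(n, k)%:R * w ^+ k)| <=
    2 ^- (2 * m) * \sum_(k < n.+1) ('C(n, k)%:R * 2 ^+ k).
  apply: (le_trans (ler_norm_sum _ _ _)); rewrite mulr_sumr.
  rewrite -(big_mkord xpredT (fun k => 2 ^- (2 * m) * ('C(n, k)%:R * 2 ^+ k))).
  rewrite [leRHS](big_cat_nat _ nm)//=.
  apply: (@le_trans _ _ (\sum_((2 * m).+1 <= k < n.+1) (2 ^- (2 * m) * ('C(n, k)%:R * 2 ^+ k)))).
    rewrite !big_nat; apply: ler_sum => k /andP[mk _].
    rewrite normrM normr_nat normrX mulrCA ler_wpM2l//.
    apply: (@le_trans _ _ 1); first by rewrite exprn_ile1.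
    rewrite -[leLHS](@mulVf _ (2 ^+ (2 * m))) ?expf_neq0// ler_wpM2l ?invr_ge0 ?exprn_ge0//.
    by rewrite ler_weXn2l ?ler1n// ltnW.
  by rewrite lerDr sumr_ge0.
have E3 : \sum_(k < n.+1) ('C(n, k)%:R * 2 ^+ k) = 3 ^+ n :> R.
  rewrite (_ : 3 = 1 + 2 :> R); last by ring.
  by rewrite exprDn; apply: eq_bigr => k _; rewrite expr1n mul1r mulr_natl.
rewrite E3 in bnd.
apply: (@le_trans _ _ (2 ^- n * (2 ^- (2 * m) * 3 ^+ n))).
  by rewrite ler_wpM2l ?invr_ge0 ?exprn_ge0.
rewrite /n !exprM -!exprVn -!exprMn lerXn2r ?nnegrE//.
by apply: eq_ler; field.
Qed.

Definition laplace d (T : measurableType d) (mu : {measure set T -> \bar R})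
  (E u : T -> R) (t : R) : R := \int[mu]_x (E x * expR (- (t * u x))).

(** The size of the integrals is split into a fixed K and a scale [rho], later r^(-d); thresholds
    found for given a, b and K then hold for all scales, measure spaces and pairs E, u at once. *)
Record laplace_pair d (T : measurableType d) (mu : {measure set T -> \bar R})
    (a K rho : R) (E u : T -> R) : Prop := LaplacePair {
  lp_measE : measurable_fun setT E;
  lp_measu : measurable_fun setT u;
  lp_norm : forall x, `|E x| <= 1;
  lp_ge0 : forall x, 0 <= u x;
  lp_rint : rint mu (fun x => expR (- (a * u x)));
  lp_rho : 0 <= rho;
  lp_Int : \int[mu]_x expR (- (a * u x)) <= K * rho }.

Section bounds.
Context d (T : measurableType d) (mu : {measure set T -> \bar R}).
Variables (E u : T -> R) (a : R).
Hypotheses (mE : measurable_fun setT E) (mu_ : measurable_fun setT u)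
  (E1 : forall x, `|E x| <= 1) (u0 : forall x, 0 <= u x)
  (ia : rint mu (fun x => expR (- (a * u x)))).

Lemma measurable_expRN_scale t : measurable_fun setT (fun x => expR (- (t * u x))).
Proof.
apply: measurable_expRT; apply: measurableT_comp => //.
exact: measurable_funM.
Qed.

Lemma rint_laplace t : a <= t -> rint mu (fun x => E x * expR (- (t * u x))).
Proof.
move=> at_; apply: (rint_dom _ ia).
  by apply: measurable_funM => //; exact: measurable_expRN_scale.
move=> x; rewrite normrM (ger0_norm (expR_ge0 _)).
apply: (@le_trans _ _ (1 * expR (- (t * u x)))); first by rewrite ler_wpM2r ?expR_ge0.
by rewrite mul1r ler_expR lerN2 ler_wpM2r.
Qed.

(** With v = e^(-hu) and h = (t-a)/N, the power v^N is e^(-(t-a)u), while p(v) is a combination of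
    the exponentials e^(-ihu). Integrating against E e^(-au) turns a uniform polynomial
    approximation on [0, 1] into extrapolation of the transform from the times a + ih. *)
Lemma laplace_extrapolation (p : {poly R}) (N : nat) (eps t : R) : a <= t ->
  (0 < N)%N ->
  (forall v, 0 <= v <= 1 -> `|v ^+ N - p.[v]| <= eps) ->
  `|laplace mu E u t -
    \sum_(i < size p) p`_i * laplace mu E u (a + i%:R * ((t - a) / N%:R))| <=
  eps * \int[mu]_x expR (- (a * u x)).
Proof.
move=> at_ N0 hp; set h := (t - a) / N%:R.
have h0 : 0 <= h by rewrite divr_ge0// subr_ge0.
have ah (i : nat) : a <= a + i%:R * h by rewrite lerDl mulr_ge0.
pose v x := expR (- (h * u x)).
have v01 x : 0 <= v x <= 1.
  by rewrite expR_ge0 /= -expR0 ler_expR oppr_le0 mulr_ge0.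
have vi x i : expR (- ((a + i%:R * h) * u x)) = expR (- (a * u x)) * v x ^+ i.
  by rewrite /v -expRM_natl -expRD; congr expR; ring.
have vt x : expR (- (t * u x)) = expR (- (a * u x)) * v x ^+ N.
  rewrite -vi; have -> // : a + N%:R * h = t.
  by rewrite /h mulrC divfK ?subrKC// pnatr_eq0 -lt0n.
have -> : \sum_(i < size p) p`_i * laplace mu E u (a + i%:R * h) =
    \int[mu]_x (\sum_(i < size p) p`_i * (E x * expR (- ((a + i%:R * h) * u x)))).
  rewrite Int_sum; last by move=> i; apply: rintZ; exact: rint_laplace.
  by apply: eq_bigr => i _; rewrite IntZ//; exact: rint_laplace.
have iS : rint mu
    (fun x => \sum_(i < size p) p`_i * (E x * expR (- ((a + i%:R * h) * u x)))).
  by apply: rint_sum => i; apply: rintZ; exact: rint_laplace.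
rewrite -IntB//; last exact: rint_laplace.
rewrite -IntZ//; apply: norm_Int_le.
- by apply: rintB => //; exact: rint_laplace.
- exact: rintZ.
move=> x; rewrite (_ : _ - _ = E x * expR (- (a * u x)) * (v x ^+ N - p.[v x])).
  rewrite !normrM (ger0_norm (expR_ge0 _)) mulrC.
  apply: ler_pM => //; first exact: hp.
  by rewrite ler_piMl// expR_ge0.
rewrite vt horner_coef mulrBr mulrA; congr (_ - _); rewrite mulr_sumr.
by apply: eq_bigr => i _; rewrite vi; ring.
Qed.

End bounds.

(** The power has degree 3m and the polynomial degree at most 2m, so the sampling times stay below a
    + (2/3)(t-a). This is at most b exactly when t <= a + (3/2)(b-a). *)
Lemma laplace_propagation (a b K eps : R) : 0 < a -> a < b -> 0 <= K -> 0 < eps ->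
  exists2 eta : R, 0 < eta & forall d (T : measurableType d)
    (mu : {measure set T -> \bar R}) (E u : T -> R) (rho : R),
  laplace_pair mu a K rho E u ->
  (forall s, a <= s <= b -> `|laplace mu E u s| <= eta * rho) ->
  forall t, a <= t <= a + 3 / 2 * (b - a) -> `|laplace mu E u t| <= eps * rho.
Proof.
move=> a0 ab K0 eps0.
have [m m0 hm] : exists2 m, (0 < m)%N & (27 / 32) ^+ m * K <= eps / 2.
  have cv : (27 / 32) ^+ n * K @[n --> \oo] --> (0 : R).
    rewrite -[X in _ --> X](mul0r K); apply: cvgMl; apply: cvg_expr.
    by rewrite ger0_norm; lra.
  have e2 : 0 < eps / 2 by rewrite divr_gt0.
  have [M _ hM] := (cvgrPdistC_le _ _).1 cv _ e2.
  exists M.+1 => //; have := hM M.+1 (leqnSn M).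
  by rewrite /= subr0; apply: le_trans; rewrite ler_norm.
have [p sp hp] := poly_approx m.
pose S := \sum_(i < size p) `|p`_i|.
have S0 : 0 <= S by apply: sumr_ge0.
have S1 : 0 < 2 * (S + 1) by lra.
(* The first entry serves t <= b, where nothing is extrapolated; the second absorbs the coefficients
   of p, whose absolute values sum to S. *)
exists (Num.min eps (eps / (2 * (S + 1)))).
  by rewrite lt_min eps0 divr_gt0.
move=> d T mu E u rho [mE mu_ E1 u0 ia rho0 IK] small t /andP[at_ tb].
have [tb'|bt] := leP t b.
  apply: (le_trans (small t _)); first by rewrite at_ tb'.
  by rewrite ler_wpM2r// ge_min lexx.
have N0 : (0 < 3 * m)%N by rewrite muln_gt0.
have := laplace_extrapolation mE mu_ E1 u0 ia at_ N0 hp.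
set P := \sum_(i < _) _ => h.
have h1 : `|laplace mu E u t - P| <= eps / 2 * rho.
  apply: (le_trans h); apply: (@le_trans _ _ ((27 / 32) ^+ m * (K * rho))).
    by rewrite ler_wpM2l// exprn_ge0.
  by rewrite mulrA ler_wpM2r.
have h2 : `|P| <= eps / 2 * rho.
  apply: (le_trans (ler_norm_sum _ _ _)).
  apply: (@le_trans _ _ (\sum_(i < size p) `|p`_i| * (eps / (2 * (S + 1)) * rho))).
    apply: ler_sum => i _; rewrite normrM ler_wpM2l//.
    apply: (le_trans (small _ _)); last by rewrite ler_wpM2r// ge_min lexx orbT.
    have i2m : (i <= 2 * m)%N by rewrite -ltnS (leq_trans _ sp).
    have ta0 : 0 <= t - a by rewrite subr_ge0.
    apply/andP; split; first by rewrite lerDl mulr_ge0// divr_ge0.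
    have mm0 : 0 < m%:R :> R by rewrite ltr0n.
    apply: (@le_trans _ _ (a + (2 * m)%:R * ((t - a) / (3 * m)%:R))).
      by rewrite lerD2l ler_wpM2r ?ler_nat// divr_ge0.
    have -> : (2 * m)%:R * ((t - a) / (3 * m)%:R) = 2 / 3 * (t - a).
      by rewrite !natrM; field; rewrite gt_eqF.
    by lra.
  rewrite -mulr_suml -/S mulrA ler_wpM2r//.
  rewrite (_ : eps / (2 * (S + 1)) = eps / 2 / (S + 1)); last by field; lra.
  rewrite mulrA ler_pdivrMr; last by lra.
  by rewrite mulrC ler_wpM2l; lra.
rewrite -(subrK P (laplace _ _ _ _)) (le_trans (ler_normD _ _))//.
by rewrite [eps]splitr mulrDl lerD.
Qed.

(** Each round stretches the interval from its left end by the factor 3/2. Tolerances are chosen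
    backwards: the accuracy demanded before the last round is the threshold which that round
    needs. *)
Lemma laplace_propagation_iter (a b K eps t0 : R) :
  0 < a -> a < b -> 0 <= K -> 0 < eps -> a <= t0 ->
  exists2 eta : R, 0 < eta & forall d (T : measurableType d)
    (mu : {measure set T -> \bar R}) (E u : T -> R) (rho : R),
  laplace_pair mu a K rho E u ->
  (forall s, a <= s <= b -> `|laplace mu E u s| <= eta * rho) ->
  `|laplace mu E u t0| <= eps * rho.
Proof.
move=> a0 ab K0 eps0 at0.
have [n hn] : exists n, t0 <= a + (3 / 2) ^+ n * (b - a).
  have ba : 0 < b - a by rewrite subr_gt0.
  exists (Num.trunc (2 * (t0 - a) / (b - a))).+1.
  have := truncnS_gt (2 * (t0 - a) / (b - a)).
  set n := (Num.trunc (2 * (t0 - a) / (b - a))).+1 => hn.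
  have bern k : 1 + k%:R / 2 <= (3 / 2) ^+ k :> R.
    elim: k => [|k IH]; first by rewrite mul0r addr0 expr0.
    rewrite exprS -natr1; have := @ler0n R k; nra.
  move: hn; rewrite ltr_pdivrMr// => hn.
  have := ler_wpM2r (ltW ba) (bern n); move: ((3 / 2) ^+ n) => X; lra.
suff [eta eta0 heta] : exists2 eta : R, 0 < eta & forall d (T : measurableType d)
    (mu : {measure set T -> \bar R}) (E u : T -> R) (rho : R),
    laplace_pair mu a K rho E u ->
    (forall s, a <= s <= b -> `|laplace mu E u s| <= eta * rho) ->
    forall t, a <= t <= a + (3 / 2) ^+ n * (b - a) -> `|laplace mu E u t| <= eps * rho.
  exists eta => // d T mu E u rho lp small.
  by apply: (heta d T mu E u rho) => //; rewrite at0.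
elim: n eps eps0 {hn} => [|n IH] eps eps0.
  exists eps => // d T mu E u rho _ small t.
  by rewrite expr0 mul1r subrKC; exact: small.
pose b' := a + (3 / 2) ^+ n * (b - a).
have ab' : a < b' by rewrite ltrDl mulr_gt0 ?exprn_gt0 ?subr_gt0//; lra.
have [eta1 eta10 h1] := laplace_propagation a0 ab' K0 eps0.
have [eta eta0 h] := IH eta1 eta10.
exists eta => // d T mu E u rho lp small t ht.
apply: (h1 d T mu E u rho) => //; last first.
  by move: ht; rewrite exprS /b' addrAC subrr add0r mulrA.
by apply: (h d T mu E u rho).
Qed.

End laplace_propagation.

(** * Integrable majorants, boxes, and exponential against polynomial decay *)

Section cauchy_weight.
Context {R : realType}.
Notation mu := (@lebesgue_measure R).

Definition cauchyC : R := \int[mu]_s (1 + s ^+ 2)^-1.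

(** A majorant whose integral scales exactly like 1/r, so that the product over d coordinates
    produces the factor r^(-d) of the final bound. *)
Definition cauchyw (r s : R) : R := (1 + (r * s) ^+ 2)^-1.

Lemma cauchyw_gt0 r s : 0 < cauchyw r s.
Proof. by rewrite invr_gt0 ltr_pwDl// sqr_ge0. Qed.

Lemma measurable_cauchyw r : measurable_fun setT (cauchyw r).
Proof.
apply: measurable_ge0V => [|s]; last by rewrite addr_ge0// sqr_ge0.
by apply: measurable_funD => //; apply: measurable_funX; exact: measurable_funM.
Qed.

Lemma integral_cauchyw r : 0 < r ->
  (\int[mu]_s (cauchyw r s)%:E = (cauchyC / r)%:E)%E.
Proof.
move=> r0; have := @integral_scale R r (fun s => (1 + s ^+ 2)^-1) r0.
rewrite (rintE rint_oneDsqrV) -/cauchyC => h.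
have {}h : (cauchyC%:E = r%:E * \int[mu]_s (cauchyw r s)%:E)%E.
  apply: h; last by move=> s; rewrite invr_ge0 addr_ge0// sqr_ge0.
  apply: measurable_ge0V => [|s]; last by rewrite addr_ge0// sqr_ge0.
  by apply: measurable_funD => //; exact: measurable_funX.
rewrite mulrC EFinM h muleA -EFinM mulVf ?gt_eqF// mul1e//.
Qed.

Lemma rint_cauchyw r : 0 < r -> rint mu (cauchyw r).
Proof.
move=> r0; apply: rint_ge0.
- exact: measurable_cauchyw.
- by move=> s; exact: ltW (cauchyw_gt0 _ _).
- by rewrite integral_cauchyw// ltry.
Qed.

Lemma cauchyC_ge0 : 0 <= cauchyC.
Proof. by apply: Int_ge0 => s; rewrite invr_ge0 addr_ge0// sqr_ge0. Qed.

Lemma rint_prod_cauchyw n r : 0 < r -> rint (leb n) (prodf (cauchyw r)).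
Proof.
move=> r0; apply: rint_prodf.
- exact: measurable_cauchyw.
- by move=> s; exact: ltW (cauchyw_gt0 _ _).
- exact: rint_cauchyw.
Qed.

Lemma Int_prod_cauchyw n r : 0 < r ->
  \int[leb n]_xi prodf (cauchyw r) xi = cauchyC ^+ n / r ^+ n.
Proof.
move=> r0; rewrite Int_prodf; first last.
- exact: rint_cauchyw.
- by move=> s; exact: ltW (cauchyw_gt0 _ _).
- exact: measurable_cauchyw.
by rewrite /Rintegral integral_cauchyw//= expr_div_n.
Qed.

Definition box1 (a s : R) : R := if `|s| <= a then 1 else 0.

Lemma box1_ge0 a s : 0 <= box1 a s.
Proof. by rewrite /box1; case: ifP. Qed.

Lemma measurable_box1 a : measurable_fun setT (box1 a).
Proof.
by apply: measurable_fun_ifT => //; apply: measurable_fun_ler => //; exact: measurableT_comp.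
Qed.

Lemma integral_box1 a : 0 < a -> (\int[mu]_s (box1 a s)%:E = (2 * a)%:E)%E.
Proof.
move=> a0.
rewrite (_ : (fun _ => _) = fun s => (\1_`[(- a)%R, a]%classic s)%:E).
  rewrite integral_indic_itv; last by lra.
  by rewrite opprK mulr_natl mulr2n.
apply/funext => s; congr EFin; rewrite indicE /box1 ler_norml.
case: ifPn => h; first by rewrite mem_set//= in_itv.
by rewrite memNset//= in_itv /=; exact/negP.
Qed.

Lemma rint_box1 a : 0 < a -> rint mu (box1 a).
Proof.
move=> a0; apply: rint_ge0; [exact: measurable_box1|exact: box1_ge0|].
by rewrite integral_box1// ltry.
Qed.

Lemma rint_prod_box1 n a : 0 < a -> rint (leb n) (prodf (box1 a)).
Proof.
by move=> a0; apply: rint_prodf; [exact: measurable_box1|exact: box1_ge0|exact: rint_box1].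
Qed.

Lemma Int_prod_box1 n a : 0 < a -> \int[leb n]_xi prodf (box1 a) xi = (2 * a) ^+ n.
Proof.
move=> a0; rewrite Int_prodf; [|exact: measurable_box1|exact: box1_ge0|exact: rint_box1].
by rewrite /Rintegral integral_box1.
Qed.

Lemma prod_box1E n a (xi : n.-tuple R) :
  prodf (box1 a) xi = 1 /\ (forall i, `|tnth xi i| <= a) \/ prodf (box1 a) xi = 0.
Proof.
have [h|/existsNP[i hi]] := pselect (forall i, `|tnth xi i| <= a).
  by left; split => //; rewrite /prodf big1// => i _; rewrite /box1 h.
right; rewrite /prodf (bigD1 i)//= /box1 ifF ?mul0r//.
by apply/negbTE/negP.
Qed.

End cauchy_weight.

Section exp_beats_poly.
Context {R : realType}.

Lemma expR_ge_pow (x : R) n : 0 <= x -> (x / n.+1%:R) ^+ n.+1 <= expR x.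
Proof.
move=> x0; have -> : expR x = expR (x / n.+1%:R) ^+ n.+1.
  by rewrite -expRM_natl mulrC divfK// pnatr_eq0.
rewrite lerXn2r ?nnegrE ?expR_ge0 ?divr_ge0//.
by rewrite (le_trans _ (expR_ge1Dx _))// lerDr.
Qed.

Lemma exp_beats_poly n (A B c : R) : 0 < A -> 0 <= B -> 0 < c ->
  exists2 t : R, 1 <= t & B * t ^+ n * expR (- (c * t)) <= A.
Proof.
move=> A0 B0 c0.
pose D := (c / n.+1%:R) ^+ n.+1.
have D0 : 0 < D by rewrite exprn_gt0// divr_gt0.
(* The series bound gives e^(ct) >= D t^(n+1), so it is enough that B <= A D t. *)
pose t := 1 + B / (A * D).
have t1 : 1 <= t by rewrite lerDl divr_ge0// mulr_ge0// ltW.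
have t0 : 0 < t by lra.
exists t => //.
rewrite expRN -ler_pdivlMr ?invr_gt0 ?expR_gt0// invrK.
have := @expR_ge_pow (c * t) n (mulr_ge0 (ltW c0) (ltW t0)).
rewrite mulrAC exprMn -/D => h.
apply: (@le_trans _ _ (A * (D * t ^+ n.+1))); last by rewrite ler_wpM2l// ltW.
rewrite exprS !mulrA ler_wpM2r ?exprn_ge0 ?(ltW t0)//.
have AD : 0 < A * D by rewrite mulr_gt0.
rewrite mulrC -ler_pdivrMr// /t lerDr//.
Qed.

End exp_beats_poly.

(** * The core lower bound *)

Section core.
Context {R : realType} {d : nat}.
Notation vec := (d.-tuple R).
Implicit Types (xi x : vec).

Let natr_le_sqr : d%:R <= d.+1%:R ^+ 2 :> R.
Proof. by rewrite -natrX ler_nat expnS expn1 mulSn (leq_trans (leqnSn d))// leq_addr. Qed.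

(* In the application u = a1 t psi, with psi the exponent of the jumps of nu_s of
   size < r, and E collects all other factors of the Fourier integrand. *)
Record core_data (K c2 C3 C4 r : R) (u E : vec -> R) : Prop := CoreData {
  cd_scale : 0 < r;
  cd_measu : measurable_fun setT u;
  cd_measE : measurable_fun setT E;
  cd_decay : forall xi, (1 + (r * enorm xi) ^+ 2) * expR (- (8^-1 * u xi)) <=
    K * prodf (cauchyw r) xi;
  cd_ge : forall xi, c2 * Num.min 1 ((r * enorm xi) ^+ 2) <= u xi;
  cd_le : forall xi, u xi <= C3 * (r * enorm xi) ^+ 2;
  cd_norm : forall xi, `|E xi| <= 1;
  cd_E_ge : forall xi, 1 - C4 * (r * enorm xi + (r * enorm xi) ^+ 2) <= E xi;
  cd_E_pos : forall (k : vec -> R) s, 0 <= s <= 1 ->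
    posft (fun xi => Complex (k xi) 0) ->
    0 <= \int[leb d]_xi (k xi * E xi * expR (- (s * u xi)));
  cd_u_pos : forall s x, 1 / 2 <= s <= 3 / 4 ->
    0 <= \int[leb d]_xi (expR (- (s * u xi)) * cos (dotv xi x)) }.

Section data.
Variables (K c2 C3 C4 r : R) (u E : vec -> R).
Hypotheses (K0 : 0 < K) (c20 : 0 < c2) (C30 : 0 < C3) (C40 : 0 < C4).
Hypothesis H : core_data K c2 C3 C4 r u E.

Let r0 := cd_scale H. Let mu_ := cd_measu H. Let mE := cd_measE H.
Let decay := cd_decay H. Let u_ge := cd_ge H. Let u_le := cd_le H.
Let E1 := cd_norm H. Let E_ge := cd_E_ge H.
Let E_pos := cd_E_pos H. Let u_pos := cd_u_pos H.

Let W : R := K * cauchyC ^+ d.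
Let rd : R := (r ^+ d)^-1.

Let rd0 : 0 < rd. Proof. by rewrite invr_gt0 exprn_gt0. Qed.

Let u0 xi : 0 <= u xi.
Proof.
apply: le_trans (u_ge xi); rewrite mulr_ge0 ?(ltW c20)//.
by rewrite le_min ler01 sqr_ge0.
Qed.

Let expu_anti s xi : 8^-1 <= s -> expR (- (s * u xi)) <= expR (- (8^-1 * u xi)).
Proof. by move=> s8; rewrite ler_expR lerN2 ler_wpM2r. Qed.

Let rintW : rint (leb d) (fun xi => K * prodf (cauchyw r) xi).
Proof. by apply: rintZ; exact: rint_prod_cauchyw. Qed.

Let IntW : \int[leb d]_xi (K * prodf (cauchyw r) xi) = W * rd.
Proof.
by rewrite IntZ ?Int_prod_cauchyw ?mulrA//; exact: rint_prod_cauchyw.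
Qed.

Let expu_le s xi : 8^-1 <= s -> expR (- (s * u xi)) <= K * prodf (cauchyw r) xi.
Proof.
move=> s8; apply: (le_trans (expu_anti xi s8)); apply: le_trans (decay xi).
by rewrite ler_peMl ?expR_ge0// lerDl sqr_ge0.
Qed.

Let sqr_expu_le s xi : 8^-1 <= s ->
  (r * enorm xi) ^+ 2 * expR (- (s * u xi)) <= K * prodf (cauchyw r) xi.
Proof.
move=> s8; apply: le_trans (decay xi); apply: ler_pM; rewrite ?sqr_ge0 ?expR_ge0//.
  by rewrite lerDr.
exact: expu_anti.
Qed.

Lemma rint_expu s : 8^-1 <= s -> rint (leb d) (fun xi => expR (- (s * u xi))).
Proof.
move=> s8; apply: (rint_dom _ rintW); first exact: measurable_expRN_scale.
by move=> xi; rewrite ger0_norm ?expR_ge0// expu_le.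
Qed.

Lemma Int_expu_le s : 8^-1 <= s -> \int[leb d]_xi expR (- (s * u xi)) <= W * rd.
Proof.
move=> s8; rewrite -IntW; apply: le_Int => //; first exact: rint_expu.
by move=> xi; exact: expu_le.
Qed.

(** Lower bound, in units of r^(-d), for the integral of e^(-su) with s <= 1: the box |xi_i| <= 1/r
    has volume 2^d r^(-d), and u <= C3 d on it. *)
Let L0 : R := 2 ^+ d * expR (- (C3 * d%:R)).

Let L00 : 0 < L0. Proof. by rewrite mulr_gt0 ?exprn_gt0 ?expR_gt0. Qed.

Let rint_expu_cos s x : 8^-1 <= s ->
  rint (leb d) (fun xi => expR (- (s * u xi)) * cos (dotv xi x)).
Proof.
move=> s8.
by apply: rint_cos (rint_expu s8) _; exact: measurable_dotvr.
Qed.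

Let box_sqr a xi : 0 < a -> (forall i, `|tnth xi i| <= a / r) ->
  (r * enorm xi) ^+ 2 <= d%:R * a ^+ 2.
Proof.
move=> a0 h; rewrite exprMn.
have := enorm_sqr_le_max h; rewrite expr_div_n => h2.
have r2 : 0 < r ^+ 2 by rewrite exprn_gt0.
apply: (le_trans (ler_wpM2l (ltW r2) h2)).
by apply: eq_ler; field; rewrite gt_eqF.
Qed.

(** The loss from cos <xi,x> >= 1 - <xi,x>^2 / 2 is a second moment of e^(-su); the factor 1 +
    (r|xi|)^2 in [cd_decay] is there to bound it. *)
Lemma Int_expu_cos_ge s x : 8^-1 <= s <= 1 ->
  (L0 - (enorm x / r) ^+ 2 / 2 * W) * rd <=
  \int[leb d]_xi (expR (- (s * u xi)) * cos (dotv xi x)).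
Proof.
move=> /andP[s8 s1].
have ir : 0 < 1 / r by rewrite divr_gt0.
pose c := (enorm x / r) ^+ 2 / 2.
have c0 : 0 <= c by rewrite divr_ge0// sqr_ge0.
have -> : (L0 - c * W) * rd = \int[leb d]_xi
    (expR (- (C3 * d%:R)) * prodf (box1 (1 / r)) xi - c * (K * prodf (cauchyw r) xi)).
  rewrite IntB; [|by apply: rintZ; exact: rint_prod_box1|exact: rintZ].
  rewrite (IntZ c rintW) IntW (IntZ _ (rint_prod_box1 d ir)).
  by rewrite Int_prod_box1// mul1r exprMn exprVn -/rd /L0; ring.
apply: le_Int.
- by apply: rintB; [apply: rintZ; exact: rint_prod_box1|exact: rintZ].
- exact: rint_expu_cos.
move=> xi.
have A : expR (- (C3 * d%:R)) * prodf (box1 (1 / r)) xi <= expR (- (s * u xi)).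
  case: (prod_box1E (1 / r) xi) => [[-> h]|->]; last by rewrite mulr0 expR_ge0.
  rewrite mulr1 ler_expR lerN2.
  have := box_sqr ltr01 h; rewrite expr1n mulr1 => h1.
  apply: (@le_trans _ _ (1 * u xi)); first by rewrite ler_wpM2r.
  by rewrite mul1r (le_trans (u_le xi))// ler_wpM2l// ltW.
have B := one_sub_cos_le (dotv xi x).
have B2 := dotv_sqr_le xi x.
have D := sqr_expu_le xi s8.
have e0 := expR_ge0 (- (s * u xi)).
have F : expR (- (s * u xi)) * (1 - cos (dotv xi x)) <= c * (K * prodf (cauchyw r) xi).
  apply: (@le_trans _ _ (c * ((r * enorm xi) ^+ 2 * expR (- (s * u xi))))); last first.
    by rewrite ler_wpM2l.
  rewrite mulrA [leRHS]mulrC ler_wpM2l// (le_trans B)//.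
  rewrite (_ : c * (r * enorm xi) ^+ 2 = enorm xi ^+ 2 * enorm x ^+ 2 / 2).
    by rewrite ler_wpM2r.
  by rewrite /c; field; rewrite gt_eqF.
by move: F; rewrite mulrBr mulr1; lra.
Qed.

Section kernel_minorant.
Variable eps : R.
Hypotheses (eps0 : 0 < eps) (eps_small : eps ^+ 2 * W <= L0).

(** Points of the box |x_i| <= de satisfy |x| <= eps r, which by [eps_small] keeps the loss in
    [Int_expu_cos_ge] below half of L0. *)
Let de : R := eps * r / d.+1%:R.
(** The quotient of the lower bound (L0 / 2) r^(-d) by the peak (2 fejerC / de)^d of the product of
    triangles; the powers of r cancel. *)
Let cm : R := L0 / 2 / (2 * fejerC * d.+1%:R / eps) ^+ d.

Let de0 : 0 < de. Proof. by rewrite divr_gt0// mulr_gt0. Qed.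

Lemma minorant_gt0 : 0 < cm.
Proof.
rewrite divr_gt0 ?divr_gt0// exprn_gt0// divr_gt0// mulr_gt0// mulr_gt0//.
exact: fejerC_gt0.
Qed.

(* The transform of the kernel is supported in the box |x_i| <= de, and near the origin
   the transform of e^(-su) is at least L0 / 2 * rd. *)
Lemma posft_minorant s : 1 / 2 <= s <= 3 / 4 ->
  posft (fun xi => Complex (expR (- (s * u xi)) - cm * prodf (fejn de) xi) 0).
Proof.
move=> s12; have s8 : 8^-1 <= s by lra.
have ik : rint (leb d) (fun xi => expR (- (s * u xi)) - cm * prodf (fejn de) xi).
  by apply: rintB; [exact: rint_expu|apply: rintZ; exact: rint_kfejer].
split; first split => //.
  apply: rint_dom rintW _ => [|xi]; first exact: measurable_cst.
  by rewrite /= normr0 (le_trans _ (expu_le xi s8))// expR_ge0.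
move=> x; rewrite /ft; under eq_Int do rewrite /= mul0r addr0.
have ikc : rint (leb d) (fun xi => prodf (fejn de) xi * cos (dotv xi x)).
  by apply: rint_cos (rint_kfejer de) _; exact: measurable_dotvr.
have -> : \int[leb d]_xi ((expR (- (s * u xi)) - cm * prodf (fejn de) xi) * cos (dotv xi x)) =
    \int[leb d]_xi (expR (- (s * u xi)) * cos (dotv xi x)) -
    cm * \prod_(i < d) tent de (tnth x i).
  rewrite -Int_kfejer_cos ?(ltW de0)// -IntZ// -IntB; [|exact: rint_expu_cos|exact: rintZ].
  by apply: eq_Int => xi; rewrite mulrBl mulrA.
rewrite subr_ge0.
have [h|/existsNP[i hi]] := pselect (forall i, `|tnth x i| <= de); last first.
  rewrite (bigD1 i)//= (_ : tent _ _ = 0) ?mul0r ?mulr0; first exact: u_pos.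
  rewrite /tent; move/negP: hi; rewrite -ltNge => hi.
  by rewrite (max_idPl _) ?mulr0// subr_le0 ltW.
apply: le_trans (Int_expu_cos_ge x _); last by apply/andP; split; lra.
have xr : (enorm x / r) ^+ 2 <= eps ^+ 2.
  rewrite expr_div_n ler_pdivrMr ?exprn_gt0//.
  apply: (le_trans (enorm_sqr_le_max h)).
  rewrite /de expr_div_n -exprMn mulrA ler_pdivrMr ?exprn_gt0//.
  by rewrite mulrC ler_wpM2l ?sqr_ge0.
have W0 : 0 <= W by rewrite mulr_ge0 ?(ltW K0)// exprn_ge0// cauchyC_ge0.
apply: (@le_trans _ _ (L0 / 2 * rd)); last first.
  rewrite ler_wpM2r ?(ltW rd0)//.
  have := ler_wpM2r W0 xr; move: eps_small.
  by move: ((enorm x / r) ^+ 2) (eps ^+ 2 * W) => q w h1 h2; lra.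
rewrite /cm [leLHS]mulrAC ler_pdivrMr; last first.
  rewrite exprn_gt0// divr_gt0// mulr_gt0// mulr_gt0//; exact: fejerC_gt0.
rewrite -[leRHS]mulrA ler_wpM2l ?divr_ge0 ?(ltW L00)//.
rewrite /rd mulrC -exprVn -exprMn.
apply: (@le_trans _ _ (\prod_(i < d) (2 * fejerC * d.+1%:R / eps * r^-1))).
  apply: ler_prod => i _; rewrite tent_ge0 /=.
  have C0 := @fejerC_gt0 R.
  have dep : 0 < de ^+ 2 by rewrite exprn_gt0.
  rewrite /tent; apply: (@le_trans _ _ (2 / de ^+ 2 * (fejerC * de))).
    apply: ler_wpM2l; first by rewrite divr_ge0// ltW.
    apply: ler_wpM2l; first exact: ltW.
    by rewrite ge_max (ltW de0)/= gerBl.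
  apply: eq_ler; rewrite /de.
  by field; rewrite !gt_eqF//.
by rewrite prodr_const card_ord.
Qed.

Let G1 : R := \int[leb d]_xi (E xi * expR (- u xi)).

Let ED xi : R := E xi * prodf (fejn de) xi.

Let mED : measurable_fun setT ED.
Proof. by apply: measurable_funM => //; exact: rint_meas (rint_kfejer de). Qed.

Let ED1 xi : `|ED xi| <= 1.
Proof.
rewrite normrM -[leRHS]mulr1 ler_pM//.
by rewrite ger0_norm ?prodf_fejn_ge0 ?prodf_fejn_le1.
Qed.

(* [E_pos] for the kernel of [posft_minorant] at time 1 - s. *)
Lemma laplace_minorant s : 1 / 4 <= s <= 1 / 2 ->
  `|laplace (leb d) ED u s| <= G1 / cm.
Proof.
move=> /andP[s4 s2]; have cm0 := minorant_gt0.
have s8 : 8^-1 <= s by lra.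
have ge0 : 0 <= laplace (leb d) ED u s.
  have := @E_pos (prodf (fejn de)) s _ (posft_kfejer (ltW de0)).
  rewrite /laplace => h; under eq_Int do rewrite /ED [E _ * _]mulrC.
  by apply: h; lra.
rewrite ger0_norm// ler_pdivlMr// mulrC -subr_ge0.
have := @E_pos (fun xi => expR (- ((1 - s) * u xi)) - cm * prodf (fejn de) xi) s _
  (@posft_minorant (1 - s) _).
rewrite [X in _ -> _ -> 0 <= X](_ : _ = G1 - cm * laplace (leb d) ED u s).
  by apply; lra.
rewrite -IntZ; last exact: (rint_laplace mED mu_ ED1 u0 (rint_expu s8)).
rewrite -IntB; last 2 first.
- have := rint_laplace mE mu_ E1 u0 (rint_expu s8) (_ : s <= 1).
  by under eq_fun do rewrite mul1r; apply; lra.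
- by apply: rintZ; exact: (rint_laplace mED mu_ ED1 u0 (rint_expu s8)).
apply: eq_Int => xi.
have -> : expR (- u xi) = expR (- ((1 - s) * u xi)) * expR (- (s * u xi)).
  by rewrite -expRD; congr expR; ring.
by rewrite /ED; ring.
Qed.

(** For r|xi| <= tau the factors E and k are both at least 3/4. Outside, the sign of E is unknown,
    but u >= c2 tau^2 makes that part exponentially small in T, whereas a box of side proportional
    to 1/T inside the ball contributes a multiple of T^(-d). *)
Lemma laplace_large_time tau T : 0 < tau -> tau <= 1 -> 8 * C4 * tau <= 1 ->
  eps * tau <= 1 -> 1 <= T ->
  (expR (- C3) / 2 * (2 * tau / (d.+1%:R * T)) ^+ d -
   expR (- ((T - 8^-1) * (c2 * tau ^+ 2))) * W) * rd <= laplace (leb d) ED u T.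
Proof.
move=> tau0 tau1 htau etau T1.
have T8 : 8^-1 <= T by lra.
have T0 : 0 < T by lra.
(* The box |xi_i| <= be / r lies in r|xi| <= tau, and T u <= C3 on it. *)
pose be := tau / (d.+1%:R * T).
have be0 : 0 < be by rewrite divr_gt0// mulr_gt0.
have ber : 0 < be / r by rewrite divr_gt0.
pose e1 := expR (- ((T - 8^-1) * (c2 * tau ^+ 2))).
have -> : (expR (- C3) / 2 * (2 * tau / (d.+1%:R * T)) ^+ d - e1 * W) * rd =
   \int[leb d]_xi (expR (- C3) / 2 * prodf (box1 (be / r)) xi -
                   e1 * (K * prodf (cauchyw r) xi)).
  rewrite IntB; [|by apply: rintZ; exact: rint_prod_box1|exact: rintZ].
  rewrite (IntZ e1 rintW) IntW (IntZ _ (rint_prod_box1 d ber)).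
  rewrite Int_prod_box1// (_ : 2 * (be / r) = 2 * tau / (d.+1%:R * T) / r).
    by rewrite [in RHS]exprMn [in RHS]exprVn -/rd; ring.
  by rewrite /be !mulrA.
apply: le_Int.
- by apply: rintB; [apply: rintZ; exact: rint_prod_box1|exact: rintZ].
- exact: (rint_laplace mED mu_ ED1 u0 (rint_expu T8)).
move=> xi; set y := r * enorm xi.
have y0 : 0 <= y by rewrite mulr_ge0 ?enorm_ge0// ltW.
have Kp0 : 0 <= K * prodf (cauchyw r) xi.
  by rewrite (le_trans _ (expu_le xi T8))// expR_ge0.
have e10 : 0 <= e1 by exact: expR_ge0.
have [yt|ty] := leP y tau; last first.
  have -> : prodf (box1 (be / r)) xi = 0.
    case: (prod_box1E (be / r) xi) => [[_ h]|//]; exfalso.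
    have := box_sqr be0 h; rewrite -/y leNgt => /negP; apply.
    apply: (@le_lt_trans _ _ (tau ^+ 2)); last by rewrite ltrXn2r// ltW.
    rewrite /be expr_div_n mulrA ler_pdivrMr ?exprn_gt0 ?mulr_gt0//.
    rewrite mulrC ler_wpM2l ?sqr_ge0// exprMn.
    apply: (@le_trans _ _ (d.+1%:R ^+ 2 * 1)); first by rewrite mulr1.
    by rewrite ler_wpM2l ?exprn_ge0// exprn_ege1.
  rewrite mulr0 sub0r.
  (* Time T - 1/8 is spent on the exponential gain, the remaining 1/8 on integrability. *)
  have h1 : expR (- (T * u xi)) <= e1 * (K * prodf (cauchyw r) xi).
    have -> : expR (- (T * u xi)) =
        expR (- ((T - 8^-1) * u xi)) * expR (- (8^-1 * u xi)).
      by rewrite -expRD; congr expR; ring.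
    apply: ler_pM; rewrite ?expR_ge0//; last by apply: expu_le.
    have h8 : 0 <= T - 8^-1 by lra.
    rewrite /e1 ler_expR lerN2 ler_wpM2l//.
    apply: le_trans (u_ge xi); rewrite -/y ler_wpM2l ?(ltW c20)// le_min.
    rewrite expr_le1 ?(ltW tau0)// tau1 /=.
    by rewrite lerXn2r ?nnegrE ?(ltW tau0)// ltW.
  have : `|ED xi * expR (- (T * u xi))| <= expR (- (T * u xi)).
    by rewrite normrM (ger0_norm (expR_ge0 _)) ler_piMl ?expR_ge0.
  by rewrite ler_norml => /andP[h2 _]; lra.
(* Since y <= tau <= 1, the error C4 (y + y^2) is at most 2 C4 tau <= 1/4. *)
have hE : 3 / 4 <= E xi.
  apply: le_trans (E_ge xi); rewrite -/y.
  have : y ^+ 2 <= y by rewrite expr2 ler_piMl//; lra.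
  have : C4 * y <= C4 * tau by rewrite ler_wpM2l// ltW.
  have := ler_wpM2l (ltW C40) (_ : y ^+ 2 <= y); nra.
have hD : 3 / 4 <= prodf (fejn de) xi.
  apply: le_trans (prodf_fejn_ge xi de0).
  have : de * enorm xi <= 1.
    rewrite /de (_ : _ * enorm xi = eps * y / d.+1%:R); last by rewrite /y; field.
    rewrite ler_pdivrMr// mul1r; apply: (@le_trans _ _ 1); last by rewrite ler1n.
    by rewrite (le_trans _ etau)// ler_wpM2l// ltW.
  have : 0 <= de * enorm xi by rewrite mulr_ge0 ?enorm_ge0// ltW.
  move=> h1 h2; have : (de * enorm xi) ^+ 2 <= 1 by rewrite expr_le1.
  by move: ((de * enorm xi) ^+ 2) => q; lra.
have hED : 1 / 2 <= ED xi by rewrite /ED; nra.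
have : expR (- C3) / 2 * prodf (box1 (be / r)) xi <= 1 / 2 * expR (- (T * u xi)).
  case: (prod_box1E (be / r) xi) => [[-> h]|->]; last first.
    by rewrite mulr0 mulr_ge0// expR_ge0.
  rewrite mulr1 mulrC mul1r ler_wpM2l// ler_expR lerN2.
  apply: (le_trans (ler_wpM2l (ltW T0) (u_le xi))).
  have := box_sqr be0 h; rewrite -/y => h1.
  rewrite mulrCA -[leRHS]mulr1 ler_wpM2l ?(ltW C30)//.
  apply: (le_trans (ler_wpM2l (ltW T0) h1)).
  rewrite /be expr_div_n exprMn.
  have t1 : tau ^+ 2 <= 1 by rewrite expr_le1// ltW.
  rewrite !mulrA ler_pdivrMr ?mulr_gt0 ?exprn_gt0// mul1r.
  rewrite -mulrA -(expr2 tau); apply: (@le_trans _ _ (T * d%:R)).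
    by rewrite ler_piMr// mulr_ge0// ltW.
  apply: (@le_trans _ _ (T * d.+1%:R ^+ 2)); first by rewrite ler_wpM2l// ltW.
  rewrite [leLHS]mulrC -[leRHS]mulrA ler_wpM2l ?sqr_ge0// ler_peMr//.
  exact: ltW.
have := expR_ge0 (- (T * u xi)); nra.
Qed.

End kernel_minorant.

End data.

(** The choices are made in the order eps, tau, T, eta, all of them before r, u and E appear; this
    is the uniformity of c. An integral below the claimed bound would make the Laplace transform at
    time T at most half of what [laplace_large_time] guarantees. *)
Theorem core_lower (K c2 C3 C4 : R) : 0 < K -> 0 < c2 -> 0 < C3 -> 0 < C4 ->
  exists2 c : R, 0 < c & forall (r : R) (u E : vec -> R),
  core_data K c2 C3 C4 r u E ->
  c * (r ^+ d)^-1 <= \int[leb d]_xi (E xi * expR (- u xi)).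
Proof.
move=> K0 c20 C30 C40.
pose W : R := K * cauchyC ^+ d.
have W0 : 0 <= W by rewrite mulr_ge0 ?(ltW K0)// exprn_ge0// cauchyC_ge0.
pose L0 : R := 2 ^+ d * expR (- (C3 * d%:R)).
have L00 : 0 < L0 by rewrite mulr_gt0 ?exprn_gt0 ?expR_gt0.
(* The second entry gives eps W <= L0, the first turns this into eps^2 W <= L0; the +1 guards
   against a vanishing denominator. *)
pose eps := Num.min 1 (L0 / (W + 1)).
have eps0 : 0 < eps by rewrite lt_min ltr01 divr_gt0// ltr_wpDl.
have eps1 : eps <= 1 by rewrite ge_min lexx.
have epsW : eps ^+ 2 * W <= L0.
  apply: (@le_trans _ _ (eps * W)).
    by rewrite ler_wpM2r// expr2 ler_piMl// ltW.
  have h : eps <= L0 / (W + 1) by rewrite ge_min lexx orbT.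
  apply: (le_trans (ler_wpM2r W0 h)).
  rewrite mulrAC ler_pdivrMr ?ltr_wpDl// ler_wpM2l ?(ltW L00)//.
  by rewrite lerDl.
pose tau := (8 * C4 + 1)^-1.
have C48 : 0 < 8 * C4 + 1 by rewrite addr_gt0// mulr_gt0.
have tau0 : 0 < tau by rewrite invr_gt0.
have tau1 : tau <= 1 by rewrite invf_le1// lerDr mulr_ge0// ltW.
have htau : 8 * C4 * tau <= 1 by rewrite ler_pdivrMr// mul1r lerDl.
have etau : eps * tau <= 1 by rewrite (le_trans _ tau1)// ler_piMl// ltW.
pose c' := c2 * tau ^+ 2.
have c'0 : 0 < c' by rewrite mulr_gt0// exprn_gt0.
pose A : R := expR (- C3) / 2 * (2 * tau / d.+1%:R) ^+ d.
have A0 : 0 < A.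
  by rewrite mulr_gt0 ?divr_gt0 ?expR_gt0// exprn_gt0// divr_gt0// mulr_gt0.
(* T is so large that the exponentially small part takes at most half of the box contribution A /
   T^d; the factor e^(c'/8) comes from T - 1/8 in the exponent. *)
have [T T1 hT] := @exp_beats_poly R d (A / 2) (expR (c' / 8) * W) c'
  (divr_gt0 A0 (ltr0Sn _ 1)) (mulr_ge0 (expR_ge0 _) W0) c'0.
have T0 : 0 < T by lra.
pose c0 := A / 2 / T ^+ d.
have Td : 0 < T ^+ d by rewrite exprn_gt0.
have c00 : 0 < c0 by rewrite !divr_gt0.
have [eta eta0 heta] := @laplace_propagation_iter R (1 / 4) (1 / 2) W (c0 / 2) T
  ltac:(lra) ltac:(lra) W0 ltac:(lra) ltac:(lra).
pose cm : R := L0 / 2 / (2 * fejerC * d.+1%:R / eps) ^+ d.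
have cm0 : 0 < cm by exact: minorant_gt0.
exists (cm * eta); first exact: mulr_gt0.
move=> r u E H; have [r0 mu_ mE _ u_ge _ E1 _ _ _] := H.
have u0 xi : 0 <= u xi.
  apply: le_trans (u_ge xi); rewrite mulr_ge0 ?(ltW c20)//.
  by rewrite le_min ler01 sqr_ge0.
have rd0 : 0 < (r ^+ d)^-1 by rewrite invr_gt0 exprn_gt0.
rewrite leNgt; apply/negP => hG.
pose ED xi : R := E xi * prodf (fejn (eps * r / d.+1%:R)) xi.
have de0 : 0 < eps * r / d.+1%:R by rewrite divr_gt0// mulr_gt0.
have h2 : `|laplace (leb d) ED u T| <= c0 / 2 * (r ^+ d)^-1.
  apply: heta; first split => //.
  - by apply: measurable_funM => //; exact: rint_meas (rint_kfejer _).
  - move=> xi; rewrite normrM -[leRHS]mulr1 ler_pM//.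
    by rewrite ger0_norm ?prodf_fejn_ge0 ?prodf_fejn_le1.
  - by apply: (rint_expu c20 H); lra.
  - exact: ltW.
  - by apply: (Int_expu_le c20 H); lra.
  - move=> s hs.
    apply: (le_trans (laplace_minorant K0 c20 C30 H eps0 epsW hs)).
    by rewrite ler_pdivrMr// mulrC mulrA ltW.
have h3 := laplace_large_time c20 C30 C40 H eps0 tau0 tau1 htau etau T1.
have h4 : c0 <= expR (- C3) / 2 * (2 * tau / (d.+1%:R * T)) ^+ d -
   expR (- ((T - 8^-1) * (c2 * tau ^+ 2))) * W.
  have -> : expR (- C3) / 2 * (2 * tau / (d.+1%:R * T)) ^+ d = A / T ^+ d.
    by rewrite /A invfM mulrA exprMn exprVn mulrA.
  have -> : expR (- ((T - 8^-1) * (c2 * tau ^+ 2))) * W =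
      (expR (c' / 8) * W * T ^+ d * expR (- (c' * T))) / T ^+ d.
    rewrite mulrAC mulfK ?gt_eqF// mulrAC -expRD.
    by congr (expR _ * _); rewrite /c'; ring.
  by rewrite -mulrBl ler_wpM2r ?invr_ge0 ?(ltW Td)//; lra.
have h5 := ler_wpM2r (ltW rd0) h4.
have := le_trans (le_trans h5 h3) (le_trans (ler_norm _) h2).
by have := mulr_gt0 c00 rd0; lra.
Qed.

End core.

(** * One-variable estimates for characteristic exponents *)

Section scalar.
Context {R : realType}.
Notation mu := (@lebesgue_measure R).
Implicit Types x y : R.

Lemma norm_sin_muln_le n x : `|sin (n%:R * x)| <= n%:R * `|sin x|.
Proof.
elim: n => [|n IH]; first by rewrite !mul0r sin0 normr0.
rewrite -(natr1 n) mulrDl mul1r sinD mulrDl mul1r (le_trans (ler_normD _ _))//.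
rewrite !normrM lerD//.
- apply: le_trans IH; rewrite ler_piMr// ler_norml; apply/andP.
  by split; [exact: cos_geN1|exact: cos_le1].
- rewrite ler_piMl// ler_norml; apply/andP.
  by split; [exact: cos_geN1|exact: cos_le1].
Qed.

Lemma one_sub_cos_sqr x : 1 - cos x = 2 * sin (x / 2) ^+ 2.
Proof.
have -> : cos x = cos (x / 2 + x / 2) by congr cos; field.
by rewrite cosD -!expr2 cos2sin2; ring.
Qed.

(** Half-angle form of |sin nx| <= n |sin x|. It carries a lower bound for an exponent from large
    frequencies down to small ones. *)
Lemma one_sub_cos_muln_le n x : 1 - cos (n%:R * x) <= n%:R ^+ 2 * (1 - cos x).
Proof.
rewrite !one_sub_cos_sqr [leRHS]mulrCA ler_wpM2l// -mulrA -exprMn.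
rewrite -real_normK ?num_real// -[leRHS]real_normK ?num_real//.
rewrite lerXn2r ?nnegrE// (le_trans (norm_sin_muln_le _ _))//.
by rewrite normrM ger0_norm.
Qed.

Lemma one_sub_cos_le_norm x : 1 - cos x <= `|x|.
Proof.
have [h|h] := leP `|x| 2; last by rewrite (le_trans (one_sub_cos_le2 x))// ltW.
apply: (le_trans (one_sub_cos_le x)); rewrite -real_normK ?num_real//.
by have := normr_ge0 x; move: `|x| h => z h z0; nra.
Qed.

(** Power growth of v, known only beyond Y0, already makes e^v exceed any polynomial in y; below Y0
    the polynomial is bounded and e^v >= 1. *)
Lemma expR_dominates_powR (a q b Y0 : R) m : 0 < a -> 0 < q -> 1 <= Y0 ->
  exists2 K : R, 0 < K & forall y v, 0 <= y -> 0 <= v ->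
    (Y0 <= y -> q * y `^ a - b <= v) -> (1 + y ^+ 2) ^+ m <= K * expR v.
Proof.
move=> a0 q0 Y1.
have [n hn] : exists n : nat, (2 * m)%:R <= n.+1%:R * a.
  exists (Num.bound ((2 * m)%:R / a)).
  rewrite -ler_pdivrMr// (le_trans (ltW (archi_boundP _)))//.
    by rewrite divr_ge0// ltW.
  by rewrite ler_nat.
pose L := 2 ^+ m * expR b * (n.+1%:R / q) ^+ n.+1.
have L0 : 0 < L.
  by rewrite mulr_gt0 ?mulr_gt0 ?expR_gt0 ?exprn_gt0// divr_gt0.
have M0 : 0 < (1 + Y0 ^+ 2) ^+ m by rewrite exprn_gt0// ltr_wpDr// sqr_ge0.
exists ((1 + Y0 ^+ 2) ^+ m + L); first exact: addr_gt0.
move=> y v y0 v0 hv.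
have v1 : 1 <= expR v by rewrite -expR0 ler_expR.
rewrite mulrDl; have [Yy|yY] := leP Y0 y; last first.
  have h : (1 + y ^+ 2) ^+ m <= (1 + Y0 ^+ 2) ^+ m.
    rewrite lerXn2r ?nnegrE ?addr_ge0 ?sqr_ge0// lerD2l.
    by rewrite lerXn2r ?nnegrE ?(ltW yY)// (le_trans _ Y1).
  apply: (le_trans h); apply: (@le_trans _ _ ((1 + Y0 ^+ 2) ^+ m * expR v)).
    by rewrite ler_peMr// ltW.
  by rewrite lerDl mulr_ge0 ?expR_ge0// ltW.
have {}hv := hv Yy.
have y1 : 1 <= y by exact: le_trans Yy.
have y00 : 0 < y by lra.
suff h : (1 + y ^+ 2) ^+ m <= L * expR v.
  by rewrite (le_trans h)// lerDr mulr_ge0 ?expR_ge0// ltW.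
have w0 : 0 <= q * y `^ a by rewrite mulr_ge0 ?powR_ge0// ltW.
have h1 := expR_ge_pow n w0.
have h2 : expR (q * y `^ a) <= expR b * expR v by rewrite -expRD ler_expR; lra.
have h3 : y ^+ (2 * m) <= (y `^ a) ^+ n.+1.
  rewrite -!powR_mulrn ?powR_ge0// -powRrM mulrC.
  exact: ler_powR.
have n0 : 0 < n.+1%:R :> R by [].
have h4 : (y `^ a) ^+ n.+1 <= (n.+1%:R / q) ^+ n.+1 * (expR b * expR v).
  have -> : (y `^ a) ^+ n.+1 =
      (n.+1%:R / q) ^+ n.+1 * (q * y `^ a / n.+1%:R) ^+ n.+1.
    by rewrite -exprMn; congr (_ ^+ _); field; rewrite !gt_eqF.
  by rewrite ler_wpM2l ?exprn_ge0 ?divr_ge0 ?(ltW q0)// (le_trans h1).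
have h5 : (1 + y ^+ 2) ^+ m <= 2 ^+ m * y ^+ (2 * m).
  rewrite exprM -exprMn lerXn2r ?nnegrE ?addr_ge0 ?mulr_ge0 ?sqr_ge0//.
  have : 1 <= y ^+ 2 by rewrite exprn_ege1.
  lra.
apply: (le_trans h5); rewrite /L.
rewrite (_ : _ * expR v = 2 ^+ m * ((n.+1%:R / q) ^+ n.+1 * (expR b * expR v))).
  by rewrite ler_wpM2l ?exprn_ge0// (le_trans h3).
by ring.
Qed.

Definition unit1 (s : R) : R := \1_(`[0%R, 1%R]%classic) s.

Lemma measurable_unit1 : measurable_fun setT unit1.
Proof. exact: measurable_indic. Qed.

Lemma unit1_ge0 s : 0 <= unit1 s. Proof. by rewrite /unit1 indicE. Qed.

Lemma unit1E s : unit1 s = if (0 <= s <= 1) then 1 else 0.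
Proof. by rewrite /unit1 indicE mem_setE /= in_itv /=; case: ifP. Qed.

Lemma integral_unit1 : (\int[mu]_s (unit1 s)%:E = 1%:E)%E.
Proof. by rewrite integral_indic_itv// subr0. Qed.

Lemma rint_unit1 : rint mu unit1.
Proof.
apply: rint_ge0; [exact: measurable_unit1|exact: unit1_ge0|].
by rewrite integral_unit1 ltry.
Qed.

Lemma Int_unit1 : \int[mu]_s unit1 s = 1.
Proof. by rewrite /Rintegral integral_unit1. Qed.

Lemma rint_unit1_cos y : rint mu (fun s => unit1 s * cos (s * y)).
Proof.
by apply: rint_cos rint_unit1 _; exact: measurable_funM.
Qed.

Lemma Int_unit1_cos y : y != 0 -> \int[mu]_s (unit1 s * cos (s * y)) = sin y / y.
Proof.
move=> y0; rewrite /Rintegral.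
have -> : (\int[mu]_s (unit1 s * cos (s * y))%:E =
    \int[mu]_(s in `[0%R, 1%R]%classic) (cos (s * y))%:E)%E.
  rewrite [RHS]integral_mkcond; apply: eq_integral => s _.
  rewrite patchE unit1E mem_setE /= in_itv /=.
  by case: ifP => _; rewrite ?mul1r ?mul0r.
have dF (s : R) : is_derive s (1 : R) (fun s => sin (s * y) / y) (cos (s * y)).
  by apply: is_derive_eq; rewrite scaler0 add0r !scaler1 /GRing.scale/= ; field.
have cc : continuous (fun s : R => cos (s * y)).
  move=> s; apply: continuous_comp; last exact: continuous_cos.
  by apply: continuousM; [exact: cvg_id|exact: cvg_cst].
have cF : continuous (fun s : R => sin (s * y) / y).
  by move=> s; apply/differentiable_continuous/derivable1_diffP; case: (dF s).
rewrite (@continuous_FTC2 _ _ (fun s => sin (s * y) / y) 0 1 ltr01).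
- by rewrite mul1r mul0r sin0 mul0r -EFinB subr0.
- exact: continuous_subspaceT.
- split; first by move=> s _; case: (dF s).
  + exact/cvg_at_right_filter/cF.
  + exact/cvg_at_left_filter/cF.
- by move=> s _; rewrite derive1E; case: (dF s).
Qed.

(** The average over s removes the zeros of 1 - cos y at multiples of 2 pi. For |y| > 2 it equals 1
    - sin y / y >= 1/2; for |y| <= 2 the part s in [1/2, 1] suffices, where 1 - cos(sy) >= y^2 /
    12. *)
Lemma Int_unit1_one_sub_cos_ge y :
  Num.min 1 (y ^+ 2) / 24 <= \int[mu]_s (unit1 s * (1 - cos (s * y))).
Proof.
have [h|h] := leP `|y| 2; last first.
  have y0 : y != 0 by rewrite -normr_gt0 (lt_trans _ h).
  have -> : \int[mu]_s (unit1 s * (1 - cos (s * y))) = 1 - sin y / y.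
    rewrite -Int_unit1_cos// -[X in _ = X - _]Int_unit1 -IntB; [|exact: rint_unit1|exact: rint_unit1_cos].
    by apply: eq_Int => s; rewrite mulrBr mulr1.
  have : sin y / y <= 1 / 2.
    apply: (le_trans (ler_norm _)); rewrite normrM normfV.
    rewrite ler_pdivrMr ?normr_gt0//.
    have : `|sin y| <= 1.
      by rewrite ler_norml; apply/andP; split; [exact: sin_geN1|exact: sin_le1].
    by move: `|sin y| `|y| h => p q; lra.
  have : Num.min 1 (y ^+ 2) <= 1 by rewrite ge_min lexx.
  by move: (sin y / y) (Num.min _ _) => p q; lra.
have y4 : y ^+ 2 <= 4.
  rewrite -real_normK ?num_real// (_ : 4 = 2 ^+ 2); last by ring.
  by rewrite lerXn2r ?nnegrE.
pose w (s : R) : R := \1_(`[2^-1%R, 1%R]%classic) s.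
have iw : (\int[mu]_s (w s)%:E = (2^-1)%:E)%E.
  by rewrite integral_indic_itv; [congr EFin; field|lra].
have rw : rint mu w.
  apply: rint_ge0; [exact: measurable_indic|by move=> s; rewrite /w indicE|].
  by rewrite iw ltry.
apply: (@le_trans _ _ (\int[mu]_s (y ^+ 2 / 12 * w s))).
  rewrite IntZ// /Rintegral iw /=.
  have : Num.min 1 (y ^+ 2) <= y ^+ 2 by rewrite ge_min lexx orbT.
  by lra.
apply: le_Int.
- exact: rintZ.
- apply: (@rintM _ _ _ _ _ _ 2); first exact: rint_unit1.
  + by apply: measurable_funB => //; apply: measurable_cosT; exact: measurable_funM.
  + by move=> s; rewrite ger0_norm ?one_sub_cos_ge0 ?one_sub_cos_le2.
move=> s; rewrite unit1E /w indicE mem_setE /= in_itv /=.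
case: (boolP (2^-1 <= s <= 1)) => [/andP[s2 s1]|_]; last first.
  by rewrite mulr0; case: ifP => _; rewrite ?mul0r// mul1r one_sub_cos_ge0.
rewrite mulr1 s1 (_ : 0 <= s); last by lra.
rewrite mul1r; apply: le_trans (one_sub_cos_ge _).
have sq : 4^-1 <= s ^+ 2 <= 1 by nra.
rewrite (_ : (s * y) ^+ 4 = (s ^+ 2) ^+ 2 * (y ^+ 2) ^+ 2); last by ring.
rewrite exprMn; have := sqr_ge0 y; move: (s ^+ 2) (y ^+ 2) sq y4 => p q /andP[p1 p2] q4 q0.
have : p * q * (p * q) <= 4 * (p * q).
  by rewrite ler_wpM2r ?mulr_ge0//; nra.
nra.
Qed.

End scalar.

(** * Concentration functions and weak scaling *)

Section concentration.
Context {R : realType} {d : nat}.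
Notation vec := (d.-tuple R).
Variable m : {measure set vec -> \bar R}.
Hypothesis im : rint m levy1.
Implicit Types (xi z : vec) (r s : R).

Lemma hfunE r : hfun m r = \int[m]_z conc1 r z. Proof. by []. Qed.

Lemma hfun_ge0 r : 0 <= hfun m r.
Proof. by rewrite hfunE; apply: Int_ge0 => z; exact: conc1_ge0. Qed.

Lemma hfun_anti r s : 0 < r -> r <= s -> hfun m s <= hfun m r.
Proof.
move=> r0 rs; rewrite !hfunE; apply: le_Int => [||z]; last exact: conc1_anti.
- exact: rint_conc1 (lt_le_trans r0 rs) im.
- exact: rint_conc1.
Qed.

Lemma hfun_scale r s : 0 < r -> r <= s -> hfun m r <= (s / r) ^+ 2 * hfun m s.
Proof.
move=> r0 rs; have is_ := rint_conc1 (lt_le_trans r0 rs) im.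
rewrite !hfunE -IntZ//; apply: le_Int => [||z]; last exact: conc1_scale.
- exact: rint_conc1.
- exact: rintZ.
Qed.

Lemma hfun_cvg0 : hfun m n.+1%:R @[n --> \oo] --> (0 : R).
Proof.
have -> : (0 : R) = \int[m]_z (fun=> 0 : R) z.
  by rewrite Rintegral_cst// mul0r.
apply: (@Int_cvg _ _ _ m (fun n => conc1 n.+1%:R) _ (conc1 1) _ _ _ _ _).2 => //.
- by move=> n; exact: measurable_conc1.
- move=> z.
  have h : enorm z ^+ 2 * n.+1%:R^-1 @[n --> \oo] --> (0 : R).
    rewrite -[X in _ --> X](mulr0 (enorm z ^+ 2)); apply: cvgMr.
    exact: cvg_harmonic.
  apply: (@squeeze_cvgr _ _ _ _ (fun=> 0) (fun n => enorm z ^+ 2 * n.+1%:R^-1)) => //.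
    near=> n; rewrite conc1_ge0 /= ge_min; apply/orP; right.
    rewrite ler_wpM2l ?sqr_ge0// lef_pV2 ?posrE ?exprn_gt0//.
    by rewrite expr2 ler_peMr// ler1n.
  exact: cvg_cst.
- exact: rint_conc1.
- move=> n z; rewrite ger0_norm ?conc1_ge0//; apply: conc1_anti => //.
  by rewrite ler1n.
Unshelve. all: by end_near. Qed.

Lemma Int_compl_ball1_le r : 0 < r -> \int[m]_z (1 - ball1 r z) <= hfun m r.
Proof.
move=> r0; rewrite hfunE; apply: le_Int; [exact: rint_compl_ball1|exact: rint_conc1|].
by move=> z; exact: compl_ball1_le.
Qed.

Lemma ball1_sqr_le r z : 0 < r -> ball1 r z * enorm z ^+ 2 <= r ^+ 2 * conc1 r z.
Proof.
move=> r0; have r2 : 0 < r ^+ 2 by rewrite exprn_gt0.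
rewrite /ball1; case: ifPn => [zr|_]; last first.
  by rewrite mul0r mulr_ge0 ?conc1_ge0// ltW.
rewrite mul1r mulrC -ler_pdivrMr// le_min lexx andbT ler_pdivrMr// mul1r.
by rewrite lerXn2r ?nnegrE ?enorm_ge0// ltW.
Qed.

Lemma norm_Int_ball1_le r (f : vec -> R) C : 0 < r -> 0 <= C ->
  measurable_fun setT f -> (forall z, `|f z| <= C * enorm z ^+ 2) ->
  `|\int[m]_z (ball1 r z * f z)| <= C * (r ^+ 2 * hfun m r).
Proof.
move=> r0 C0 mf fC; have rc := rintZ (r ^+ 2) (rint_conc1 r0 im).
rewrite hfunE -!IntZ//; last exact: rint_conc1.
apply: norm_Int_le; [exact: (Int_annulus1_cvg r im mf fC).1|exact: rintZ|].
move=> z; rewrite normrM (ger0_norm (ball1_ge0 _ _)).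
apply: (le_trans (ler_wpM2l (ball1_ge0 _ _) (fC z))).
by rewrite mulrCA ler_wpM2l// ball1_sqr_le.
Qed.

Lemma rint_levyc r xi : rint m (fun z => ball1 r z * (1 - cos (dotv xi z))).
Proof. exact: (levyc_cvg r xi im).1. Qed.

Lemma levyc_ge0 r xi : 0 <= \int[m]_z (ball1 r z * (1 - cos (dotv xi z))).
Proof.
by apply: Int_ge0 => z; rewrite mulr_ge0 ?ball1_ge0 ?one_sub_cos_ge0.
Qed.

Lemma levyc_le_hfun r xi : 0 < r ->
  \int[m]_z (ball1 r z * (1 - cos (dotv xi z))) <= (r * enorm xi) ^+ 2 * hfun m r.
Proof.
move=> r0; rewrite exprMn [_ * enorm xi ^+ 2]mulrC -mulrA.
apply: le_trans (ler_norm _) (norm_Int_ball1_le r0 (sqr_ge0 _) _ _).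
  exact: measurable_one_sub_cos_dotv.
exact: norm_one_sub_cos_dotv_le.
Qed.

Lemma norm_levys_le_hfun r xi : 0 < r ->
  `|\int[m]_z (ball1 r z * (sin (dotv xi z) - dotv xi z))| <=
  (r * enorm xi) ^+ 2 * hfun m r.
Proof.
move=> r0; rewrite exprMn [_ * enorm xi ^+ 2]mulrC -mulrA.
apply: (norm_Int_ball1_le r0 (sqr_ge0 _) (measurable_sub_sin_dotv xi)).
exact: norm_sin_sub_dotv_le.
Qed.

Lemma levyc_muln_le r n xi :
  \int[m]_z (ball1 r z * (1 - cos (dotv (vscale n%:R xi) z))) <=
  n%:R ^+ 2 * \int[m]_z (ball1 r z * (1 - cos (dotv xi z))).
Proof.
rewrite -IntZ; last exact: rint_levyc.
apply: le_Int; [exact: rint_levyc|by apply: rintZ; exact: rint_levyc|].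
move=> z; rewrite dotvZl mulrCA ler_wpM2l ?ball1_ge0//.
exact: one_sub_cos_muln_le.
Qed.

Lemma one_sub_cos_le_conc1 r xi z : 0 < r -> enorm xi <= r^-1 ->
  1 - cos (dotv xi z) <= 2 * conc1 r z.
Proof.
move=> r0 xr; rewrite /conc1 minEle; case: ifP => _.
  by rewrite mulr1 one_sub_cos_le2.
apply: (le_trans (one_sub_cos_le _)).
have h := dotv_sqr_le xi z.
have : enorm xi ^+ 2 * enorm z ^+ 2 <= enorm z ^+ 2 / r ^+ 2.
  rewrite mulrC ler_wpM2l ?sqr_ge0// -exprVn lerXn2r ?nnegrE ?enorm_ge0//.
  by rewrite invr_ge0 ltW.
have := sqr_ge0 (dotv xi z); lra.
Qed.

Lemma rint_RePsi xi : rint m (fun z => 1 - cos (dotv xi z)).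
Proof.
have e0 : 0 < 1 + enorm xi by rewrite ltr_wpDr ?enorm_ge0.
have r0 : 0 < (1 + enorm xi)^-1 by rewrite invr_gt0.
apply: (rint_dom _ (rintZ 2 (rint_conc1 r0 im))).
  exact: measurable_one_sub_cos_dotv.
move=> z; rewrite ger0_norm ?one_sub_cos_ge0//; apply: one_sub_cos_le_conc1 => //.
by rewrite invrK lerDr.
Qed.

Lemma RePsi_le_hfun r xi : 0 < r -> enorm xi <= r^-1 -> RePsi m xi <= 2 * hfun m r.
Proof.
move=> r0 xr; rewrite hfunE -IntZ; last exact: rint_conc1.
apply: le_Int; [exact: rint_RePsi|by apply: rintZ; exact: rint_conc1|].
by move=> z; exact: one_sub_cos_le_conc1.
Qed.

Lemma RePsi_le_levyc r xi : 0 < r ->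
  RePsi m xi <= \int[m]_z (ball1 r z * (1 - cos (dotv xi z))) + 2 * hfun m r.
Proof.
move=> r0; have ic := rint_compl_ball1 r0 im.
apply: (@le_trans _ _ (\int[m]_z (ball1 r z * (1 - cos (dotv xi z))) +
    2 * \int[m]_z (1 - ball1 r z))); last first.
  by rewrite lerD2l ler_wpM2l// Int_compl_ball1_le.
rewrite -IntZ// -IntD; [|exact: rint_levyc|exact: rintZ].
apply: le_Int; [exact: rint_RePsi|by apply: rintD; [exact: rint_levyc|exact: rintZ]|].
move=> z; have := one_sub_cos_le2 (dotv xi z); rewrite /ball1; case: ifP => _; lra.
Qed.

(** A real supremum dominates its set only if the set is bounded above; the concentration function
    at 1/r supplies the bound. *)
Lemma RePsi_le_Psistar r xi : 0 < r -> enorm xi <= r -> RePsi m xi <= Psistar m r.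
Proof.
move=> r0 xr; apply: ub_le_sup; last by exists xi.
exists (2 * hfun m r^-1) => _ [z zr <-]; apply: RePsi_le_hfun; rewrite ?invr_gt0//.
by rewrite invrK.
Qed.

End concentration.

Section psistar.
Context {R : realType} {d : nat}.
Notation vec := (d.-tuple R).
Notation mu := (@lebesgue_measure R).
Implicit Types (z : vec) (r : R).

Definition unitv (i : 'I_d) : vec := [tuple (i == j)%:R | j < d].

Lemma dotv_unitv i z : dotv (unitv i) z = tnth z i.
Proof.
rewrite /dotv (bigD1 i)//= big1 ?addr0 => [|j ji].
  by rewrite tnth_mktuple eqxx mul1r.
by rewrite tnth_mktuple eq_sym (negbTE ji) mul0r.
Qed.

Lemma enorm_unitv i : enorm (unitv i) = 1.
Proof.
apply/eqP; rewrite -(@eqrXn2 _ 2)// ?enorm_ge0// -dotv_self dotv_unitv.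
by rewrite tnth_mktuple eqxx expr1n.
Qed.

(** Truncation at 1 is subadditive; this splits |z|^2 into its coordinates, each seen by the
    frequencies along one axis. *)
Lemma min_sum_le (I : finType) (f : I -> R) : (forall i, 0 <= f i) ->
  Num.min 1 (\sum_i f i) <= \sum_i Num.min 1 (f i).
Proof.
move=> f0; have m0 i : 0 <= Num.min 1 (f i) by rewrite le_min ler01 f0.
have [/existsP[i fi]|/existsPn h] := boolP [exists i, 1 <= f i].
  rewrite ge_min; apply/orP; left; rewrite (bigD1 i)//= (min_idPl fi).
  by rewrite lerDl sumr_ge0.
rewrite ge_min; apply/orP; right; apply: ler_sum => i _.
by have := h i; rewrite -ltNge => /ltW fi; rewrite (min_idPr fi).
Qed.

Variable m : {sigma_finite_measure set vec -> \bar R}.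
Hypothesis im : rint m levy1.

(* Tonelli, after averaging 1 - cos <s r e_i, z> over 0 <= s <= 1. *)
Lemma hfun_le_Psistar r : 0 < r -> hfun m r^-1 <= 24 * d%:R * Psistar m r.
Proof.
move=> r0; have ri : 0 < r^-1 by rewrite invr_gt0.
pose f i (p : vec * measurableTypeR R) := unit1 p.2 * (1 - cos (p.2 * (r * tnth p.1 i))).
have mf i : measurable_fun setT (f i).
  apply: measurable_funM.
    by apply: (measurableT_comp (@measurable_unit1 R)); exact: measurable_snd.
  apply: measurable_funB => //; apply: measurable_cosT; apply: measurable_funM => //.
  apply: measurable_funM => //.
  by apply: (measurableT_comp (measurable_tnthR i)); exact: measurable_fst.
have phase s i z : s * (r * tnth z i) = dotv (vscale (s * r) (unitv i)) z.
  by rewrite dotvZl dotv_unitv mulrA.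
have sr s i : 0 <= s <= 1 -> enorm (vscale (s * r) (unitv i)) <= r.
  move=> /andP[s0 s1]; rewrite enormZ enorm_unitv mulr1 ger0_norm.
    by rewrite ler_piMl// ltW.
  by rewrite mulr_ge0// ltW.
have fb i z s : `|f i (z, s)| <= 2 * conc1 r^-1 z * unit1 s.
  rewrite /f /= unit1E; case: ifP => [s01|_]; last by rewrite mul0r normr0 mulr0.
  rewrite mul1r mulr1 ger0_norm ?one_sub_cos_ge0// phase.
  by apply: one_sub_cos_le_conc1 => //; rewrite invrK sr.
have ic : rint m (fun z => 2 * conc1 r^-1 z).
  by apply: rintZ; exact: rint_conc1.
have fub i := fubini_dom (mf i) ic (@rint_unit1 R) (fb i).
have P0 : 0 <= Psistar m r.
  apply: le_trans (@RePsi_le_Psistar _ _ m im r (vzero R d) r0 _).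
    by rewrite RePsi0.
  by rewrite enorm0 ltW.
have avg i : \int[m]_z (\int[mu]_s f i (z, s)) <= Psistar m r.
  have [_ _ _ i4 ->] := fub i.
  apply: (@le_trans _ _ (\int[mu]_s (Psistar m r * unit1 s))); last first.
    by rewrite IntZ ?Int_unit1 ?mulr1//; exact: rint_unit1.
  apply: le_Int => //; first by apply: rintZ; exact: rint_unit1.
  move=> s; rewrite /f /= unit1E; case: ifP => [s01|_]; last first.
    by rewrite mulr0 (eq_Int _ (fun z => mul0r _)) Rintegral_cst// mul0r.
  rewrite mulr1 (eq_Int _ (fun z => mul1r _)).
  rewrite (eq_Int _ (fun z => congr1 (fun c => 1 - cos c) (phase s i z))).
  by apply: RePsi_le_Psistar => //; exact: sr.
apply: (@le_trans _ _ (24 * \sum_(i < d) \int[m]_z (\int[mu]_s f i (z, s)))); last first.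
  rewrite -mulrA ler_wpM2l//.
  have := @ler_sum _ _ (index_enum 'I_d) predT _ _ (fun i _ => avg i).
  by rewrite sumr_const card_ord -[_ *+ d]mulr_natl.
have i3 i : rint m (fun z => \int[mu]_s f i (z, s)) by have [] := fub i.
rewrite hfunE -Int_sum// -IntZ; last exact: rint_sum.
apply: le_Int; [exact: rint_conc1|by apply: rintZ; exact: rint_sum|].
move=> z; rewrite /conc1 -exprVn invrK enorm_sqr mulr_suml.
have h0 i : 0 <= tnth z i ^+ 2 * r ^+ 2 by rewrite mulr_ge0 ?sqr_ge0.
apply: (le_trans (min_sum_le h0)).
rewrite mulr_sumr; apply: ler_sum => i _; rewrite -exprMn.
have := Int_unit1_one_sub_cos_ge (r * tnth z i).
rewrite [r * _]mulrC ler_pdivrMr// mulrC => h; apply: (le_trans h).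
by rewrite [leLHS]mulrC.
Qed.

End psistar.

Section weak_scaling.
Context {R : realType} {d : nat}.
Notation vec := (d.-tuple R).
Notation smeasure := {sigma_finite_measure set vec -> \bar R}.
Implicit Types (xi z : vec) (g : vec -> R).

Variables (N nu : smeasure) (T3 : \bar R) (c3 a3 a1 a2 : R).
Hypotheses (d0 : (0 < d)%N) (iN : rint N levy1) (inu : rint nu levy1).
Hypotheses (a10 : 0 < a1) (a20 : 0 < a2) (C3 : cond_C3 N T3 c3 a3).
Hypothesis nu_le_N : forall B : set vec, measurable B -> (a1%:E * nu B <= N B)%E.
Hypothesis RePsi_le : forall x : vec, einv T3 < enorm x -> RePsi N x <= a2 * RePsi nu x.

Lemma integral_nu_le al g : 0 <= al <= a1 -> measurable_fun setT g ->
  (forall z, 0 <= g z) -> (al%:E * \int[nu]_z (g z)%:E <= \int[N]_z (g z)%:E)%E.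
Proof.
move=> /andP[al0 al1] mg g0.
apply: (@le_trans _ _ (a1%:E * \int[nu]_z (g z)%:E)%E).
  by rewrite lee_wpmul2r ?lee_fin// integral_ge0// => z _; rewrite lee_fin.
pose k : {nonneg R} := NngNum (ltW a10).
have mgE : measurable_fun setT (fun z => (g z)%:E) by exact/measurable_EFinP.
have gE0 z : (0 <= (g z)%:E)%E by rewrite lee_fin.
have -> : (a1%:E * \int[nu]_z (g z)%:E = \int[mscale k nu]_z (g z)%:E)%E.
  by rewrite (@ge0_integral_mscale _ _ _ nu setT measurableT k).
by apply: (@ge0_le_measure_integral _ _ _ (mscale k nu) N).
Qed.

Lemma hfun_nu_le s : 0 < s -> a1 * hfun nu s <= hfun N s.
Proof.
move=> s0; rewrite -subr_ge0 !hfunE.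
apply: Int_diff_ge0; [|exact: rint_conc1|exact: rint_conc1|exact: conc1_ge0].
by move=> g mg g0; apply: integral_nu_le => //; rewrite ltW/=.
Qed.

(** Q is the reference frequency at which (C3) is read off: admissible, that is above 1/T3, and
    equal to 1/r up to a factor in [1, A]. *)
Variables (t r Q A : R).
Hypotheses (t0 : 0 < t) (r0 : 0 < r) (A1 : 1 <= A) (Q0 : 0 < Q).
Hypotheses (TQ : einv T3 < Q) (Qr1 : 1 <= Q * r) (QrA : Q * r <= A).
Hypothesis hr : hfun nu r = t^-1.

Let c30 : 0 < c3. Proof. by case: C3 => _ [/andP[]]. Qed.
Let a30 : 0 < a3. Proof. by case: C3 => _ [_ [/andP[]]]. Qed.
Let c3P x := (C3.2.2.2).1 x.
Let scaleP l s := (C3.2.2.2).2 l s.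
Let A0 : 0 < A. Proof. exact: lt_le_trans A1. Qed.
Let dR : 0 < d%:R :> R. Proof. by rewrite ltr0n. Qed.
Let d24 : 0 < 24 * d%:R :> R. Proof. by rewrite mulr_gt0// ltr0n. Qed.
Let Qi : 0 < Q^-1. Proof. by rewrite invr_gt0. Qed.
Let Qir : Q^-1 <= r. Proof. by rewrite -[leLHS]mulr1 ler_pdivrMl. Qed.

Let thr : t * hfun nu r = 1. Proof. by rewrite hr divff// gt_eqF. Qed.

(** With l = |xi|/Q, comparison of the real parts and (C3) give a2 Re Psi_s(xi) >= c3^2 l^a3
    Psi^*(Q). Moreover 24 d Psi^*(Q) >= h_N(1/Q) >= a1 h_s(1/Q) >= a1 h_s(r) = a1 / t. The summand
    -2 pays for dropping the jumps of size at least r. *)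
Lemma levyc_growth xi : A <= r * enorm xi ->
  c3 ^+ 2 * a1 / (a2 * (24 * d%:R)) * (r * enorm xi / A) `^ a3 - 2 <=
  t * levyc nu (ball1 r) xi.
Proof.
move=> Ay; pose l := enorm xi / Q.
have yA : r * enorm xi / A <= l.
  rewrite /l ler_pdivlMr// mulrAC ler_pdivrMr// mulrC mulrA [_ * enorm xi]mulrC.
  by rewrite ler_wpM2l ?enorm_ge0.
have l1 : 1 <= l by rewrite (le_trans _ yA)// ler_pdivlMr// mul1r.
have Qxi : Q <= enorm xi by move: l1; rewrite /l ler_pdivlMr// mul1r.
have h1 : c3 * l `^ a3 * Psistar N Q <= Psistar N (enorm xi).
  by have := scaleP l1 TQ; rewrite /l divfK// gt_eqF.
have h2 := c3P (lt_le_trans TQ Qxi).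
have h3 := RePsi_le (lt_le_trans TQ Qxi).
have h4 := hfun_le_Psistar iN Q0.
have h5 := hfun_nu_le Qi.
have h6 := hfun_anti inu Qi Qir.
have h7 := RePsi_le_levyc inu xi r0.
have h8 : (r * enorm xi / A) `^ a3 <= l `^ a3.
  rewrite ge0_ler_powR ?nnegrE ?(ltW a30)//; last by rewrite (le_trans _ l1).
  by rewrite divr_ge0 ?mulr_ge0 ?enorm_ge0// ltW.
have k1 : t * RePsi nu xi <= t * levyc nu (ball1 r) xi + 2.
  have := ler_wpM2l (ltW t0) h7; rewrite mulrDr [t * (2 * _)]mulrCA thr mulr1.
  exact.
have k2 : a1 <= t * (24 * d%:R) * Psistar N Q.
  rewrite -mulrA -ler_pdivrMl// mulrC -hr.
  by rewrite (le_trans _ h4)// (le_trans _ h5)// ler_wpM2l// ltW.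
have k3 : c3 ^+ 2 * l `^ a3 * Psistar N Q <= a2 * RePsi nu xi.
  rewrite (le_trans _ h3)// (le_trans _ h2)// expr2 -!mulrA ler_wpM2l ?(ltW c30)//.
  by rewrite mulrA.
rewrite lerBlDr (le_trans _ k1)//.
have p0 : 0 <= l `^ a3 by exact: powR_ge0.
have c32 : 0 <= c3 ^+ 2 by exact: sqr_ge0.
apply: (@le_trans _ _ (c3 ^+ 2 * a1 / (a2 * (24 * d%:R)) * l `^ a3)).
  by rewrite ler_wpM2l// divr_ge0 ?mulr_ge0// ltW.
rewrite mulrAC ler_pdivrMr ?mulr_gt0//.
have k4 := ler_wpM2l (mulr_ge0 c32 p0) k2.
have k5 := ler_wpM2l (ltW (mulr_gt0 t0 d24)) k3.
rewrite mulrAC (le_trans k4)//.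
rewrite (_ : _ * (a2 * _) = t * (24 * d%:R) * (a2 * RePsi nu xi)); last by ring.
by rewrite (le_trans _ k5)//; apply: eq_ler; ring.
Qed.

(** N dominates a multiple of nu_s but not conversely, so the upper bound for h_N passes through the
    exponents at one vector of length Q: h_N(r) <= h_N(1/Q) <= 24 d Psi^*(Q), then (C3), Re Psi <=
    a2 Re Psi_s <= 2 a2 h_s(1/Q), and finally h_s(1/Q) <= (Qr)^2 h_s(r). *)
Lemma hfun_scaled_le : t * hfun N r <= 48 * d%:R * a2 * A ^+ 2 / c3.
Proof.
pose i0 := Ordinal d0; pose x := vscale Q (unitv i0).
have ex : enorm x = Q by rewrite enormZ enorm_unitv mulr1 ger0_norm// ltW.
have h1 := @c3P x; have h2 := @RePsi_le x; rewrite !ex in h1 h2.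
have {}h1 := h1 TQ; have {}h2 := h2 TQ.
have h3 : RePsi nu x <= 2 * hfun nu Q^-1.
  by apply: RePsi_le_hfun => //; rewrite ex invrK.
have h4 := hfun_scale inu Qi Qir; rewrite invrK [r * Q]mulrC in h4.
have h5 := hfun_anti iN Qi Qir.
have h6 := hfun_le_Psistar iN Q0.
have AQ : (Q * r) ^+ 2 <= A ^+ 2.
  by rewrite lerXn2r ?nnegrE ?mulr_ge0 ?(ltW A0) ?(ltW Q0) ?(ltW r0).
have k1 : t * hfun nu Q^-1 <= A ^+ 2.
  have := ler_wpM2l (ltW t0) h4; rewrite mulrCA thr mulr1 => h.
  exact: le_trans AQ.
have k2 : c3 * Psistar N Q <= a2 * (2 * hfun nu Q^-1).
  by rewrite (le_trans h1)// (le_trans h2)// ler_wpM2l// ltW.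
rewrite ler_pdivlMr// [_ * c3]mulrC.
apply: (@le_trans _ _ (t * (24 * d%:R) * (c3 * Psistar N Q))).
  have := ler_wpM2l (ltW (mulr_gt0 t0 c30)) (le_trans h5 h6).
  rewrite (_ : t * c3 * hfun N r = c3 * (t * hfun N r)); last by ring.
  by rewrite (_ : t * c3 * _ = t * (24 * d%:R) * (c3 * Psistar N Q)); last by ring.
apply: (le_trans (ler_wpM2l (ltW (mulr_gt0 t0 d24)) k2)).
rewrite (_ : t * _ * _ = 48 * d%:R * a2 * (t * hfun nu Q^-1)); last by ring.
by rewrite ler_wpM2l// !mulr_ge0// ltW.
Qed.

End weak_scaling.

(** * The truncated Levy exponents satisfy the core hypotheses *)

Section truncated_exponent.
Context {R : realType} {d : nat}.
Notation vec := (d.-tuple R).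
Notation smeasure := {sigma_finite_measure set vec -> \bar R}.
Implicit Types (xi z x : vec).

Variables (N nu : smeasure) (a1 t r : R).
Hypotheses (iN : rint N levy1) (inu : rint nu levy1) (nusym : symmetric_measure nu).
Hypotheses (a101 : 0 < a1 <= 1) (t0 : 0 < t) (r0 : 0 < r).
Hypothesis nu_le_N : forall B : set vec, measurable B -> (a1%:E * nu B <= N B)%E.
Hypothesis hr : hfun nu r = t^-1.

(** The u of [core_data]. *)
Definition texp xi : R := a1 * t * levyc nu (ball1 r) xi.
(** The E of [core_data]: the Fourier phase at x is absorbed into the cosine, so a lower bound at x
    becomes one for an integral without further oscillating factors. *)
Definition tphase x xi : R :=
  expR (- (t * (levyc N (ball1 r) xi - a1 * levyc nu (ball1 r) xi))) *
  cos (t * levys N (ball1 r) xi - dotv xi x).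

Let a10 : 0 < a1. Proof. by case/andP: a101. Qed.
Let a1t : 0 < a1 * t. Proof. exact: mulr_gt0. Qed.
Let nuN al : 0 <= al <= a1 -> forall g : vec -> R, measurable_fun setT g ->
  (forall z, 0 <= g z) -> (al%:E * \int[nu]_z (g z)%:E <= \int[N]_z (g z)%:E)%E.
Proof. by move=> hal g; exact: (integral_nu_le a10 nu_le_N hal). Qed.
Let nuN1 := nuN (introT andP (conj (ltW a10) (lexx a1))).

Lemma measurable_texp : measurable_fun setT texp.
Proof. by apply: measurable_funM => //; exact: measurable_levyc. Qed.

Lemma measurable_tphase x : measurable_fun setT (tphase x).
Proof.
apply: measurable_funM.
  apply: measurable_expRT; apply: measurableT_comp => //.
  apply: measurable_funM => //; apply: measurable_funB.
    exact: measurable_levyc.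
  by apply: measurable_funM => //; exact: measurable_levyc.
apply: measurable_cosT; apply: measurable_funB; last exact: measurable_dotvr.
by apply: measurable_funM => //; exact: measurable_levys.
Qed.

Lemma texp_le xi : texp xi <= 1 * (r * enorm xi) ^+ 2.
Proof.
have h := levyc_le_hfun inu xi r0; rewrite hr in h.
have : t * levyc nu (ball1 r) xi <= (r * enorm xi) ^+ 2.
  apply: (le_trans (ler_wpM2l (ltW t0) h)).
  by rewrite mulrCA divff ?gt_eqF// mulr1.
have p0 : 0 <= t * levyc nu (ball1 r) xi by rewrite mulr_ge0 ?levyc_ge0// ltW.
case/andP: a101 => _ a11 h1; rewrite mul1r /texp -mulrA.
by apply: le_trans h1; rewrite ler_piMl.
Qed.

Lemma norm_tphase_le1 x xi : `|tphase x xi| <= 1.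
Proof.
rewrite /tphase normrM -[leRHS]mulr1 ler_pM// ?cos_bound1//.
rewrite ger0_norm ?expR_ge0// -expR0 ler_expR oppr_le0 mulr_ge0 ?(ltW t0)//.
exact: (levy_diff_ge0 r nuN1 iN inu).
Qed.

(** With y = r|xi|, the modulus of the factor is at least 1 - H y^2 and its argument is at most H
    y^2 + theta y in size; this is where |x| <= theta r enters. *)
Lemma tphase_ge x xi (H theta : R) : t * hfun N r <= H -> enorm x <= theta * r ->
  1 - (theta + 2 * H) * (r * enorm xi + (r * enorm xi) ^+ 2) <= tphase x xi.
Proof.
move=> tH xr; set y := r * enorm xi; have e0 := enorm_ge0 xi.
have y0 : 0 <= y by rewrite mulr_ge0// ltW.
have y2 : 0 <= y ^+ 2 by exact: sqr_ge0.
pose P := t * (levyc N (ball1 r) xi - a1 * levyc nu (ball1 r) xi).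
pose S := t * levys N (ball1 r) xi; pose D := dotv xi x.
have P0 : 0 <= P.
  by rewrite mulr_ge0 ?(ltW t0)//; exact: (levy_diff_ge0 r nuN1 iN inu).
have H0 : 0 <= H by rewrite (le_trans _ tH)// mulr_ge0 ?hfun_ge0// ltW.
have hy (q : R) : q <= y ^+ 2 * hfun N r -> t * q <= H * y ^+ 2.
  move=> /(ler_wpM2l (ltW t0)) h; apply: (le_trans h).
  by rewrite mulrCA mulrC ler_wpM2r.
have PH : P <= H * y ^+ 2.
  apply: hy; apply: (le_trans _ (levyc_le_hfun iN xi r0)).
  by rewrite gerBl mulr_ge0 ?levyc_ge0// ltW.
have SH : `|S| <= H * y ^+ 2.
  by rewrite normrM (gtr0_norm t0); apply: hy; exact: norm_levys_le_hfun.
have DH : `|D| <= theta * y.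
  apply: (le_trans (dotv_le _ _)); apply: (le_trans (ler_wpM2l e0 xr)).
  by rewrite /y; apply: eq_ler; ring.
have th0 : 0 <= theta * y by exact: le_trans (normr_ge0 D) DH.
have th2 : 0 <= theta.
  by have := le_trans (enorm_ge0 x) xr; rewrite pmulr_lge0.
have hc := one_sub_cos_le_norm (S - D).
have hn := ler_normB S D.
have e1 : expR (- P) <= 1 by rewrite -expR0 ler_expR oppr_le0.
have eP := expR_ge1Dx (- P); have ep := expR_ge0 (- P).
have c0 := one_sub_cos_ge0 (S - D).
rewrite /tphase -/P -/S -/D.
have k1 : expR (- P) * (1 - cos (S - D)) <= `|S - D|.
  by apply: le_trans hc; rewrite ler_piMl.
have k2 : 0 <= theta * y ^+ 2 by exact: mulr_ge0.
have k3 : 0 <= H * y by exact: mulr_ge0.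
move: k1; rewrite mulrBr mulr1 mulrDl !mulrDr -mulrA => k1.
have k4 : `|S - D| <= H * y ^+ 2 + theta * y by exact: le_trans hn (lerD SH DH).
rewrite -mulrA; move: k4 k3 k2 eP PH k1.
by move: (expR (- P) * cos (S - D)) (expR (- P)) (`|S - D|) => v1 v2 v3; lra.
Qed.

(** Multiplying by e^(-su) puts back a share s of the jumps a1 nu_s, leaving the measure N - (1-s)
    a1 nu_s, which is nonnegative for s in [0, 1]. *)
Lemma tphase_expR x xi s : tphase x xi * expR (- (s * texp xi)) =
  complex.Re (levyexp N nu ((1 - s) * a1) t (ball1 r) xi) * cos (dotv xi x) +
  complex.Im (levyexp N nu ((1 - s) * a1) t (ball1 r) xi) * sin (dotv xi x).
Proof.
rewrite /levyexp /cexp /= /tphase mulrAC -expRD cosB /texp.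
rewrite (_ : - _ + - _ = - (t * (levyc N (ball1 r) xi -
  (1 - s) * a1 * levyc nu (ball1 r) xi))); last by ring.
by rewrite mulrDr !mulrA.
Qed.

Lemma Int_tphase_ge0 x (k : vec -> R) s : 0 <= s <= 1 ->
  posft (fun xi => Complex (k xi) 0) ->
  0 <= \int[leb d]_xi (k xi * tphase x xi * expR (- (s * texp xi))).
Proof.
move=> /andP[s0 s1] pk.
have al : 0 <= (1 - s) * a1 <= a1.
  by rewrite mulr_ge0 ?subr_ge0 ?(ltW a10)//= ler_piMl ?(ltW a10)// gerBl.
have [_ /(_ x)] := posft_levyexp r (andP al).1 (ltW t0) (nuN al) iN inu nusym pk.
rewrite /ft (@eq_Int _ _ _ _ _ (fun xi => k xi * tphase x xi * expR (- (s * texp xi))))//.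
move=> xi; rewrite -mulrA tphase_expR ReM ImM /=.
by ring.
Qed.

Let levyexp_nu s xi :
  levyexp nu nu 0 (s * (a1 * t)) (ball1 r) xi = Complex (expR (- (s * texp xi))) 0.
Proof.
have s_0 : levys nu (ball1 r) xi = 0.
  apply: Int_odd => //; first exact: (levys_cvg r xi inu).1.
  move=> z; rewrite dotvNr sinN /ball1 enormN; ring.
by rewrite /levyexp s_0 mul0r subr0 mulr0 /cexp cos0 sin0 mulr1 mulr0 /texp -!mulrA.
Qed.

(** The function e^(-su) is itself of the form [levyexp], with nu in the role of N and nothing
    subtracted. Since [posft_levyexp] acts on an integrable kernel, Fejer kernels that tend to 1
    stand in for the constant kernel. *)
Lemma Int_texp_cos_ge0 s x : 0 <= s ->
  rint (leb d) (fun xi => expR (- (s * texp xi))) ->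
  0 <= \int[leb d]_xi (expR (- (s * texp xi)) * cos (dotv xi x)).
Proof.
move=> s0 iu; pose L := levyexp nu nu 0 (s * (a1 * t)) (ball1 r).
have LE : L = fun xi => Complex (expR (- (s * texp xi))) 0.
  by apply/funext => xi; exact: levyexp_nu.
have cL : cint L.
  rewrite LE; split => //; apply: (rint_dom _ iu) => [|xi] /=.
    exact: measurable_cst.
  by rewrite normr0 expR_ge0.
have -> : \int[leb d]_xi (expR (- (s * texp xi)) * cos (dotv xi x)) = ft L x.
  by rewrite /ft LE; apply: eq_Int => xi /=; rewrite mul0r addr0.
have cv := @ft_kfejer_cvg _ _ L x cL.
rewrite -(cvg_lim _ cv)//; apply: limr_ge; first by apply/cvg_ex; eexists; exact: cv.
apply: nearW => n.
have nn : forall g : vec -> R, measurable_fun setT g -> (forall z, 0 <= g z) ->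
    ((0 : R)%:E * \int[nu]_z (g z)%:E <= \int[nu]_z (g z)%:E)%E.
  by move=> g _ g0; rewrite mul0e integral_ge0// => z _; rewrite lee_fin.
have n0 : 0 <= n.+1%:R^-1 :> R by rewrite invr_ge0.
exact: (posft_levyexp r (lexx 0) (mulr_ge0 s0 (ltW a1t)) nn inu inu nusym
  (posft_kfejer n0)).2.
Qed.

End truncated_exponent.

(** * Uniform constants *)

Section uniform.
Context {R : realType}.

(** For 0 < y = r|xi| < Y0 take n = floor(Y0/y) + 1. Then n xi is in the range of the hypothesis, n
    <= 2 Y0/y, and the exponent at n xi is at most n^2 times that at xi. *)
Lemma levyc_quad_lower d (m : {sigma_finite_measure set d.-tuple R -> \bar R})
    (t r Y0 : R) : rint m levy1 -> 0 < t -> 0 < r -> 1 <= Y0 ->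
  (forall xi, Y0 <= r * enorm xi -> 1 <= t * levyc m (ball1 r) xi) ->
  forall xi, (4 * Y0 ^+ 2)^-1 * Num.min 1 ((r * enorm xi) ^+ 2) <=
    t * levyc m (ball1 r) xi.
Proof.
move=> im t0 r0 Y1 hY xi; set y := r * enorm xi.
have Y00 : 0 < Y0 by exact: lt_le_trans Y1.
have Y2 : 1 <= Y0 ^+ 2 by rewrite exprn_ege1.
have Y4 : 0 < 4 * Y0 ^+ 2 by lra.
have y0 : 0 <= y by rewrite mulr_ge0 ?enorm_ge0// ltW.
have [/hY h|yY] := leP Y0 y.
  apply: le_trans h; rewrite ler_pdivrMl// mulr1.
  have : Num.min 1 (y ^+ 2) <= 1 by rewrite ge_min lexx.
  lra.
have p0 : 0 <= t * levyc m (ball1 r) xi by rewrite mulr_ge0 ?levyc_ge0// ltW.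
have [y_0|yn0] := eqVneq y 0.
  by rewrite y_0 expr0n /= (min_idPr _)// mulr0.
have {}y0 : 0 < y by rewrite lt_neqAle eq_sym yn0.
pose n := (Num.truncn (Y0 / y)).+1.
have q1 : 1 <= Y0 / y by rewrite ler_pdivlMr// mul1r ltW.
have n1 : Y0 / y < n%:R by exact: truncnS_gt.
have n2 : n%:R <= 2 * (Y0 / y).
  have : (Num.truncn (Y0 / y))%:R <= Y0 / y by rewrite truncn_le; lra.
  by rewrite /n -natr1; lra.
have h1 : 1 <= t * levyc m (ball1 r) (vscale n%:R xi).
  apply: hY; rewrite enormZ ger0_norm// mulrCA -/y.
  by rewrite -ler_pdivrMr// ltW.
have h2 := ler_wpM2l (ltW t0) (levyc_muln_le im r n xi).
have h3 : 1 <= n%:R ^+ 2 * (t * levyc m (ball1 r) xi).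
  by rewrite mulrCA (le_trans h1).
have h4 : n%:R ^+ 2 <= 4 * Y0 ^+ 2 / y ^+ 2.
  apply: (@le_trans _ _ ((2 * (Y0 / y)) ^+ 2)).
    have Yy0 : 0 <= 2 * (Y0 / y) by rewrite (le_trans _ n2)// ler0n.
    by rewrite lerXn2r// nnegrE ler0n.
  by rewrite exprMn expr_div_n mulrA -natrX.
have h5 := le_trans h3 (ler_wpM2r p0 h4).
have ymin : Num.min 1 (y ^+ 2) <= y ^+ 2 by rewrite ge_min lexx orbT.
have y2 : 0 < y ^+ 2 by rewrite exprn_gt0.
rewrite ler_pdivrMl// (le_trans ymin)//.
by move: h5; rewrite mulrAC ler_pdivlMr// mul1r.
Qed.

Lemma prodf_cauchyw_ge n (r : R) (xi : n.-tuple R) : 0 < r ->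
  ((1 + (r * enorm xi) ^+ 2) ^+ n)^-1 <= prodf (cauchyw r) xi.
Proof.
move=> r0; have p (s : R) : 0 < 1 + s ^+ 2 by rewrite ltr_pwDl// sqr_ge0.
rewrite -exprVn -[X in _ ^+ X]card_ord -prodr_const; apply: ler_prod => i _.
rewrite invr_ge0 ltW//= /cauchyw lef_pV2 ?posrE// lerD2l !exprMn.
rewrite ler_wpM2l ?sqr_ge0// -real_normK ?num_real//.
by rewrite lerXn2r ?nnegrE ?enorm_ge0// norm_tnth_le_enorm.
Qed.

(** The constant is fixed before nu_s and T3 appear; their influence is confined to the number A,
    which measures how far the reference frequency Q is from 1/r. *)
Theorem uniform_density_lower (d : nat) (c3 a3 a1 a2 A theta : R) : (0 < d)%N ->
  0 < c3 -> 0 < a3 -> 0 < a1 <= 1 -> 0 < a2 -> 1 <= A -> 0 < theta ->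
  exists2 c : R, 0 < c & forall (N nu : {sigma_finite_measure set d.-tuple R -> \bar R})
    (T3 : \bar R) (b : d.-tuple R) (p : R -> d.-tuple R -> R),
  rint N levy1 -> rint nu levy1 -> symmetric_measure nu -> cond_C3 N T3 c3 a3 ->
  (forall B : set (d.-tuple R), measurable B -> (a1%:E * nu B <= N B)%E) ->
  (forall x : d.-tuple R, einv T3 < enorm x -> RePsi N x <= a2 * RePsi nu x) ->
  levy_density N b p ->
  forall (t r Q : R) (x : d.-tuple R), 0 < t -> 0 < r -> hfun nu r = t^-1 ->
    0 < Q -> einv T3 < Q -> 1 <= Q * r <= A -> enorm x <= theta * r ->
  c * (r ^+ d)^-1 <= p t (vadd x (vscale t (bshift N b r))).
Proof.
move=> d0 c30 a30 a101 a20 A1 th0; have a10 : 0 < a1 by case/andP: a101.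
have A0 : 0 < A by exact: lt_le_trans A1.
have dR : 0 < d%:R :> R by rewrite ltr0n.
pose kap := c3 ^+ 2 * a1 / (a2 * (24 * d%:R)).
have kap0 : 0 < kap by rewrite divr_gt0 ?mulr_gt0 ?exprn_gt0.
pose H := 48 * d%:R * a2 * A ^+ 2 / c3.
have H0 : 0 < H by rewrite divr_gt0 ?mulr_gt0 ?exprn_gt0.
(* Beyond Y0 the leading term in [levyc_growth] is at least 3, so that t times the exponent is at
   least 3 - 2 = 1. *)
pose Y0 := A * Num.max 1 ((3 / kap) `^ a3^-1).
have YA : A <= Y0 by rewrite ler_peMr ?(ltW A0)// le_max lexx.
have Y1 : 1 <= Y0 by exact: le_trans YA.
have Y00 : 0 < Y0 by exact: lt_le_trans Y1.
have hY0 : 3 <= kap * (Y0 / A) `^ a3.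
  rewrite /Y0 [X in X `^ _]mulrAC divff ?gt_eqF// mul1r mulrC -ler_pdivrMr//.
  apply: (@le_trans _ _ (((3 / kap) `^ a3^-1) `^ a3)).
    by rewrite -powRrM mulVf ?gt_eqF// powRr1// divr_ge0// ltW.
  by rewrite ge0_ler_powR ?nnegrE ?powR_ge0 ?(ltW a30)// le_max ?ler01 ?lexx ?orbT.
pose q := 8^-1 * (a1 * (kap * A^-1 `^ a3)).
have q0 : 0 < q by rewrite mulr_gt0// mulr_gt0// mulr_gt0// powR_gt0// invr_gt0.
(* The power d+1 covers the d factors of the Cauchy product and the second-moment weight in
   [cd_decay]; q and the shift are the growth constants multiplied by a1/8. *)
have [K K0 hK] := @expR_dominates_powR R a3 q (8^-1 * (a1 * 2)) Y0 d.+1 a30 q0 Y1.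
pose c2 := a1 * (4 * Y0 ^+ 2)^-1.
have c20 : 0 < c2 by rewrite mulr_gt0// invr_gt0 mulr_gt0// exprn_gt0.
have C40 : 0 < theta + 2 * H by lra.
have [c c0 core] := @core_lower R d K c2 1 (theta + 2 * H) K0 c20 ltr01 C40.
have F0 : 0 < (4 * fejerC) ^+ d :> R by rewrite exprn_gt0// mulr_gt0// fejerC_gt0.
(* Here e^(-H) bounds from below the probability that no jump of size at least r occurs before t;
   the denominator is the loss in Fourier inversion. *)
exists (expR (- H) * c / (4 * fejerC) ^+ d); first by rewrite divr_gt0// mulr_gt0// expR_gt0.
move=> N nu T3 b p iN inu nusym hC3 nuN RePsi_le dens t r Q x t0 r0 hr Q0 TQ.
move=> /andP[Qr1 QrA] xr.
have growth xi : A <= r * enorm xi ->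
    kap * (r * enorm xi / A) `^ a3 - 2 <= t * levyc nu (ball1 r) xi.
  exact: (levyc_growth d0 iN inu a10 a20 hC3 nuN RePsi_le t0 r0 A1 Q0 TQ Qr1 QrA hr).
have tail : t * hfun N r <= H.
  exact: (hfun_scaled_le d0 iN inu a20 hC3 RePsi_le t0 r0 A1 Q0 TQ Qr1 QrA hr).
have large xi : Y0 <= r * enorm xi -> 1 <= t * levyc nu (ball1 r) xi.
  move=> Yy; apply: le_trans (growth xi (le_trans YA Yy)).
  rewrite lerBrDr (_ : 1 + 2 = 3); last by ring.
  rewrite (le_trans hY0)// ler_wpM2l ?(ltW kap0)//.
  rewrite ge0_ler_powR ?nnegrE ?divr_ge0 ?(ltW a30) ?(ltW A0) ?(ltW Y00)//.
    by rewrite (le_trans (ltW Y00)).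
  by rewrite ler_wpM2r// invr_ge0 ltW.
pose u := texp nu a1 t r.
have mu_ : measurable_fun setT u by exact: measurable_texp.
have uE xi : u xi = a1 * (t * levyc nu (ball1 r) xi) by rewrite /u /texp mulrA.
have u0 xi : 0 <= u xi.
  by rewrite uE !mulr_ge0 ?levyc_ge0 ?ltW.
have u_ge xi : c2 * Num.min 1 ((r * enorm xi) ^+ 2) <= u xi.
  rewrite uE /c2 -mulrA ler_wpM2l ?(ltW a10)//.
  exact: levyc_quad_lower.
have decay xi : (1 + (r * enorm xi) ^+ 2) * expR (- (8^-1 * u xi)) <=
    K * prodf (cauchyw r) xi.
  have y0 : 0 <= r * enorm xi by rewrite mulr_ge0 ?enorm_ge0// ltW.
  have v0 : 0 <= 8^-1 * u xi by rewrite mulr_ge0.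
  have h1 : (1 + (r * enorm xi) ^+ 2) ^+ d.+1 <= K * expR (8^-1 * u xi).
    apply: hK => // Yy; have := growth xi (le_trans YA Yy).
    move=> /(ler_wpM2l (ltW a10)); rewrite -uE powRM ?invr_ge0 ?(ltW A0)// => h.
    rewrite /q -mulrA -mulrBr ler_wpM2l//; apply: le_trans h.
    by apply: eq_ler; ring.
  have w0 : 0 < (1 + (r * enorm xi) ^+ 2) ^+ d.
    by rewrite exprn_gt0// ltr_pwDl// sqr_ge0.
  apply: (@le_trans _ _ (K * ((1 + (r * enorm xi) ^+ 2) ^+ d)^-1)).
    rewrite ler_pdivlMr// expRN mulrAC -exprS ler_pdivrMr ?expR_gt0//.
  by rewrite ler_wpM2l ?(ltW K0)//; exact: prodf_cauchyw_ge.
have iu s : 8^-1 <= s -> rint (leb d) (fun xi => expR (- (s * u xi))).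
  move=> s8; apply: (rint_dom _ (rintZ K (rint_prod_cauchyw d r0))).
    by apply: measurable_expRN_scale.
  move=> xi; rewrite ger0_norm ?expR_ge0// (le_trans _ (decay xi))//.
  apply: (@le_trans _ _ (1 * expR (- (8^-1 * u xi)))).
    by rewrite mul1r ler_expR lerN2 ler_wpM2r.
  by rewrite ler_wpM2r ?expR_ge0// lerDl sqr_ge0.
have main : c * (r ^+ d)^-1 <= \int[leb d]_xi (tphase N nu a1 t r x xi * expR (- u xi)).
  apply: core; split => //.
  - exact: measurable_tphase.
  - by move=> xi; exact: texp_le.
  - by move=> xi; exact: norm_tphase_le1.
  - by move=> xi; exact: tphase_ge.
  - by move=> k s s01 pk; exact: Int_tphase_ge0.
  - by move=> s y s12; apply: Int_texp_cos_ge0 => //; [|apply: iu]; lra.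
have nu0 (g : d.-tuple R -> R) : measurable_fun setT g -> (forall z, 0 <= g z) ->
    (a1%:E * \int[nu]_z (g z)%:E <= \int[N]_z (g z)%:E)%E.
  by apply: (integral_nu_le a10 nuN); rewrite ltW/=.
have cL : cint (levyexp N nu 0 t (ball1 r)).
  have i1 : rint (leb d) (fun xi => expR (- u xi)).
    by have := iu 1 _; under eq_fun do rewrite mul1r; apply; lra.
  have bnd xi : expR (- (t * (levyc N (ball1 r) xi - 0 * levyc nu (ball1 r) xi))) <= expR (- u xi).
    rewrite ler_expR lerN2 mul0r subr0 uE mulrCA ler_wpM2l ?(ltW t0)// -subr_ge0.
    exact: (levy_diff_ge0 r nu0 iN inu).
  have mN : measurable_fun setT (fun xi => expR (- (t * (levyc N (ball1 r) xi - 0 * levyc nu (ball1 r) xi)))).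
    apply: measurable_expRT; apply: measurableT_comp => //.
    apply: measurable_funM => //; apply: measurable_funB; first exact: measurable_levyc.
    by apply: measurable_funM => //; exact: measurable_levyc.
  have mS : measurable_fun setT (fun xi => t * levys N (ball1 r) xi).
    by apply: measurable_funM => //; exact: measurable_levys.
  split; apply: (rint_dom _ i1) => [|xi] /=.
  - by apply: measurable_funM => //; exact: measurable_cosT.
  - by rewrite normrM ger0_norm ?expR_ge0// (le_trans _ (bnd xi))// ler_piMr ?expR_ge0 ?cos_bound1.
  - by apply: measurable_funM => //; exact: measurable_sinT.
  - by rewrite normrM ger0_norm ?expR_ge0// (le_trans _ (bnd xi))// ler_piMr ?expR_ge0 ?sin_bound1.
have ftE : ft (levyexp N nu 0 t (ball1 r)) x =
    \int[leb d]_xi (tphase N nu a1 t r x xi * expR (- u xi)).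
  apply: eq_Int => xi; have := tphase_expR N nu a1 t r x xi 1.
  by rewrite subrr mul0r mul1r => ->.
have lower := levy_density_lower iN inu nusym dens t0 x r0 cL.
rewrite ftE in lower.
have eH : expR (- H) <= expR (- (t * \int[N]_z (1 - ball1 r z))).
  rewrite ler_expR lerN2 (le_trans _ tail)// ler_wpM2l ?(ltW t0)//.
  exact: Int_compl_ball1_le.
rewrite mulrAC ler_pdivrMr// (le_trans _ lower)// -mulrA.
apply: ler_pM => //; rewrite ?expR_ge0//.
by rewrite mulr_ge0 ?invr_ge0 ?exprn_ge0 ?(ltW c0) ?(ltW r0).
Qed.

End uniform.

(** * Choice of the reference frequency *)

Lemma hfun_inv_bound (R : realType) d (nu : {measure set d.-tuple R -> \bar R}) (T : R) :
  rint nu levy1 -> 0 < T ->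
  exists2 rmax : R, 0 < rmax & forall t r, 0 < t < T -> 0 < r ->
    hfun nu r = t^-1 -> r <= rmax.
Proof.
move=> inu T0; have iT : 0 < T^-1 by rewrite invr_gt0.
have /cvgrPdist_lt /(_ _ iT) [n _ hn] := hfun_cvg0 inu.
exists n.+1%:R => // t r /andP[t0 tT] r0 hr; rewrite leNgt; apply/negP => nr.
have h1 := hfun_anti inu (ltr0Sn R n) (ltW nr).
have := hn n (leqnn n); rewrite /= sub0r normrN ger0_norm ?hfun_ge0// => h2.
have : t^-1 < T^-1 by rewrite -hr (le_lt_trans h1).
by rewrite ltf_pV2 ?posrE// ltNge (ltW tT).
Qed.

Lemma rint_levy1 (R : realType) d (N : {measure set d.-tuple R -> \bar R}) :
  levy_measure N -> rint N levy1.
Proof.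
by case=> _ h; apply: rint_ge0; [exact: measurable_levy1|exact: levy1_ge0|].
Qed.

(** The value h_s^{-1}(1/t) is represented by a positive solution r of h_s(r) = 1/t. Both parts come
    from the same uniform bound and differ only in the reference frequency chosen for r. *)
Theorem theorem4p3 (R : realType) (d : nat) (T3 : \bar R) (c3 a3 : R)
  (nus : {measure set d.-tuple R -> \bar R}) (a1 a2 : R) :
  (0 < d)%N ->
  (0 < T3)%E -> 0 < c3 <= 1 -> 0 < a3 <= 2 ->
  levy_measure nus -> symmetric_measure nus ->
  0 < a1 <= 1 -> 1 <= a2 ->
  (* finite horizon T *)
  (forall T theta : R, 0 < T -> 0 < theta ->
   exists2 c : R, 0 < c &
   forall (N : {measure set d.-tuple R -> \bar R}) (b : d.-tuple R)
          (p : R -> d.-tuple R -> R),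
     levy_measure N ->
     cond_C3 N T3 c3 a3 ->
     (forall B : set (d.-tuple R), measurable B -> (a1%:E * nus B <= N B)%E) ->
     (forall x : d.-tuple R, einv T3 < enorm x -> RePsi N x <= a2 * RePsi nus x) ->
     levy_density N b p ->
     forall (t r : R) (x : d.-tuple R),
       0 < t < T -> 0 < r -> hfun nus r = t^-1 ->
       enorm x <= theta * r ->
       c * (r ^+ d)^-1 <= p t (vadd x (vscale t (bshift N b r)))) /\
  (* T3 = oo : T = oo allowed *)
  (T3 = +oo%E ->
   forall theta : R, 0 < theta ->
   exists2 c : R, 0 < c &
   forall (N : {measure set d.-tuple R -> \bar R}) (b : d.-tuple R)
          (p : R -> d.-tuple R -> R),
     levy_measure N ->
     cond_C3 N T3 c3 a3 ->
     (forall B : set (d.-tuple R), measurable B -> (a1%:E * nus B <= N B)%E) ->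
     (forall x : d.-tuple R, einv T3 < enorm x -> RePsi N x <= a2 * RePsi nus x) ->
     levy_density N b p ->
     forall (t r : R) (x : d.-tuple R),
       0 < t -> 0 < r -> hfun nus r = t^-1 ->
       enorm x <= theta * r ->
       c * (r ^+ d)^-1 <= p t (vadd x (vscale t (bshift N b r)))).
Proof.
move=> d0 T30 c301 a302 levy_nu sym_nu a101 a21.
have c30 : 0 < c3 by case/andP: c301.
have a30 : 0 < a3 by case/andP: a302.
have a20 : 0 < a2 by exact: lt_le_trans a21.
have inu := rint_levy1 levy_nu.
have unif A theta (P : R -> Prop) (Q : R -> R) : 1 <= A -> 0 < theta ->
    (forall t r, 0 < t -> P t -> 0 < r -> hfun nus r = t^-1 ->
      [/\ 0 < Q r, einv T3 < Q r & 1 <= Q r * r <= A]) ->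
    exists2 c : R, 0 < c & forall (N : {measure set d.-tuple R -> \bar R})
      (b : d.-tuple R) (p : R -> d.-tuple R -> R),
    levy_measure N -> cond_C3 N T3 c3 a3 ->
    (forall B : set (d.-tuple R), measurable B -> (a1%:E * nus B <= N B)%E) ->
    (forall x : d.-tuple R, einv T3 < enorm x -> RePsi N x <= a2 * RePsi nus x) ->
    levy_density N b p ->
    forall (t r : R) (x : d.-tuple R), 0 < t -> P t -> 0 < r -> hfun nus r = t^-1 ->
      enorm x <= theta * r ->
    c * (r ^+ d)^-1 <= p t (vadd x (vscale t (bshift N b r))).
  move=> A1 th0 hQ; have [c c0 H] := uniform_density_lower d0 c30 a30 a101 a20 A1 th0.
  exists c => // N b p levy_N hC3 nuN RePsi_le dens t r x t0 Pt r0 hr xr.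
  have [Q0 TQ QA] := hQ t r t0 Pt r0 hr.
  (* The packed measures are convertible to the given ones, so every hypothesis transfers
     unchanged. *)
  exact: (H (sigma_finite_pack (levy_sigma_finite levy_N))
    (sigma_finite_pack (levy_sigma_finite levy_nu)) T3 b p (rint_levy1 levy_N)
    inu sym_nu hC3 nuN RePsi_le dens t r (Q r) x).
have inv_scale (r : R) : 0 < r -> 0 < r^-1 /\ r^-1 * r = 1.
  by move=> r0; rewrite invr_gt0 mulVf// gt_eqF.
(* For T3 infinite every positive frequency is admissible: Q = 1/r and A = 1, for all t. *)
split; last first.
  move=> T3oo theta th0.
  have [|c c0 H] := unif 1 theta (fun=> True) (@GRing.inv R) (lexx 1) th0.
    by move=> t r _ _ /inv_scale[ri ->] _; rewrite T3oo lexx.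
  by exists c => // N b p lN hC hn hR hd t r x t0; exact: H.
move=> T theta T0 th0; have [rmax rmax0 hr_] := hfun_inv_bound inu T0.
(* A finite stand-in for T3; when T3 is infinite it exceeds every r that occurs, so that only the
   case Q = 1/r is met. *)
pose tau := if T3 is tau%:E then tau else rmax + 1.
have tau0 : 0 < tau by rewrite /tau; case: (T3) T30 => [s||]; rewrite ?lte_fin//; lra.
have tauE : einv T3 <= tau^-1.
  by rewrite /tau; case: (T3) => //=; rewrite invr_ge0; lra.
have A1 : 1 <= Num.max 1 (2 * rmax / tau) by rewrite le_max lexx.
(* For r < tau, Q = 1/r is admissible. Otherwise Q = 2/tau, with 2 in place of 1 because
   admissibility is a strict inequality, and Qr is at most 2 rmax / tau. *)
have [|c c0 H] := unif _ theta (fun t => t < T)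
    (fun r => if r < tau then r^-1 else 2 / tau) A1 th0.
  move=> t r t0 tT r0 hr; have [ri rV] := inv_scale r r0.
  have [rt|tr] := ltP r tau.
    by split=> //; [rewrite (le_lt_trans tauE)// ltf_pV2|rewrite rV lexx].
  have Q0 : 0 < 2 / tau by rewrite divr_gt0.
  split=> //.
    by rewrite (le_lt_trans tauE)// -[ltLHS]mul1r ltr_pM2r ?invr_gt0// ltr1n.
  apply/andP; split; first by rewrite mulrAC ler_pdivlMr// mul1r; lra.
  rewrite le_max mulrAC; apply/orP; right.
  rewrite ler_wpM2r ?invr_ge0 ?(ltW tau0)// ler_wpM2l//.
  by apply: hr_ hr => //; rewrite t0.
by exists c => // N b p lN hC hn hR hd t r x /andP[t0 tT]; exact: H.
Qed.
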